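(* Let $n\ge 2$ be an integer and let $p_n=\frac{2(n+1)}{n-1}$. For every $p\in(2,p_n]$ there is a constant $C_{n,p}\ge 1$, depending only on $n$ and $p$, such that the following holds. For each integer $k\ge 1$ there is an orthonormal basis $\{u_j\}_{j=1}^{N_k}$ of $\mathbb{SH}_k^n$ such that, for all $j=1,\dots,N_k$ and all $p$ with $2<p\le p_n$, $$C_{n,p}^{-1}\,k^{\frac{n-1}{4}-\frac{n-1}{2p}}\le\|u_j\|_{L^p(\mathbb{S}^n)}\le C_{n,p}\,k^{\frac{n-1}{4}-\frac{n-1}{2p}}.$$ (The basis may depend on $k$ and $n$ but is the same for all $p\in(2,p_n]$.)
   Context: $\mathbb{S}^n\subset\mathbb{R}^{n+1}$ is the unit sphere with the round metric. Its Riemannian volume measure $dy$ is normalized to be a probability measure, and all $L^p(\mathbb{S}^n)$ norms and the $L^2$ inner product (with respect to which ''orthonormal'' is understood) are taken with respect to it. $\mathbb{SH}_k^n$ denotes the space of spherical harmonics of degree $k$ on $\mathbb{S}^n$, that is, the restrictions to $\mathbb{S}^n$ of harmonic homogeneous polynomials of degree $k$ in $\mathbb{R}^{n+1}$ (complex-valued, with $\langle u,v\rangle=\int_{\mathbb{S}^n}u\overline{v}\,dy$), and $N_k=\dim\mathbb{SH}_k^n$. *)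

(* Defs.v *)
From HB Require Import structures.
From mathcomp Require Import all_boot all_order all_algebra perm.
From mathcomp Require Import all_classical all_reals all_analysis.
From mathcomp Require Import measurable_realfun.
From mathcomp Require Import complex.
From mathcomp Require mpoly.
(* The notations of mpoly clash with those of mathcomp-analysis. *)
Import (coercions, canonicals) mpoly.
Import Order.TTheory GRing.Theory Num.Theory.
Import numFieldNormedType.Exports.

Set Implicit Arguments.
Unset Strict Implicit.
Unset Printing Implicit Defensive.

Local Open Scope classical_set_scope.
Local Open Scope ring_scope.
Local Open Scope complex_scope.

Section lebesgue_tuple.
Context {R : realType}.

Definition tcons n (p : measurableTypeR R * n.-tuple R) : n.+1.-tuple R :=
  [tuple of p.1 :: p.2].

Lemma measurable_tcons n : measurable_fun setT (@tcons n).
Proof.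
exact: (@measurable_cons _ _ _ R fst n snd measurable_fst measurable_snd).
Qed.

HB.instance Definition _ n :=
  isMeasurableFun.Build _ _ _ _ (@tcons n) (@measurable_tcons n).

Section step.
Variables (n : nat) (mu : {sigma_finite_measure set (n.-tuple R) -> \bar R}).

Definition lebesgue_step : set (n.+1.-tuple R) -> \bar R :=
  pushforward (@lebesgue_measure R \x mu)%E (@tcons n).

Let step0 : lebesgue_step set0 = 0%E.
Proof. exact: measure0. Qed.

Let step_ge0 A : (0 <= lebesgue_step A)%E.
Proof. exact: measure_ge0. Qed.

Let step_sigma_additive : semi_sigma_additive lebesgue_step.
Proof. exact: measure_semi_sigma_additive. Qed.

HB.instance Definition _ := isMeasure.Build _ _ _ lebesgue_step
  step0 step_ge0 step_sigma_additive.

Let step_sigma_finite : sigma_finite setT lebesgue_step.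
Proof.
have /sigma_finiteP[F [FT ndF Foo]] := sigma_finiteT (@lebesgue_measure R).
have /sigma_finiteP[G [GT ndG Goo]] := sigma_finiteT mu.
pose g (x : n.+1.-tuple R) : measurableTypeR R * n.-tuple R :=
  (thead x, [tuple of behead x]).
have mg : measurable_fun setT g.
  apply: measurable_fun_pair; last exact: measurable_behead.
  exact: (@measurable_tnth _ R _ ord0).
have gK : cancel (@tcons n) g.
  by case=> a t; congr pair; apply/val_inj.
exists (fun k => g @^-1` (F k `*` G k)).
  rewrite -preimage_bigcup; apply/seteqP; split=> // x _.
  have : [set: R] (g x).1 by []. rewrite FT => -[i _ Fi].
  have : [set: n.-tuple R] (g x).2 by []. rewrite GT => -[j _ Gj].
  exists (maxn i j) => //; split.
    by move: (g x).1 Fi; exact/subsetPset/ndF/leq_maxl.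
  by move: (g x).2 Gj; exact/subsetPset/ndG/leq_maxr.
move=> k; have [mF Fk] := Foo k; have [mG Gk] := Goo k; split.
  by rewrite -[X in measurable X]setTI; apply: mg => //; exact: measurableX.
rewrite /lebesgue_step /pushforward -comp_preimage.
rewrite (_ : g \o @tcons n = id) ?preimage_id; last exact/funext.
by rewrite product_measure1E// lte_mul_pinfty// ge0_fin_numE.
Qed.

HB.instance Definition _ := Measure_isSigmaFinite.Build _ _ _ lebesgue_step
  step_sigma_finite.

End step.

(* n-dimensional Lebesgue measure on the Borel sets of R^n = n.-tuple R, as the
   iterated product of lebesgue_measure. *)
Fixpoint lebesgue_tuple n : {sigma_finite_measure set (n.-tuple R) -> \bar R} :=
  match n with
  | 0 => dirac [tuple]
  | m.+1 => lebesgue_step (lebesgue_tuple m)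
  end.

End lebesgue_tuple.
Arguments lebesgue_tuple R n : clear implicits.

Definition sqnorm {R : realType} n (x : n.-tuple R) : R :=
  \sum_(i < n) tnth x i ^+ 2.

(* S^n, with n the dimension of the manifold: unit vectors of R^(n+1). *)
Record sphere (R : realType) (n : nat) := Sphere {
  sphere_val :> n.+1.-tuple R;
  _ : sqnorm sphere_val == 1 }.

HB.instance Definition _ R n := [isSub for @sphere_val R n].
HB.instance Definition _ R n := [Choice of sphere R n by <:].

Section sphere_measure.
Context {R : realType} {n : nat}.

Lemma north_subproof : sqnorm [tuple of 1 :: nseq n (0 : R)] == 1.
Proof.
rewrite /sqnorm big_ord_recl /= expr1n big1 ?addr0// => i _.
by rewrite tnthS (tnth_nth 0) /= nth_nseq if_same expr0n.
Qed.

HB.instance Definition _ := isPointed.Build (sphere R n) (Sphere north_subproof).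

(* The trace of the Borel sigma-algebra of R^(n+1). *)
HB.instance Definition _ := Measurable.copy (sphere R n)
  (g_sigma_algebra_preimageType (@sphere_val R n)).

End sphere_measure.

Section riemannian_volume.
Context {R : realType} {n : nat}.
Implicit Types (t : n.-tuple R) (b : bool).

(* Graph parametrization t |-> (+- h(t), t), h(t) = sqrt (1 - |t|^2), of the
   open hemispheres x_0 > 0 (b = false) and x_0 < 0 (b = true) by the open unit
   ball; the value of insubd outside of the ball is irrelevant. *)
Definition chart b t : sphere R n :=
  insubd (point : sphere R n) [tuple of (-1) ^+ b * Num.sqrt (1 - sqnorm t) :: t].

(* The metric induced by R^(n+1) in these coordinates:
   g_ij = <d_i chart, d_j chart> = delta_ij + (d_i h) (d_j h), where
   d_i h = - t_i / h. *)
Definition round_metric t : 'M[R]_n :=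
  \matrix_(i, j) ((i == j)%:R + tnth t i * tnth t j / (1 - sqnorm t)).

Definition hemisphere_volume b (A : set (sphere R n)) : \bar R :=
  (\int[lebesgue_tuple R n]_(t in chart b @^-1` A `&` [set t | sqnorm t < 1]%R)
    (Num.sqrt (\det (round_metric t)))%:E)%E.

Lemma measurable_sqnorm m : measurable_fun setT (@sqnorm R m).
Proof.
by apply: measurable_sum => i; apply: measurable_funX; exact: measurable_tnth.
Qed.

Lemma measurable_sqrt : measurable_fun setT (fun x : R => Num.sqrt x).
Proof. by apply: continuous_measurable_fun => x; exact: sqrt_continuous. Qed.

Lemma measurable_ball1 : measurable [set t : n.-tuple R | sqnorm t < 1].
Proof.
have : measurable_fun setT (fun t : n.-tuple R => sqnorm t < 1).
  by apply: measurable_fun_ltr => //; exact: measurable_sqnorm.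
by move=> /(_ measurableT [set true]); rewrite setTI; apply.
Qed.

Lemma measurable_chart b : measurable_fun setT (chart b).
Proof.
pose c t := [tuple of (-1) ^+ b * Num.sqrt (1 - sqnorm t) :: t].
have mc : measurable_fun setT c.
  apply: (@measurable_cons _ _ _ R _ n id) => //.
  apply: measurable_funM => //; apply: (measurableT_comp measurable_sqrt).
  by apply: measurable_funB => //; exact: measurable_sqnorm.
have mv : measurable_fun setT (fun t => sphere_val (chart b t)).
  rewrite (_ : (fun t => _) =
      fun t => if sqnorm (c t) == 1 then c t else sphere_val (point : sphere R n)).
    apply: measurable_fun_ifT => //.
    apply: measurable_fun_eqr => //.
    by apply: measurableT_comp => //; exact: measurable_sqnorm.
  by apply/funext => t; rewrite /chart val_insubd.
move=> _ _ [B mB <-]; rewrite setTI.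
by have := mv measurableT B mB; rewrite setTI setTI.
Qed.

Lemma measurable_volume_density :
  measurable_fun [set t : n.-tuple R | sqnorm t < 1] (fun t => Num.sqrt (\det (round_metric t))).
Proof.
pose h t := \sum_(s : {perm 'I_n}) (-1) ^+ s *
  \prod_(i < n) ((i == s i)%:R + tnth t i * tnth t (s i) * (1 - sqnorm t) `^ (-1)).
apply: (@eq_measurable_fun _ _ _ _ _ (fun t => Num.sqrt (h t))).
  move=> t; rewrite inE /= => t1; congr Num.sqrt.
  apply: eq_bigr => s _; congr (_ * _); apply: eq_bigr => i _.
  by rewrite mxE powR_inv1// subr_ge0 ltW.
apply: measurable_funTS; apply: (measurableT_comp measurable_sqrt).
apply: measurable_sum => s; apply: measurable_funM => //.
apply: measurable_prod => i _; apply: measurable_funD => //.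
apply: measurable_funM.
  by apply: measurable_funM; exact: measurable_tnth.
apply: (measurableT_comp (measurable_powR _)).
by apply: measurable_funB => //; exact: measurable_sqnorm.
Qed.

Section measure.
Variable b : bool.

Let volume0 : hemisphere_volume b set0 = 0%E.
Proof. by rewrite /hemisphere_volume preimage_set0 set0I integral_set0. Qed.

Let volume_ge0 A : (0 <= hemisphere_volume b A)%E.
Proof. by apply: integral_ge0 => t _; rewrite lee_fin sqrtr_ge0. Qed.

Let volume_sigma_additive : semi_sigma_additive (hemisphere_volume b).
Proof.
move=> F mF tF mUF; rewrite /hemisphere_volume preimage_bigcup setI_bigcupl.
have mE k : measurable (chart b @^-1` F k `&` [set t : n.-tuple R | sqnorm t < 1]).
  apply: measurableI; last exact: measurable_ball1.
  by rewrite -[X in measurable X]setTI; exact: measurable_chart.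
rewrite ge0_integral_bigcup//.
- by apply: is_cvg_ereal_nneg_natsum_cond => k _ _; exact: volume_ge0.
- apply/measurable_EFinP; apply: measurable_funS measurable_volume_density => //.
  + exact: measurable_ball1.
  + by move=> t [k _ []].
- apply/trivIsetP => i j _ _ ij.
  rewrite setIACA -preimage_setI.
  by move/trivIsetP : tF => /(_ _ _ _ _ ij) ->//; rewrite preimage_set0 set0I.
Qed.

HB.instance Definition _ := isMeasure.Build _ _ _ (hemisphere_volume b)
  volume0 volume_ge0 volume_sigma_additive.

End measure.

(* sqrt (det g) dt in the two charts; they miss only the equator x_0 = 0,
   a submanifold of codimension 1, which is a null set. *)
Definition riemannian_volume : {measure set (sphere R n) -> \bar R} :=
  measure_add (hemisphere_volume false) (hemisphere_volume true).

(* riemannian_volume / riemannian_volume(S^n); the second argument of mnormalize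
   is a default for measures of total mass 0 or +oo, hence it is not used. *)
Definition sphere_measure : probability (sphere R n) R :=
  mnormalize riemannian_volume (dirac point).

End riemannian_volume.

Definition laplacian (K : nzRingType) m (p : mpoly.mpoly m K) : mpoly.mpoly m K :=
  \sum_(i < m) mpoly.mderiv i (mpoly.mderiv i p).

Section function_spaces.
Context {T : Type} {K : nzRingType}.

Definition is_basis (V : set (T -> K)) N (b : 'I_N -> T -> K) : Prop :=
  (forall j, V (b j)) /\
  (forall v, V v -> exists! c : {ffun 'I_N -> K},
     v = fun x => \sum_(j < N) c j * b j x).

(* All bases of V have the same size when K is a field; the default 0 is for
   V without a finite basis. *)
Definition dimension (V : set (T -> K)) : nat :=
  xget 0%N [set N | exists b : 'I_N -> T -> K, is_basis V b].

End function_spaces.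

Section spherical_harmonics.
Context {R : realType} {n : nat}.
Local Notation C := R[i].

Definition spherical_harmonic (k : nat) : set (sphere R n -> C) :=
  [set u | exists2 p : mpoly.dhomog n.+1 C k,
     laplacian p = 0 &
     u = fun x : sphere R n => mpoly.meval (fun i => (tnth x i)%:C) p].

Definition sphere_integral (f : sphere R n -> C) : C :=
  Complex
    (\int[sphere_measure]_x complex.Re (f x))
    (\int[sphere_measure]_x complex.Im (f x)).

Definition inner_product (u v : sphere R n -> C) : C :=
  sphere_integral (fun x => u x * conjc (v x)).

Definition orthonormal_family N (u : 'I_N -> sphere R n -> C) : Prop :=
  forall i j, inner_product (u i) (u j) = (i == j)%:R.

Definition Lp_norm (p : R) (u : sphere R n -> C) : \bar R :=
  Lnorm sphere_measure p%:E (fun x => (Normc.normc (u x))%:E).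

End spherical_harmonics.

Arguments spherical_harmonic R n k : clear implicits.

(* Main.v *)
(* Let nu = n - 1 and X = k^(nu/4). It suffices to find an orthonormal basis all
   of whose elements u satisfy int |u|^6 <= A X^4 and |<u, Q>| >= 1/A for some
   Gaussian beam Q, that is, a normalized multiple of (b.x)^k with b.b = 0: the
   upper bound follows by interpolation between L^2 and L^6, as p_n <= 6, and
   the lower one by duality, as int |Q| <= A/X and |Q| <= A X.

   The inner product of two beams is (b.conj(b')/2)^k. For vectors b on a grid of
   mesh k^(-1/2) this gives a family of beams with an almost diagonal Gram
   matrix, whose size is at least a fixed fraction of N_k = O(k^nu). Gram-Schmidt
   makes it orthonormal with bounded coefficients. In its orthogonal complement,
   a basis f_j is replaced by the discrete Fourier transform of (+-f_j); as
   sum_j |f_j|^2 <= N_k pointwise, a suitable choice of signs makes the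
   sixth moments O(N_k). Finally, a Householder reflection in each of
   boundedly small groups, consisting of one beam and of flat vectors, gives
   every vector of the basis a component along a beam. *)
Require Import Defs.
From HB Require Import structures.
From mathcomp Require Import all_boot all_order all_algebra perm.
From mathcomp Require Import all_classical all_reals all_analysis.
From mathcomp Require Import measurable_realfun.
From mathcomp Require Import cyclic separable cyclotomic.
From mathcomp Require Import complex ring lra zify.
From mathcomp Require mpoly.
Import Order.TTheory GRing.Theory Num.Theory.
Import numFieldNormedType.Exports.

Set Implicit Arguments.
Unset Strict Implicit.
Unset Printing Implicit Defensive.

Local Open Scope ring_scope.

(** * Linear algebra in the space of coefficients *)

Section complex_modulus.
Context {R : rcfType}.
Local Notation C := R[i].
Local Notation nrm := (@Normc.normc R).

(** Beams already have the right norms, but almost orthonormal beams span only part of the space.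
    The remaining vectors, built with random signs, are controlled from above only: their Lp norms
    may stay bounded. Hence each of them has to borrow a component from a beam. Changes of basis are
    measured by the l1 norms of their rows, because the triangle inequality in L^6 then gives
    constants independent of k. In the random step the sixth moments are merely summed over all
    rows; the factor of order N_k that this loses is affordable, since beams themselves have sixth
    moments of order k^nu. The integral enters the algebra through a positive normalized functional
    E with E(x_j (n + euler) p) = E(D_j p). This identity yields the inner products of beams, the
    definiteness of the inner product, and, with infinitesimal rotations in place of the rotation
    group, the constancy of sum_j |f_j|^2. Of the dimension only an upper bound is computed; the
    number of beams is capped at about half of N_k. *)

Lemma normcE (z : C) : `|z| = (nrm z)%:C%C. Proof. by []. Qed.

Lemma normc_ge0 (z : C) : 0 <= nrm z.
Proof. by rewrite -ler0c -normcE. Qed.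

Lemma normc_conj (z : C) : nrm z^* = nrm z.
Proof. by apply: (@complexI R); rewrite -!normcE norm_conjC. Qed.

Lemma normc_sum (I : Type) (r : seq I) (P : pred I) (F : I -> C) :
  nrm (\sum_(i <- r | P i) F i) <= \sum_(i <- r | P i) nrm (F i).
Proof.
elim/big_ind2 : _ => [|a b c d ab cd|//]; first by rewrite Normc.normc0.
by rewrite (le_trans (le_normcD _ _))// lerD.
Qed.

Lemma normc_real (x : R) : 0 <= x -> nrm x%:C%C = x.
Proof. by move=> x0; rewrite /= expr0n addr0 sqrtr_sqr ger0_norm. Qed.

Lemma normc_sqr (z : C) : (nrm z ^+ 2)%:C%C = z * z^*.
Proof. by rewrite -normCK rmorphXn. Qed.

Lemma normcX (z : C) k : nrm (z ^+ k) = nrm z ^+ k.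
Proof.
elim: k => [|k IH]; first by rewrite !expr0 Normc.normc1.
by rewrite !exprS Normc.normcM IH.
Qed.
End complex_modulus.

Local Open Scope sesquilinear_scope.

Section gram_schmidt.
Context {R : rcfType}.
Local Notation C := R[i].
Local Notation nrm := (@Normc.normc R).

(** In [c = b - c *m (G - 1)] the last term has at most a quarter of the l1 norm of [c], by the row
    sums of [G]. So passing from [b] to [c] costs a factor 4/3, whatever the size [M]. *)
Lemma dominant_l1 M (G : 'M[C]_M) (b c : 'rV[C]_M) :
  (forall i, G i i = 1) -> (forall i, \sum_(j | j != i) nrm (G i j) <= 1 / 4) ->
  b = c *m G -> \sum_j nrm (b 0 j) <= 1 / 4 -> \sum_j nrm (c 0 j) <= 1 / 3.
Proof.
move=> G1 Gd bc b4.
suff : \sum_j nrm (c 0 j) <= \sum_j nrm (b 0 j) + 1 / 4 * \sum_j nrm (c 0 j) by lra.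
apply: (@le_trans _ _ (\sum_j (nrm (b 0 j) + \sum_(l | l != j) nrm (c 0 l) * nrm (G l j)))).
  apply: ler_sum => j _.
  have -> : c 0 j = b 0 j - \sum_(l | l != j) c 0 l * G l j.
    by rewrite bc mxE (bigD1 j)//= G1 mulr1 addrK.
  rewrite (le_trans (le_normcD _ _))// lerD2l normcN (le_trans (normc_sum _ _ _))//.
  by apply: ler_sum => l _; rewrite Normc.normcM.
rewrite big_split lerD2l /= (exchange_big_dep xpredT) //= mulr_sumr; apply: ler_sum => l _.
rewrite -mulr_sumr mulrC ler_wpM2r ?normc_ge0//.
by rewrite (le_trans _ (Gd l))//; under eq_bigl do rewrite eq_sym.
Qed.

(** Induction that orthonormalizes the later rows first, so that the new row is [q] minus its
    projection. The l1 bound on the rows of [T] does not depend on [M] and later controls sixth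
    moments; the last clause keeps each new vector correlated with the row it came from. *)
Lemma gram_schmidt_dominant M N (Q : 'M[C]_(M, N)) :
  (forall i, (Q *m Q ^t*) i i = 1) ->
  (forall i, \sum_(j | j != i) nrm ((Q *m Q ^t*) i j) <= 1 / 4) ->
  exists T : 'M[C]_M, [/\ T \in unitmx, T *m Q \is unitarymx,
    forall i, \sum_j nrm (T i j) <= 2 &
    forall i, 1 / 2 <= nrm ((T *m Q *m Q ^t*) i i)].
Proof.
elim: M Q => [|M IH] Q Q1 Qd.
  exists 1%:M; split; [exact: unitmx1| |by case|by case].
  by apply/unitarymxP/matrixP => -[].
rewrite -[M.+1]/(1 + M)%N in Q Q1 Qd *.
pose q := usubmx Q; pose P := dsubmx Q.
have QE : Q = col_mx q P by rewrite vsubmxK.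
have GE : Q *m Q ^t* = block_mx (q *m q ^t*) (q *m P ^t*) (P *m q ^t*) (P *m P ^t*).
  by rewrite QE tr_col_mx map_row_mx mul_col_row.
have P1 i : (P *m P ^t*) i i = 1.
  by have := Q1 (rshift 1 i); rewrite GE block_mxEdr.
have Pd i : \sum_(j | j != i) nrm ((P *m P ^t*) i j) <= 1 / 4.
  apply: le_trans (Qd (rshift 1 i)); rewrite big_split_ord /=.
  rewrite -[leLHS]add0r lerD//; first by apply: sumr_ge0 => j _; exact: normc_ge0.
  rewrite GE; under [leRHS]eq_bigr do rewrite block_mxEdr.
  by rewrite (eq_bigl (fun j => j != i))// => j; rewrite (inj_eq (@rshift_inj _ _)).
have [T [Tu Wu T2 TW]] := IH P P1 Pd.
(* [c *m P] is the orthogonal projection of [q] to the row space of [P]. The orthonormal [W] gives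
   the formula for [c]; its size comes from [dominant_l1], since [q *m P ^t*] is [c] times the Gram
   matrix of [P]. *)
pose W := T *m P; pose c := q *m W ^t* *m T; pose r := q - c *m P.
have PE : P = invmx T *m W by rewrite /W mulKmx.
have rW : r *m W ^t* = 0.
  rewrite /r mulmxBl /c -!mulmxA [T *m (P *m _)]mulmxA -/W (unitarymxP _)// mulmx1.
  by rewrite subrr.
have rP : r *m P ^t* = 0 by rewrite PE trmx_mul map_mxM mulmxA rW mul0mx.
have b4 : \sum_j nrm ((q *m P ^t*) 0 j) <= 1 / 4.
  apply: le_trans (Qd (lshift M 0)); rewrite big_split_ord /= [X in _ <= X + _]big_pred0 ?add0r; last first.
    by move=> j /=; rewrite ord1 eqxx.
  rewrite GE; under [leRHS]eq_bigr do rewrite block_mxEur.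
  by rewrite le_eqVlt; apply/orP; left; apply/eqP/eq_bigl.
have c3 : \sum_j nrm (c 0 j) <= 1 / 3.
  apply: (@dominant_l1 _ (P *m P ^t*) (q *m P ^t*)) => //.
  by apply/eqP; rewrite mulmxA -subr_eq0 -mulmxBl rP.
have rr : r *m r ^t* = r *m q ^t*.
  rewrite {2}/r linearB /= map_mxB mulmxBr trmx_mul map_mxM mulmxA rP mul0mx subr0 //.
(* The squared length of [r] differs from 1 by the inner product of [c *m P] with [q], so by at most
   1/3 * 1/4. *)
pose rho : R := \sum_j nrm (r 0 j) ^+ 2.
have rhoE : (r *m r ^t*) 0 0 = rho%:C%C.
  by rewrite mxE rmorph_sum; apply: eq_bigr => j _; rewrite !mxE -normc_sqr.
have rho12 : nrm (rho%:C%C - 1) <= 1 / 12.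
  have q1 : (q *m q ^t*) 0 0 = 1 by have := Q1 (lshift M 0); rewrite GE block_mxEul.
  have -> : rho%:C%C - 1 = - \sum_j c 0 j * ((P *m q ^t*) j 0).
    rewrite -rhoE rr /r mulmxBl mxE q1 addrAC subrr add0r mxE -mulmxA mxE.
    by congr (- _).
  rewrite normcN (le_trans (normc_sum _ _ _))//.
  apply: (@le_trans _ _ (\sum_j nrm (c 0 j) * (1 / 4))); last by rewrite -mulr_suml; lra.
  apply: ler_sum => j _; rewrite Normc.normcM ler_wpM2l ?normc_ge0//.
  have -> : (P *m q ^t*) j 0 = ((q *m P ^t*) 0 j)^*.
    by rewrite !mxE rmorph_sum; apply: eq_bigr => l _; rewrite !mxE [RHS]rmorphM /= conjCK mulrC.
  rewrite normc_conj; apply: le_trans b4; rewrite (bigD1 j)//= lerDl.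
  by apply: sumr_ge0 => l _; exact: normc_ge0.
have rhoB : 11 / 12 <= rho /\ rho <= 13 / 12.
  move: rho12; rewrite -[1]/((1 : R)%:C%C) -rmorphB /= expr0n addr0 sqrtr_sqr.
  by rewrite ler_norml => /andP[]; lra.
have [rho1 rho2] := rhoB.
pose s : R := (Num.sqrt rho)^-1.
have sr0 : 0 < Num.sqrt rho by rewrite sqrtr_gt0; lra.
have sr2 : Num.sqrt rho ^+ 2 = rho by rewrite sqr_sqrtr; lra.
have s0 : 0 < s by rewrite invr_gt0.
have srE : s * rho = Num.sqrt rho by rewrite /s -{2}sr2 expr2 mulKf// gt_eqF.
have ss : s * s * rho = 1 by rewrite -mulrA srE /s mulVf// gt_eqF.
have slt : s <= 12 / 11.
  rewrite -(@ler_pXn2r _ 2) ?nnegrE ?(ltW s0) ?divr_ge0//.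
  rewrite expr2; have : s * s * (11 / 12) <= s * s * rho by rewrite ler_wpM2l// mulr_ge0 ?ltW.
  by rewrite ss expr2; lra.
have srho : 1 / 2 <= s * rho.
  rewrite srE -(@ler_pXn2r _ 2) ?nnegrE ?sqrtr_ge0 ?divr_ge0//.
  by rewrite sr2 expr2; lra.
(* The first row has l1 norm at most [s * (1 + 1/3)], which is below 2, and the inner product of
   [s *: r] with [q] is [s * rho], the square root of [rho]. *)
pose T' : 'M[C]_(1 + M) := block_mx (s%:C%C)%:M (- (s%:C%C *: c)) 0 T.
have T'Q : T' *m Q = col_mx (s%:C%C *: r) W.
  rewrite /T' QE mul_block_col mul0mx add0r mul_scalar_mx mulNmx -scalemxAl -scalerBr //.
exists T'; split.
- rewrite unitmxE det_ublock det_scalar expr1 unitrM -unitmxE Tu andbT unitfE.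
  by rewrite -[0]/((0 : R)%:C%C) (inj_eq (@complexI _)) gt_eqF.
- apply/unitarymxP; rewrite T'Q tr_col_mx map_row_mx mul_col_row.
  have Wr : W *m r ^t* = 0.
    by rewrite -[W]trmxCK -map_mxM -trmx_mul rW trmx0 map_mx0.
  have cs : (s%:C%C *: r) ^t* = s%:C%C *: r ^t*.
    by apply/matrixP => i j; rewrite !mxE rmorphM; congr (_ * _); apply: conjc_real.
  rewrite cs -!scalemxAl -!scalemxAr Wr rW !scaler0 (unitarymxP _)// scalerA.
  rewrite [r *m _]mx11_scalar rhoE scale_scalar_mx -!rmorphM ss /=.
  by rewrite -scalar_mx_block.
- move=> i; case: (split_ordP i) => j ->; rewrite big_split_ord /=.
    under eq_bigr do rewrite block_mxEul.
    under [X in _ + X]eq_bigr do rewrite block_mxEur mxE mxE normcN Normc.normcM normc_real ?(ltW s0)//.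
    rewrite big_ord1 !ord1 mxE eqxx mulr1n normc_real ?(ltW s0)// -mulr_sumr.
    have : s * \sum_j nrm (c 0 j) <= s * (1 / 3) by rewrite ler_wpM2l// ltW.
    lra.
  under eq_bigr do rewrite block_mxEdl mxE Normc.normc0.
  under [X in _ + X]eq_bigr do rewrite block_mxEdr.
  by rewrite sumr_const mul0rn add0r.
- move=> i; rewrite T'Q QE tr_col_mx map_row_mx mul_col_row.
  case: (split_ordP i) => j ->; last by rewrite block_mxEdr -/P; exact: TW.
  rewrite block_mxEul !ord1 -scalemxAl mxE -rr rhoE -rmorphM normc_real//.
  by rewrite mulr_ge0 ?(ltW s0)//; lra.
Qed.
End gram_schmidt.
Local Close Scope sesquilinear_scope.

(** * Moments of sums with random signs *)

Section sign_sums.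
Variables (R : realFieldType) (I : eqType).

(* [sign_sum r a G v] is the sum of [G (v + sum_i (+-) a i)] over all choices of signs. *)
Fixpoint sign_sum (V W : zmodType) (r : seq I) (a : I -> V) (G : V -> W) (v : V) : W :=
  if r is i :: r' then sign_sum r' a G (v + a i) + sign_sum r' a G (v - a i) else G v.

Lemma sign_sum_comp (V V' W : zmodType) r (a : I -> V) (l : {additive V -> V'}) (G : V' -> W) v :
  sign_sum r a (G \o l) v = sign_sum r (l \o a) G (l v).
Proof. by elim: r v => //= i r IH v; rewrite !IH raddfD raddfB. Qed.

Lemma sign_sum_sum (V W : zmodType) (J : Type) (s : seq J) r (a : I -> V) (G : J -> V -> W) v :
  sign_sum r a (fun v => \sum_(j <- s) G j v) v = \sum_(j <- s) sign_sum r a (G j) v.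
Proof. by elim: r v => //= i r IH v; rewrite !IH -big_split. Qed.

Lemma le_sign_sum (V : zmodType) r (a : I -> V) (G H : V -> R) v :
  (forall v, G v <= H v) -> sign_sum r a G v <= sign_sum r a H v.
Proof. by move=> GH; elim: r v => //= i r IH v; rewrite lerD. Qed.

Lemma sign_sumD (V W : zmodType) r (a : I -> V) (G H : V -> W) v :
  sign_sum r a (fun v => G v + H v) v = sign_sum r a G v + sign_sum r a H v.
Proof. by elim: r v => //= i r IH v; rewrite !IH addrACA. Qed.

Lemma sign_sumZ (V : zmodType) r (a : I -> V) (G : V -> R) c v :
  sign_sum r a (fun v => c * G v) v = c * sign_sum r a G v.
Proof. by elim: r v => //= i r IH v; rewrite !IH mulrDr. Qed.

(** Method of conditional expectations: of the two halves of the sum, one is at most half of the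
    bound. As [r] has no repetitions, the sign at [i] can be set without disturbing the later
    ones. *)
Lemma sign_sum_exists (V : zmodType) r (a : I -> V) (G : V -> R) v B : uniq r ->
  sign_sum r a G v <= 2 ^+ size r * B ->
  exists eps : I -> bool, G (v + \sum_(i <- r) (if eps i then - a i else a i)) <= B.
Proof.
elim: r v => [|i r IH] v /=; first by move=> _; exists xpredT; rewrite big_nil addr0 -[B]mul1r.
move=> /andP[ir ur]; rewrite exprS => H.
have ext eps b : \sum_(j <- i :: r) (if (if j == i then b else eps j) then - a j else a j) =
    (if b then - a i else a i) + \sum_(j <- r) (if eps j then - a j else a j).
  rewrite big_cons eqxx; congr (_ + _); apply: eq_big_seq => j jr.
  by rewrite eq_sym (negbTE (memPnC ir j jr)).
have [h|h] := leP (sign_sum r a G (v + a i)) (2 ^+ size r * B).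
  have [eps He] := IH _ ur h; exists (fun j => if j == i then false else eps j).
  by rewrite ext addrA.
have {}h : sign_sum r a G (v - a i) <= 2 ^+ size r * B by lra.
have [eps He] := IH _ ur h; exists (fun j => if j == i then true else eps j).
by rewrite ext addrA.
Qed.

(* The bound is the sixth moment of a Gaussian of mean [x] and variance [sum_i a_i^2]. *)
Lemma sign_sum_pow6 r (a : I -> R) (x : R) (s := \sum_(i <- r) a i ^+ 2) :
  sign_sum r a (fun x => x ^+ 6) x <=
  2 ^+ size r * (x ^+ 6 + 15 * x ^+ 4 * s + 45 * x ^+ 2 * s ^+ 2 + 15 * s ^+ 3).
Proof.
rewrite {}/s; elim: r x => [|i r IH] x /=.
  by rewrite big_nil; lra.
rewrite big_cons; have t0 : 0 <= \sum_(j <- r) a j ^+ 2 by apply: sumr_ge0 => j _; exact: sqr_ge0.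
apply: le_trans (lerD (IH _) (IH _)) _.
move: (\sum_(j <- r) _) t0 (a i) => t t0 b.
rewrite [2 ^+ (size r).+1]exprSr -[leLHS]mulrDr -[leRHS]mulrA; apply: ler_wpM2l; first by rewrite exprn_ge0.
(* A sign times [b] has fourth and sixth moments b^4 and b^6, against 3 b^4 and 15 b^6 for the
   Gaussian of the same variance; the difference has nonnegative terms only. *)
rewrite -subr_ge0 [leRHS](_ : _ = 60 * (x ^+ 2 * (b ^+ 2) ^+ 2) + 28 * ((b ^+ 2) ^+ 3) + 60 * (t * (b ^+ 2) ^+ 2)); last by ring.
have b0 := sqr_ge0 b; have x0 := sqr_ge0 x.
have h1 := mulr_ge0 x0 (exprn_ge0 2 b0); have h2 := exprn_ge0 3 b0; have h3 := mulr_ge0 t0 (exprn_ge0 2 b0).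
by rewrite !addr_ge0// mulr_ge0.
Qed.
End sign_sums.

Section complex_sign_sums.
Context {R : rcfType} {I : eqType}.
Local Notation C := R[i].
Local Notation nrm := (@Normc.normc R).

Lemma normc_sqrE (z : C) : nrm z ^+ 2 = complex.Re z ^+ 2 + complex.Im z ^+ 2.
Proof. by case: z => a b /=; rewrite sqr_sqrtr// addr_ge0 ?sqr_ge0. Qed.

Lemma ReD (z w : C) : complex.Re (z + w) = complex.Re z + complex.Re w.
Proof. by case: z; case: w. Qed.
Lemma ImD (z w : C) : complex.Im (z + w) = complex.Im z + complex.Im w.
Proof. by case: z; case: w. Qed.
Fact Re_is_nmod : nmod_morphism (@complex.Re R).
Proof. by split=> [|z w]; rewrite ?ReD. Qed.
Fact Im_is_nmod : nmod_morphism (@complex.Im R).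
Proof. by split=> [|z w]; rewrite ?ImD. Qed.
Definition Re_additive : {additive C -> R} := HB.pack (@complex.Re R : C -> R) (GRing.isNmodMorphism.Build C R (@complex.Re R) Re_is_nmod).
Definition Im_additive : {additive C -> R} := HB.pack (@complex.Im R : C -> R) (GRing.isNmodMorphism.Build C R (@complex.Im R) Im_is_nmod).

(** (x^2 + y^2)^3 <= 4 (x^6 + y^6) separates real and imaginary parts, each of which contributes the
    Gaussian moment 15 s^3; this gives 60 = 4 * 15. The cubes of the two variances sum to at most
    the cube of their sum. *)
Lemma sign_sum_normc6 (r : seq I) (a : I -> C) :
  sign_sum r a (fun z => nrm z ^+ 6) 0 <= 2 ^+ size r * (60 * (\sum_(i <- r) nrm (a i) ^+ 2) ^+ 3).
Proof.
pose G x : R := x ^+ 6.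
apply: (@le_trans _ _ (4 * (sign_sum r a (G \o Re_additive) 0 + sign_sum r a (G \o Im_additive) 0))).
  rewrite -sign_sumD -sign_sumZ; apply: le_sign_sum => z; rewrite /G /=.
  rewrite -[6%N]/(2 * 3)%N !exprM normc_sqrE.
  move: (complex.Re z ^+ 2) (complex.Im z ^+ 2) (sqr_ge0 (complex.Re z)) (sqr_ge0 (complex.Im z)) => x y x0 y0.
  rewrite -subr_ge0 [leRHS](_ : _ = 3 * ((x + y) * (x - y) ^+ 2)); last by ring.
  by rewrite mulr_ge0// mulr_ge0 ?addr_ge0 ?sqr_ge0.
rewrite !sign_sum_comp.
have h (l : {additive C -> R}) (a' := l \o a) : sign_sum r a' G (l 0) <= 2 ^+ size r * (15 * (\sum_(i <- r) a' i ^+ 2) ^+ 3).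
  apply: le_trans (sign_sum_pow6 _ _ _) _; rewrite raddf0 ler_wpM2l ?exprn_ge0//.
  by rewrite !expr0n /= !mulr0 !mul0r !add0r.
apply: le_trans (ler_wpM2l _ (lerD (h _) (h _))) _ => //.
rewrite -mulrDr mulrCA ler_wpM2l ?exprn_ge0//.
have -> : \sum_(i <- r) nrm (a i) ^+ 2 = \sum_(i <- r) complex.Re (a i) ^+ 2 + \sum_(i <- r) complex.Im (a i) ^+ 2.
  by rewrite -big_split; apply: eq_bigr => i _; rewrite normc_sqrE.
have : 0 <= \sum_(i <- r) complex.Re (a i) ^+ 2 by apply: sumr_ge0 => i _; exact: sqr_ge0.
have : 0 <= \sum_(i <- r) complex.Im (a i) ^+ 2 by apply: sumr_ge0 => i _; exact: sqr_ge0.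
move: (\sum_(i <- r) _) (\sum_(i <- r) _) => x y x0 y0.
rewrite -subr_ge0 [leRHS](_ : _ = 180 * (x * y * (x + y))); last by ring.
by rewrite !mulr_ge0// addr_ge0.
Qed.
End complex_sign_sums.

Local Open Scope sesquilinear_scope.
Section flat_unitary.
Context {R : rcfType}.
Local Notation C := R[i].
Local Notation nrm := (@Normc.normc R).

Lemma prim_root_exists D : (0 < D)%N -> exists z : C, D.-primitive_root z.
Proof.
move=> D0; pose p : {poly C} := 'X^D - 1; have [r Dp] := closed_field_poly_normal p.
rewrite (monicP _) ?monicXnsubC// scale1r in Dp.
have rn1 : all D.-unity_root r by apply/allP => z; rewrite -root_prod_XsubC -Dp.
have sz_r : (D < (size r).+1)%N by rewrite -(size_prod_XsubC r id) -Dp size_XnsubC.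
have [|z] := hasP (has_prim_root D0 rn1 _ sz_r); last by exists z.
by rewrite -separable_prod_XsubC -Dp separable_Xn_sub_1// pnatr_eq0 -lt0n.
Qed.

(** The normalized Fourier matrix. Equal moduli of the entries make the variance of every row of
    [U *m diag_mx eps *m e] at a point x the same, namely D^-1 sum_j |e_j(x)|^2. *)
Lemma flat_unitary D : (0 < D)%N ->
  exists2 U : 'M[C]_D, U \is unitarymx & forall i j, nrm (U i j) ^+ 2 = D%:R^-1.
Proof.
move=> D0; have [z pz] := prim_root_exists D0.
have nz : `|z| = 1.
  apply/eqP; rewrite -(pexpr_eq1 D0 (normr_ge0 z)).
  by rewrite -normrX (prim_expr_order pz) normr1.
have z0 : z != 0 by rewrite -normr_eq0 nz oner_eq0.
have zc : z^* = z^-1.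
  by apply: (mulfI z0); rewrite -normCK nz expr1n divff.
pose s : R := (Num.sqrt D%:R)^-1.
have sD : s ^+ 2 = D%:R^-1 by rewrite exprVn sqr_sqrtr.
have s0 : 0 <= s by rewrite invr_ge0 sqrtr_ge0.
exists (\matrix_(i, j) (s%:C%C * z ^+ (i * j))); last first.
  move=> i j; rewrite mxE Normc.normcM normc_real// exprMn sD normcX.
  have -> : nrm z = 1 by apply: (@complexI R); rewrite -normcE nz.
  by rewrite !expr1n mulr1.
apply/unitarymxP/matrixP => i l; rewrite !mxE.
have cj m : (s%:C%C * z ^+ m)^* = s%:C%C * (z ^- m).
  by rewrite rmorphM rmorphXn /= -exprVn -zc; congr (_ * _); exact: conjc_real.
rewrite (eq_bigr (fun j : 'I_D => (D%:R^-1)%:C%C * (z ^+ i / z ^+ l) ^+ j)); last first.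
  move=> j _; rewrite !mxE cj mulrACA -rmorphM -expr2 sD !exprM -exprVn.
  by rewrite -[in RHS]exprVn exprMn -!exprVn.
rewrite -mulr_sumr; have [->|il] := eqVneq i l.
  rewrite mulfV ?expf_neq0//; under eq_bigr do rewrite expr1n.
  rewrite sumr_const card_ord /= rmorphV ?rmorph_nat ?mulVf ?pnatr_eq0 -?lt0n//.
  by rewrite unitfE pnatr_eq0 -lt0n.
set y := z ^+ i / z ^+ l.
have y1 : y - 1 != 0.
  rewrite subr_eq0; apply: contra il => /eqP yE.
  have : z ^+ i = z ^+ l by rewrite -[RHS]mul1r -yE mulfVK// expf_neq0.
  by move/eqP; rewrite (eq_prim_root_expr pz) !modn_small.
have : y ^+ D - 1 = 0.
  by rewrite expr_div_n -!exprM ![(_ * D)%N]mulnC !exprM (prim_expr_order pz) !expr1n divr1 subrr.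
by rewrite subrX1 => /eqP; rewrite mulf_eq0 (negbTE y1) /= => /eqP->; rewrite mulr0.
Qed.
End flat_unitary.

Section mixing.
Context {R : rcfType}.
Local Notation C := R[i].
Local Notation nrm := (@Normc.normc R).
Variables (N M : nat) (kap : 'I_N -> 'I_M) (sig : 'I_M -> 'I_N) (L : R).
Hypothesis sigK : cancel sig kap.
Hypothesis fiber_le : forall c, #|[set i | kap i == c]|%:R <= L.

(* A Householder reflection in each fiber of [kap], along the vector with entry 1
   at the base point [sig c] and 2 elsewhere; unlike those of the constant vector,
   its entries in the column of the base point never vanish. *)
Let Y i : R := if i == sig (kap i) then 1 else 2.
Let n2 c : R := \sum_(i | kap i == c) Y i ^+ 2.
Let H i j : R := (i == j)%:R - (if kap i == kap j then 2 * Y i * Y j / n2 (kap i) else 0).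

Let n2E c : n2 c = 4 * #|[set i | kap i == c]|%:R - 3.
Proof.
rewrite /n2 (bigD1 (sig c)) ?sigK//= {1}/Y sigK eqxx expr1n.
rewrite (eq_bigr (fun=> 4)) => [|i /andP[/eqP <- ne]]; last by rewrite /Y (negbTE ne) expr2; ring.
rewrite sumr_const (cardsD1 (sig c)) inE sigK eqxx natrD.
rewrite (_ : #|[set i | kap i == c] :\ sig c| = #|[pred i | (kap i == c) && (i != sig c)]|); last first.
  by apply: eq_card => i; rewrite !inE andbC.
by rewrite -[4 *+ _]mulr_natr /=; ring.
Qed.

Let card_fiber c : (0 < #|[set i | kap i == c]|)%N.
Proof. by apply/card_gt0P; exists (sig c); rewrite inE sigK. Qed.

Let n2_ge1 c : 1 <= n2 c.
Proof.
rewrite n2E; have : 1 <= #|[set i | kap i == c]|%:R :> R by rewrite ler1n.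
lra.
Qed.

Let Y_ge1 i : 1 <= Y i /\ Y i <= 2.
Proof. by rewrite /Y; case: ifP; rewrite ?lexx; lra. Qed.

(** In a fiber of g elements the squared length of [Y] is 4 g - 3. The base column has the entries 1
    - 2 / (4 g - 3), which is -1 for g = 1 and at least 3/5 otherwise, and -4 / (4 g - 3), of
    modulus at least 1/g. The row bound 5 is 1 + 4, because 2 Y_i Y_j <= 4 Y_j^2. *)
Lemma mixing_unitary : exists2 U : 'M[C]_N, U \is unitarymx &
  [/\ forall i j, kap i != kap j -> U i j = 0,
      forall i, \sum_j nrm (U i j) <= 5 &
      forall i, L^-1 <= nrm (U i (sig (kap i)))].
Proof.
have nrmR (x : R) : nrm x%:C%C = `|x| by rewrite /= expr0n addr0 sqrtr_sqr.
have n0 c : n2 c != 0 by rewrite gt_eqF// (lt_le_trans ltr01 (n2_ge1 c)).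
exists (\matrix_(i, j) (H i j)%:C%C).
  apply/unitarymxP/matrixP => i j; rewrite !mxE.
  under eq_bigr => l _.
    rewrite !mxE (_ : ((H j l)%:C%C)^* = (H j l)%:C%C); last exact: conjc_real.
    rewrite -rmorphM; over.
  rewrite -rmorph_sum -[RHS]/((i == j)%:R : C) -(rmorph_nat (real_complex R)); congr (_%:C%C).
  rewrite /H; under eq_bigr do rewrite mulrBl !mulrBr.
  rewrite !sumrB.
  have dl (F : 'I_N -> R) a : \sum_l (a == l)%:R * F l = F a.
    rewrite (bigD1 a)//= eqxx mul1r big1 ?addr0// => l; rewrite eq_sym => /negbTE->.
    by rewrite mul0r.
  rewrite (dl (fun l => (j == l)%:R)) (dl (fun l => if kap j == kap l then _ else 0)).
  under [X in _ - (X - _)]eq_bigr do rewrite mulrC.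
  rewrite (dl (fun l => if kap i == kap l then _ else 0)).
  have [kij|kij] := eqVneq (kap i) (kap j); last first.
    rewrite big1 ?subr0; last first.
      by move=> l _; case: eqP => [<-|_]; rewrite ?mul0r// eq_sym (negbTE kij) mulr0.
    by rewrite [j == i]eq_sym.
  rewrite kij.
  have -> : \sum_l (if kap j == kap l then 2 * Y i * Y l / n2 (kap j) else 0) *
     (if kap j == kap l then 2 * Y j * Y l / n2 (kap j) else 0) = 4 * Y i * Y j / n2 (kap j).
    under eq_bigr => l _.
      rewrite (_ : _ * _ = if kap l == kap j then (4 * Y i * Y j / n2 (kap j) ^+ 2) * Y l ^+ 2 else 0); last first.
        by rewrite eq_sym; case: ifP; rewrite ?mulr0// => _; field.
      over.
    rewrite -big_mkcond -mulr_sumr -/(n2 (kap j)).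
    by have := n0 (kap j); move: (n2 _) => x x0; field.
  rewrite [j == i]eq_sym; have := n0 (kap j); move: (n2 _) => x x0; field.
  by [].
split.
- move=> i j kij; rewrite mxE /H (negbTE kij) subr0 (_ : i == j = false) //.
  by apply: contraNF kij => /eqP->.
- move=> i; apply: (@le_trans _ _ (1 + \sum_(j | kap j == kap i) 4 * Y j ^+ 2 / n2 (kap i))).
    rewrite [X in _ <= _ + X]big_mkcond -[X in X + _](_ : \sum_j (i == j)%:R = 1); last first.
      by rewrite (bigD1 i)//= eqxx big1 ?addr0// => j; rewrite eq_sym => /negbTE->.
    rewrite -big_split /=; apply: ler_sum => j _; rewrite mxE nrmR /H.
    apply: le_trans (ler_normB _ _) _; apply: lerD; first by rewrite ger0_norm.
    rewrite [kap i == _]eq_sym; case: ifP => _; rewrite ?normr0//.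
    have [yi1 yi2] := Y_ge1 i; have [yj1 yj2] := Y_ge1 j.
    have ni : 0 < n2 (kap i) by rewrite (lt_le_trans ltr01).
    rewrite ger0_norm; last by rewrite divr_ge0 ?(ltW ni)// !mulr_ge0//; lra.
    rewrite ler_pM2r ?invr_gt0// expr2.
    have : Y i * Y j <= 2 * Y j by rewrite ler_wpM2r//; lra.
    have : 1 * Y j <= Y j * Y j by rewrite ler_wpM2r//; lra.
    lra.
  rewrite -mulr_suml -mulr_sumr -/(n2 _) mulfK//; lra.
- move=> i; rewrite mxE nrmR /H sigK eqxx {2}/Y sigK eqxx.
  have Lg := fiber_le (kap i); have := n2E (kap i); have := card_fiber (kap i).
  move: (n2 (kap i)) (#|_|) Lg => x g Lg g0 xE.
  have L1 : 1 <= L by rewrite (le_trans _ Lg)// ler1n.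
  have L0 : 0 < L by lra.
  have g1' : 1 <= g%:R :> R by rewrite ler1n.
  have x0 : 1 <= x by rewrite xE; lra.
  have [isig|isig] := eqVneq i (sig (kap i)).
    rewrite /Y -isig eqxx !mulr1 /=.
    have [g1|g2] := leqP g 1.
      have -> : x = 1 by rewrite xE (_ : g = 1%N); [ring|lia].
      rewrite divr1 (_ : 1 - 2 = -1 :> R); last by ring.
      by rewrite normrN1 invf_le1.
    have g2' : 2 <= g%:R :> R by rewrite ler_nat.
    have x5 : 5 <= x by lra.
    have h : 2 / x <= 2 / 5 by rewrite ler_pM2l// lef_pV2 ?posrE; lra.
    have h2 : L^-1 <= 1 / 2 by rewrite mul1r lef_pV2 ?posrE; lra.
    by rewrite ger0_norm; lra.
  rewrite /Y (negbTE isig) sub0r normrN !mulr1 ger0_norm; last by rewrite divr_ge0//; lra.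
  rewrite ler_pdivlMr; last lra.
  rewrite mulrC ler_pdivrMr//; lra.
Qed.
End mixing.
Local Close Scope sesquilinear_scope.

(** * The second moment of a Gaussian beam *)

Section beam_constant.
Variable F : numFieldType.

(** Equal to k! Gamma((n+1)/2) / Gamma(k + (n+1)/2); it will turn out to be the mean of |b.x|^(2k)
    over the n-sphere for b.b = 0 and |b|^2 = 2. *)
Definition beam_const n k : F := \prod_(j < k) (j.+1.*2%:R / (n + j.*2.+1)%:R).
End beam_constant.

Section beam_constant_bounds.
Variable R : realFieldType.

(** The factor (2j+2) / (2j+2+nu) of the beam constant telescopes into [nu] quotients of consecutive
    integers. Each resulting product [s i k] is of order k^(-1/2), so half-integral powers of k are
    reached through squares, without Gamma functions. *)
Let s i k : R := \prod_(j < k) ((j.*2 + 2 + i)%:R / (j.*2 + 3 + i)%:R).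

Let beam_constE nu k : beam_const R nu.+1 k = \prod_(i < nu) s i k.
Proof.
rewrite /s exchange_big /=; apply: eq_bigr => j _.
elim: nu => [|nu IH].
  by rewrite big_ord0 doubleS addnC addn1 divff// pnatr_eq0.
rewrite big_ord_recr /= -IH.
have -> : (nu.+1 + j.*2.+1)%N = (j.*2 + 2 + nu)%N by lia.
have -> : (nu.+2 + j.*2.+1)%N = (j.*2 + 3 + nu)%N by lia.
by rewrite mulrA divfK // pnatr_eq0; lia.
Qed.

(** The square of a/(a+1) lies between (a-1)/(a+1) and a/(a+2), and both bounds telescope when a
    advances by 2. *)
Let s_bounds i k : (i.+1)%:R / (k.*2 + i.+1)%:R <= s i k ^+ 2 /\ s i k ^+ 2 <= (i.+2)%:R / (k.*2 + i.+2)%:R.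
Proof.
elim: k => [|k [IH1 IH2]].
  by rewrite /s big_ord0 expr1n !add0n !divff ?pnatr_eq0.
have -> : s i k.+1 = s i k * ((k.*2 + 2 + i)%:R / (k.*2 + 3 + i)%:R) by rewrite /s big_ord_recr.
set x := (X in s i k * X); have x0 : 0 <= x ^+ 2 by exact: sqr_ge0.
rewrite exprMn; split.
  apply: le_trans _ (ler_wpM2r x0 IH1).
  rewrite /x expr_div_n mulrACA -invfM ler_pdivrMr; last by rewrite ltr0n; lia.
  rewrite [leRHS]mulrAC ler_pdivlMr; last by rewrite mulr_gt0 ?exprn_gt0 ?ltr0n//; lia.
  by rewrite -!natrX -!natrM ler_nat; nia.
apply: le_trans (ler_wpM2r x0 IH2) _.
rewrite /x expr_div_n mulrACA -invfM ler_pdivrMr; last by rewrite mulr_gt0 ?exprn_gt0 ?ltr0n//; lia.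
rewrite mulrAC ler_pdivlMr; last by rewrite ltr0n; lia.
by rewrite -!natrX -!natrM ler_nat; nia.
Qed.

Lemma beam_const_gt0 n k : 0 < beam_const R n.+1 k.
Proof. by apply: prodr_gt0 => j _; rewrite divr_gt0 ?ltr0n//. Qed.

Lemma beam_const_ge nu k : (0 < k)%N -> 1 <= beam_const R nu.+1 k ^+ 2 * (3 * k)%:R ^+ nu.
Proof.
move=> k0; have cE y : y ^+ nu = \prod_(i < nu) y :> R by rewrite prodr_const card_ord.
rewrite cE beam_constE -prodrXl -big_split /=.
elim/big_ind: _ => // [x y x1 y1|i _]; first by rewrite mulr_ege1.
have [h _] := s_bounds i k; apply: le_trans _ (ler_wpM2r (ler0n _ _) h).
rewrite mulrAC ler_pdivlMr ?ltr0n; last by lia.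
by rewrite mul1r -natrM ler_nat; nia.
Qed.

Lemma beam_const_le nu k : beam_const R nu.+1 k ^+ 2 * k%:R ^+ nu <= nu.+1%:R ^+ nu.
Proof.
have cE y : y ^+ nu = \prod_(i < nu) y :> R by rewrite prodr_const card_ord.
rewrite !cE beam_constE -prodrXl -big_split /=.
apply: ler_prod => i _; rewrite mulr_ge0 ?sqr_ge0//=.
have [_ h] := s_bounds i k; apply: le_trans (ler_wpM2r (ler0n _ _) h) _.
rewrite mulrAC ler_pdivrMr ?ltr0n; last by lia.
by rewrite -!natrM ler_nat; have := ltn_ord i; nia.
Qed.
End beam_constant_bounds.

(** * Null vectors and well separated beams *)

Section lagrange.
Variable C : numClosedFieldType.
Local Notation "x ^c" := (Num.conj x) (at level 1, format "x ^c").

Lemma lagrange_identity (I : finType) (a b : I -> C) :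
  (\sum_i `|a i| ^+ 2) * (\sum_i `|b i| ^+ 2) - `|\sum_i a i * (b i)^c| ^+ 2 =
  (\sum_i \sum_j `|a i * b j - a j * b i| ^+ 2) / 2.
Proof.
set A := \sum_i `|a i| ^+ 2; set B := \sum_i `|b i| ^+ 2; set S := \sum_i a i * _.
have prodE (f g : I -> C) : (\sum_i f i) * (\sum_j g j) = \sum_i \sum_j f i * g j.
  by rewrite mulr_suml; apply: eq_bigr => i _; rewrite mulr_sumr.
have -> : \sum_i \sum_j `|a i * b j - a j * b i| ^+ 2 = A * B + B * A - (S * S^c + S^c * S).
  rewrite rmorph_sum /= !prodE -!big_split -sumrB /=; apply: eq_bigr => i _.
  rewrite -!big_split -sumrB /=; apply: eq_bigr => j _.
  rewrite !normCK !(rmorphB, rmorphM) /= !conjCK.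
  by move: (a i) (a j) (b i) (b j) (a i)^c (a j)^c (b i)^c (b j)^c => *; ring.
by rewrite normCK; move: S^c => S'; field.
Qed.

Variable nu : nat.
Implicit Types z : 'I_nu -> C.

(** A polynomial chart of the null cone b.b = 0 around (1, i, 0, ..., 0), with the coordinates from
    the third on as free parameters: the squares of the first two sum to -w. Its 2 nu real
    parameters match the dimension of the space of great circles of the (nu+1)-sphere. *)
Definition null_vector z (i : 'I_nu.+2) : C :=
  let w := \sum_l z l ^+ 2 in
  if unlift ord0 i is Some j then
    if unlift ord0 j is Some l then z l else 'i * (1 + w / 4)
  else 1 - w / 4.

Lemma sum_null_vector z (f : 'I_nu.+2 -> C -> C) (w := \sum_l z l ^+ 2) :
  \sum_i f i (null_vector z i) = f ord0 (1 - w / 4) + (f (lift ord0 ord0) ('i * (1 + w / 4)) +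
    \sum_l f (lift ord0 (lift ord0 l)) (z l)).
Proof.
rewrite !big_ord_recl /null_vector unlift_none liftK unlift_none; congr (_ + (_ + _)).
by apply: eq_bigr => l _; rewrite !liftK.
Qed.

Lemma null_vector_null z : \sum_i null_vector z i ^+ 2 = 0.
Proof.
rewrite (sum_null_vector z (fun _ x => x ^+ 2)); move: (\sum_l _) => w.
by rewrite exprMn sqrCi; field.
Qed.

Lemma parallelogram (x y : C) : `|x - y| ^+ 2 + `|x + y| ^+ 2 = 2 * `|x| ^+ 2 + 2 * `|y| ^+ 2.
Proof.
rewrite !normCK !(rmorphB, rmorphD) /=.
by move: x^c y^c => x' y'; ring.
Qed.

Lemma null_vector_norm z : \sum_i `|null_vector z i| ^+ 2 =
  2 + `|\sum_l z l ^+ 2| ^+ 2 / 8 + \sum_l `|z l| ^+ 2.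
Proof.
rewrite (sum_null_vector z (fun _ x => `|x| ^+ 2)) addrA normrM normCi mul1r parallelogram.
by congr (_ + _); rewrite normr1 normf_div normr_nat expr_div_n; field.
Qed.

(** Of the 2x2 minors in the Lagrange identity, only those that pair one of the first two
    coordinates with some z_l are kept. By the parallelogram law the two minors for l sum to 2 |z_l
    - z'_l|^2 plus a nonnegative term that absorbs [w] and [w']. *)
Lemma null_vector_gap z z' :
  2 * \sum_l `|z l - z' l| ^+ 2 <=
  (\sum_i `|null_vector z i| ^+ 2) * (\sum_i `|null_vector z' i| ^+ 2) -
  `|\sum_i null_vector z i * (null_vector z' i)^c| ^+ 2.
Proof.
pose G i j := `|null_vector z i * null_vector z' j - null_vector z j * null_vector z' i| ^+ 2.
rewrite lagrange_identity.
have G0 i j : 0 <= G i j by exact: exprn_ge0.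
have Gs i j : G i j = G j i by rewrite /G distrC.
rewrite ler_pdivlMr//.
rewrite -[leRHS]/(\sum_i \sum_j G i j).
pose e l : 'I_nu.+2 := lift ord0 (lift ord0 l).
have GE l : 2 * `|z l - z' l| ^+ 2 <= G ord0 (e l) + G (lift ord0 ord0) (e l).
  rewrite /G /null_vector !unlift_none !liftK !unlift_none.
  set w := \sum_l z l ^+ 2; set w' := \sum_l z' l ^+ 2.
  have -> : (1 - w / 4) * z' l - z l * (1 - w' / 4) = (z' l - z l) - (w * z' l - w' * z l) / 4 by ring.
  have -> : 'i * (1 + w / 4) * z' l - z l * ('i * (1 + w' / 4)) =
    'i * ((z' l - z l) + (w * z' l - w' * z l) / 4) by ring.
  rewrite normrM normCi mul1r parallelogram [in X in X <= _]distrC lerDl.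
  by rewrite mulr_ge0// exprn_ge0.
apply: (@le_trans _ _ ((\sum_l (G ord0 (e l) + G (lift ord0 ord0) (e l))) * 2)).
  by rewrite ler_pM2r// mulr_sumr ler_sum.
have rowE (g : 'I_nu.+2 -> C) : \sum_j g j = g ord0 + (g (lift ord0 ord0) + \sum_l g (e l)).
  by rewrite !big_ord_recl.
have row_ge i : \sum_l G i (e l) <= \sum_j G i j.
  by rewrite rowE addrA lerDr addr_ge0.
rewrite mulr_natr mulr2n big_split /= [leRHS]rowE [leRHS]addrA; apply: lerD; first exact: lerD.
rewrite -big_split /= ler_sum// => l _.
by rewrite rowE addrA [G ord0 _]Gs [G (lift _ _) _]Gs lerDl sumr_ge0.
Qed.
End lagrange.

Local Open Scope classical_set_scope.
Local Open Scope ring_scope.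

Section grid_sums.
Variable R : realFieldType.

(** The exponent is |m - l|, written with truncated subtraction. The two-sided geometric series is
    at most (1+q)/(1-q), which is at most 1 + 4 q for q <= 1/2; the term [q ^+ m.+1] below makes the
    induction on [m] close. *)
Lemma sum_exp_distn (q : R) L m : 0 <= q <= 1 / 2 ->
  \sum_(l < L) q ^+ (m - l + (l - m)) <= 1 + 4 * q.
Proof.
move=> /andP[q0 q1].
have H : (1 - q) * \sum_(l < L) q ^+ (m - l + (l - m)) <= 1 + q - q ^+ m.+1.
  elim: m L => [|m IH] [|L].
  - by rewrite big_ord0; lra.
  - rewrite (eq_bigr (fun l : 'I_L.+1 => q ^+ l)) => [|l _]; last by rewrite sub0n subn0.
    by rewrite -opprB mulNr -subrX1 expr1; have := exprn_ge0 L.+1 q0; lra.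
  - rewrite big_ord0 mulr0 subr_ge0 -[leLHS]mulr1 exprS.
    have : q ^+ m.+1 <= 1 by rewrite exprn_ile1//; lra.
    by nra.
  - rewrite big_ord_recl subn0 sub0n addn0 mulrDr.
    under eq_bigr => l _ do rewrite lift0 !subSS.
    by have := IH L; rewrite [q ^+ m.+2]exprS; lra.
have qm := exprn_ge0 m.+1 q0.
rewrite -(ler_pM2l (_ : 0 < 1 - q)); last by lra.
move: H qm; move: (\sum_(l < L) _) (q ^+ _) => x y H y0.
have : 0 <= q * (1 - 2 * q) by rewrite mulr_ge0//; lra.
by move=> ?; apply: le_trans H _; lra.
Qed.

Lemma sum_exp_dist_grid (T : finType) (q : R) L (m : {ffun T -> 'I_L}) : 0 <= q <= 1 / 2 ->
  \sum_(m' | m' != m) \prod_t q ^+ (m t - m' t + (m' t - m t)) <= (1 + 4 * q) ^+ #|T| - 1.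
Proof.
move=> q01; have q0 : 0 <= q by case/andP: q01.
pose F (m' : {ffun T -> 'I_L}) := \prod_t q ^+ (m t - m' t + (m' t - m t)).
have Fm : F m = 1 by rewrite /F big1// => t _; rewrite subnn.
rewrite lerBrDl; suff : \sum_m' F m' <= (1 + 4 * q) ^+ #|T| by rewrite (bigD1 m)//= Fm.
rewrite -(bigA_distr_bigA (fun t (l : 'I_L) => q ^+ (m t - l + (l - m t)))) /=.
rewrite -prodr_const; apply: ler_prod => t _.
by rewrite sum_exp_distn// andbT sumr_ge0// => l _; rewrite exprn_ge0.
Qed.
End grid_sums.

Section beam_family.
Variable R : realType.
Local Notation C := R[i].
Local Notation nrm := (@Normc.normc R).
Local Notation "x ^c" := (Num.conj x) (at level 1, format "x ^c").

Lemma expr1D_le (y : R) N : 0 <= y -> N%:R * y <= 1 / 8 -> (1 + y) ^+ N <= 8 / 7.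
Proof.
move=> y0 Ny; apply: (@le_trans _ _ (expR (1 / 8))).
  apply: (@le_trans _ _ (expR y ^+ N)).
    by rewrite lerXn2r ?expR_ge1Dx// nnegrE ?expR_ge0// addr_ge0.
  by rewrite -expRM_natl ler_expR.
have e0 := expR_gt0 (1 / 8 : R).
have := expR_ge1Dx (- (1 / 8) : R); rewrite expRN -(ler_pM2r e0) mulVf ?gt_eqF//.
by lra.
Qed.

Lemma normc2C (z : C) : `|z| ^+ 2 = (nrm z ^+ 2)%:C%C.
Proof. by rewrite normcE rmorphXn. Qed.

Lemma sum_normc2C (I : finType) (z : I -> C) : \sum_i `|z i| ^+ 2 = (\sum_i nrm (z i) ^+ 2)%:C%C.
Proof. by rewrite rmorph_sum; apply: eq_bigr => i _; exact: normc2C. Qed.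

Variable nu : nat.

Lemma null_vector_normc (z : 'I_nu -> C) : \sum_l nrm (z l) ^+ 2 <= 1 ->
  2 <= \sum_i nrm (null_vector z i) ^+ 2 <= 4.
Proof.
move=> z1; have : \sum_i nrm (null_vector z i) ^+ 2 =
    2 + nrm (\sum_l z l ^+ 2) ^+ 2 / 8 + \sum_l nrm (z l) ^+ 2.
  have E8 (x y : R) : (2 + x / 8 + y)%:C%C = 2 + x%:C%C / 8 + y%:C%C.
    by rewrite !rmorphD rmorphM fmorphV !rmorph_nat.
  by apply: (@complexI R); rewrite -sum_normc2C null_vector_norm E8 -sum_normc2C -normc2C.
have : nrm (\sum_l z l ^+ 2) <= 1.
  apply: le_trans (normc_sum _ _ _) _; apply: le_trans z1.
  by apply: ler_sum => l _; rewrite normcX.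
have : 0 <= \sum_l nrm (z l) ^+ 2 by apply: sumr_ge0 => l _; exact: sqr_ge0.
have := normc_ge0 (\sum_l z l ^+ 2).
by move: z1; move: (nrm (\sum_l z l ^+ 2)) (\sum_l nrm (z l) ^+ 2) (\sum_i nrm (null_vector z i) ^+ 2) => x y w y1 x0 y0 x1 ->; nra.
Qed.

Lemma null_vector_gap_normc (z z' : 'I_nu -> C) :
  nrm (\sum_i null_vector z i * (null_vector z' i)^c) ^+ 2 <=
  (\sum_i nrm (null_vector z i) ^+ 2) * (\sum_i nrm (null_vector z' i) ^+ 2)
    - 2 * \sum_l nrm (z l - z' l) ^+ 2.
Proof.
rewrite lerBrDl -lerBrDr -lecR; have := null_vector_gap z z'.
by rewrite !sum_normc2C normc2C -(rmorph_nat (real_complex R)) -!rmorphM -rmorphB.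
Qed.

(** Scaled to squared length 2: the real and imaginary parts of [b] are then orthonormal, so that
    |b.x| <= 1 on the sphere with equality on a great circle. *)
Definition unit_beam (z : 'I_nu -> C) (i : 'I_nu.+2) : C :=
  (Num.sqrt (2 / \sum_i nrm (null_vector z i) ^+ 2))%:C%C * null_vector z i.

Lemma unit_beam_null z : \sum_i unit_beam z i ^+ 2 = 0.
Proof.
under eq_bigr => i _ do rewrite exprMn.
by rewrite -mulr_sumr null_vector_null mulr0.
Qed.

Lemma unit_beam_norm z : \sum_l nrm (z l) ^+ 2 <= 1 -> \sum_i nrm (unit_beam z i) ^+ 2 = 2.
Proof.
move=> /null_vector_normc/andP[A2 _].
under eq_bigr => i _ do rewrite Normc.normcM normc_real ?sqrtr_ge0// exprMn.
have A0 : 0 < \sum_i nrm (null_vector z i) ^+ 2 by apply: lt_le_trans A2.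
rewrite -mulr_sumr sqr_sqrtr ?divfK ?gt_eqF//.
by rewrite divr_ge0// ltW.
Qed.

(** The gap between null vectors is divided by the product of their squared lengths, which is at
    most 16. *)
Lemma unit_beam_overlap (z z' : 'I_nu -> C) :
  \sum_l nrm (z l) ^+ 2 <= 1 -> \sum_l nrm (z' l) ^+ 2 <= 1 ->
  nrm ((\sum_i unit_beam z i * (unit_beam z' i)^c) / 2) ^+ 2 <=
    1 - (\sum_l nrm (z l - z' l) ^+ 2) / 8.
Proof.
move=> /null_vector_normc/andP[A2 A4] /null_vector_normc/andP[B2 B4].
have := null_vector_gap_normc z z'; rewrite /unit_beam.
under [X in _ -> nrm (X / _) ^+ 2 <= _]eq_bigr => i _ do rewrite rmorphM mulrACA.
rewrite -mulr_sumr -mulrA.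
move: (\sum_i null_vector z i * (null_vector z' i)^c) => s.
rewrite !Normc.normcM normc_conj !normc_real ?sqrtr_ge0// !exprMn.
have -> : nrm 2^-1 = 2^-1.
  by apply: (@complexI R); rewrite -normcE fmorphV rmorph_nat normfV normr_nat.
have : 0 <= \sum_l nrm (z l - z' l) ^+ 2 by apply: sumr_ge0 => l _; exact: sqr_ge0.
move: (\sum_i nrm (null_vector z i) ^+ 2) (\sum_i nrm (null_vector z' i) ^+ 2) A2 A4 B2 B4.
move: (nrm s ^+ 2) (\sum_l _) => S D A B A2 A4 B2 B4 D0 SD.
rewrite !sqr_sqrtr; try by rewrite divr_ge0//; lra.
have -> : 2 / A * (2 / B) * (S * 2^-1 ^+ 2) = S / (A * B) by field; apply/andP; split; lra.
rewrite ler_pdivrMr; last by nra.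
have : A * B <= 16 by nra.
by nra.
Qed.

Let K := (64 * nu ^ 2)%N.

(** The parameters z run over a cubic grid in the unit ball of C^nu. The overlap of two beams decays
    like a Gaussian in the number of grid steps between them, so the row sums factor over the 2 nu
    real coordinates. All prefixes of the family are provided, because the number of beams is fixed
    only later, in terms of the dimension. *)
Lemma beam_family k : (0 < nu)%N -> (0 < k)%N ->
  exists2 M, (k ^ nu <= K ^ (nu * 2) * M)%N &
    forall M', (M' <= M)%N -> exists b : 'I_M' -> 'I_nu.+2 -> C,
    [/\ forall i, \sum_l b i l ^+ 2 = 0, forall i, \sum_l nrm (b i l) ^+ 2 = 2 &
      forall i, \sum_(j | j != i) nrm ((\sum_l b i l * (b j l)^c) / 2) ^+ k <= 1 / 4].
Proof.
move=> nu0 k0.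
(* [L] is the number of grid points per real coordinate, of order sqrt k / K. That [L] works gives
   the lower bound on the size L^(2 nu) of the grid; that [L.-1] fails keeps the grid inside the
   unit ball. *)
have [|L kL Lmin] := ex_minnP (P := fun L => k <= (K * L) ^ 2)%N.
  have K0 : (0 < K)%N by rewrite muln_gt0 expn_gt0 nu0.
  by exists k; apply: (leq_trans (leq_pmull k K0)); rewrite -mulnn leq_pmulr// muln_gt0 K0.
have L1k : ((K * L.-1) ^ 2 < k)%N.
  by case: L kL Lmin => [|L] kL Lmin; [lia|rewrite ltnNge; apply/negP => /Lmin; rewrite /= ltnn].
pose T := ('I_nu * bool)%type.
pose G := {ffun T -> 'I_L}.
have GE : #|{: G}| = (L ^ (nu * 2))%N by rewrite card_ffun card_prod !card_ord card_bool.
exists #|{: G}|.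
  by rewrite GE -expnMn [(nu * 2)%N]mulnC expnM leq_exp2r.
move=> M' M'G.
(* The mesh is 32 nu / sqrt k, wide enough for the exponent k delta^2 / 8 of the squared overlap to
   be 128 nu^2. *)
pose delta : R := Num.sqrt ((32 * nu)%:R ^+ 2 / k%:R).
have k0R : 0 < k%:R :> R by rewrite ltr0n.
have delta2 : delta ^+ 2 * k%:R = (32 * nu)%:R ^+ 2.
  by rewrite sqr_sqrtr ?divfK ?gt_eqF// divr_ge0// ltW.
pose z (m : G) l : C := Complex (delta * (m (l, false))%:R) (delta * (m (l, true))%:R).
have sumT (f : T -> R) : \sum_t f t = \sum_l (f (l, false) + f (l, true)).
  rewrite (eq_bigr (fun t => f (t.1, t.2))) => [|[]//].
  rewrite -(pair_bigA _ (fun l b => f (l, b))) /=; apply: eq_bigr => l _.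
  by rewrite big_bool addrC.
have normC (x y : R) : nrm (Complex x y) ^+ 2 = x ^+ 2 + y ^+ 2.
  by rewrite /= sqr_sqrtr// addr_ge0// sqr_ge0.
have z1 m : \sum_l nrm (z m l) ^+ 2 <= 1.
  rewrite (eq_bigr (fun l => (delta * (m (l, false))%:R) ^+ 2 + (delta * (m (l, true))%:R) ^+ 2)).
    2: by move=> l _; rewrite normC.
  rewrite -(sumT (fun t => (delta * (m t)%:R) ^+ 2)).
  rewrite -(ler_pM2r k0R) mul1r.
  apply: (@le_trans _ _ (\sum_(t : T) (32 * nu)%:R ^+ 2 * (L.-1)%:R ^+ 2)).
    rewrite mulr_suml; apply: ler_sum => t _.
    rewrite exprMn mulrAC delta2 ler_pM2l ?exprn_gt0 ?ltr0n ?muln_gt0//.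
    by rewrite -!natrX ler_nat leq_exp2r//; have := ltn_ord (m t); lia.
  rewrite sumr_const card_prod card_ord card_bool -!natrX -natrM -mulrnA ler_nat.
  apply: leq_trans (ltnW L1k).
  have -> : ((K * L.-1) ^ 2 = (32 * nu) ^ 2 * L.-1 ^ 2 * (nu * 2) * (2 * nu))%N.
    by rewrite /K -!mulnn; ring.
  by rewrite leq_pmulr// muln_gt0.
have zz m m' : \sum_l nrm (z m l - z m' l) ^+ 2 =
    delta ^+ 2 * (\sum_t (m t - m' t + (m' t - m t)) ^ 2)%:R.
  rewrite natr_sum mulr_sumr sumT; apply: eq_bigr => l _.
  have dE (a b : nat) : delta ^+ 2 * ((a - b + (b - a)) ^ 2)%:R = (delta * a%:R - delta * b%:R) ^+ 2.
    rewrite -mulrBr exprMn natrX; congr (_ * _).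
    case: (leqP a b) => [ab|/ltnW ab].
      by rewrite (eqP ab) add0n natrB// -sqrrN opprB.
    by rewrite (eqP ab) addn0 natrB.
  by rewrite !dE -normC.
(* Half of the exponent 128 nu^2, as overlaps are bounded through their squares. It makes 64 nu q <=
   1, whence (1 + 4 q)^(2 nu) - 1 <= 8/7 - 1 < 1/4. *)
pose q : R := expR (- (64 * nu ^ 2)%:R).
have q0 : 0 < q by exact: expR_gt0.
have q64 : q * (64 * nu)%:R <= 1.
  rewrite /q expRN mulrC ler_pdivrMr ?expR_gt0// mul1r.
  apply: le_trans (_ : _ <= (64 * nu ^ 2)%:R) _; first by rewrite ler_nat; nia.
  by apply: le_trans (expR_ge1Dx _); rewrite lerDr.
have overlap m m' : nrm ((\sum_l unit_beam (z m) l * (unit_beam (z m') l)^c) / 2) ^+ k <=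
    \prod_t q ^+ (m t - m' t + (m' t - m t)).
  have := unit_beam_overlap (z1 m) (z1 m'); rewrite zz.
  move: (nrm _) (normc_ge0 ((\sum_l unit_beam (z m) l * (unit_beam (z m') l)^c) / 2)) => r r0 rD.
  rewrite prodrXr; set d := (\sum_t _)%N in rD; set d' := (\sum_t _)%N.
  (* Squared distances are replaced by plain ones, which are at most as large for integers, so that
     the sums become geometric. *)
  have dd : (d' <= d)%N by apply: leq_sum => t _; rewrite -mulnn; case: (_ + _)%N => // e; rewrite leq_pmulr.
  have q1 : q <= 1 by rewrite /q expRN invf_le1 ?expR_gt0// -expR0 ler_expR.
  apply: le_trans (_ : _ <= q ^+ d) _; last by rewrite ler_wiXn2l// ltW.
  rewrite -(ler_pXn2r (n := 2))// ?nnegrE ?exprn_ge0//; last exact: ltW.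
  rewrite exprAC; apply: le_trans (_ : _ <= expR (- (delta ^+ 2 * d%:R / 8)) ^+ k) _.
    by rewrite lerXn2r ?nnegrE ?sqr_ge0 ?expR_ge0// (le_trans rD)// expR_ge1Dx.
  rewrite -!exprM -!expRM_natl ler_expR !mulrN lerN2.
  rewrite [X in _ <= X](_ : _ = (delta ^+ 2 * k%:R) * d%:R / 8); last by field.
  rewrite delta2 ler_pdivlMr// -!natrX -!natrM ler_nat.
  by nia.
pose h (i : 'I_M') : G := enum_val (widen_ord M'G i).
have hI : injective h by move=> i j /enum_val_inj /(congr1 val) /= /val_inj.
exists (fun i => unit_beam (z (h i))); split=> [i|i|i].
- exact: unit_beam_null.
- exact: unit_beam_norm.
pose F (m' : G) := \prod_t q ^+ (h i t - m' t + (m' t - h i t)).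
have F0 m' : 0 <= F m' by apply: prodr_ge0 => t _; rewrite exprn_ge0// ltW.
apply: (@le_trans _ _ (\sum_(j | j != i) F (h j))).
  by apply: ler_sum => j _; exact: overlap.
rewrite -(big_imset _ (in2W hI)) /=.
apply: (@le_trans _ _ (\sum_(m' | m' != h i) F m')).
  rewrite [leRHS](bigID (mem [set h j | j in [pred j | j != i]]%SET)) /=.
  rewrite [X in _ <= X + _](eq_bigl (mem [set h j | j in [pred j | j != i]]%SET)).
    by rewrite lerDl sumr_ge0.
  move=> m' /=; rewrite andb_idl// => /imsetP[j]; rewrite inE => ji ->.
  by rewrite (inj_eq hI).
have nu1 : 1 <= nu%:R :> R by rewrite ler1n.
apply: le_trans (sum_exp_dist_grid _ _) _; first by rewrite ltW//=; rewrite natrM in q64; nra.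
rewrite card_prod card_ord card_bool lerBlDr.
apply: le_trans (expr1D_le _ _) _; first by rewrite mulr_ge0// ltW.
  by rewrite natrM; rewrite natrM in q64; lra.
lra.
Qed.
End beam_family.

(** * Moments of the round measure *)

Section wallis.
Context {R : realType}.
Local Notation mu := (@lebesgue_measure R).

(** Gamma((i+1)/2). *)
Fixpoint half_gamma (i : nat) : R :=
  match i with
  | 0 => Num.sqrt pi
  | 1 => 1
  | j.+2 => j.+1%:R / 2 * half_gamma j
  end.

Lemma half_gammaSS i : half_gamma i.+2 = i.+1%:R / 2 * half_gamma i.
Proof. by []. Qed.

Lemma half_gamma_gt0 i : 0 < half_gamma i.
Proof.
suff [] : 0 < half_gamma i /\ 0 < half_gamma i.+1 by [].
elim: i => [|i [IH1 IH2]]; first by rewrite /= sqrtr_gt0 pi_gt0 ltr01.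
by split=> //; rewrite half_gammaSS mulr_gt0// divr_gt0.
Qed.

Lemma Rintegral_derive (F f : R -> R) (a b : R) : a < b ->
  continuous f -> (forall x : R, is_derive x (1:R) F (f x)) ->
  (\int[mu]_(x in `[a, b]) f x = F b - F a)%R.
Proof.
move=> ab cf dF; rewrite /Rintegral (@continuous_FTC2 _ f F)//.
- exact: continuous_subspaceT.
- have cF : continuous F.
    by move=> x; apply/differentiable_continuous/derivable1_diffP; case: (dF x).
  split; first by move=> x _; case: (dF x).
    exact/cvg_at_right_filter/cF.
  exact/cvg_at_left_filter/cF.
- by move=> x _; rewrite derive1E; apply: derive_val.
Qed.

Lemma continuous_Rintegrable (f : R -> R) (a b : R) : continuous f ->
  mu.-integrable `[a, b] (EFin \o f).
Proof.
move=> cf; apply: continuous_compact_integrable; first exact: segment_compact.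
exact: continuous_subspaceT.
Qed.

Definition wallis m c : R :=
  (\int[mu]_(x in `[- (pi / 2), pi / 2]) (cos x ^+ m * sin x ^+ c))%R.

Lemma continuous_cos_sin m c : continuous (fun x : R => cos x ^+ m * sin x ^+ c).
Proof.
move=> x; apply: (@cvgM _ _ (nbhs x)).
  exact: (continuous_comp (@continuous_cos R x) (@exprn_continuous R m (cos x))).
exact: (continuous_comp (@continuous_sin R x) (@exprn_continuous R c (sin x))).
Qed.

Let npi : - (pi / 2) < pi / 2 :> R.
Proof. have := @pi_gt0 R; lra. Qed.

Lemma wallisD m c : wallis m.+2 c + wallis m c.+2 = wallis m c.
Proof.
rewrite /wallis -RintegralD//; try by apply: continuous_Rintegrable; exact: continuous_cos_sin.
apply: eq_Rintegral => x _.
rewrite /=; have e (y : R) i : y ^+ i.+2 = y ^+ i * y ^+ 2 by rewrite -exprD addn2.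
by rewrite (e (sin x)) sin2cos2 e; ring.
Qed.

(** The integrand of the difference is the derivative of cos^(m+1) sin^(c+1), which vanishes at both
    ends. *)
Lemma wallis_parts m c :
  c.+1%:R * wallis m.+2 c = m.+1%:R * wallis m c.+2.
Proof.
rewrite /wallis; apply/eqP; rewrite -subr_eq0; apply/eqP.
have i1 := continuous_Rintegrable (- (pi / 2)) (pi / 2) (@continuous_cos_sin m.+2 c).
have i2 := continuous_Rintegrable (- (pi / 2)) (pi / 2) (@continuous_cos_sin m c.+2).
rewrite -RintegralZl// -RintegralZl// -RintegralB//; last 2 first.
- by apply: continuous_Rintegrable => x; apply: cvgM; [exact: cvg_cst|exact: continuous_cos_sin].
- by apply: continuous_Rintegrable => x; apply: cvgM; [exact: cvg_cst|exact: continuous_cos_sin].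
pose F x : R := cos x ^+ m.+1 * sin x ^+ c.+1.
transitivity (F (pi / 2) - F (- (pi / 2))); last first.
  by rewrite /F cosN cos_pihalf !expr0n/= !mul0r subrr.
apply: Rintegral_derive => //.
  by move=> x; apply: cvgB; apply: cvgM; try exact: cvg_cst; exact: continuous_cos_sin.
move=> x.
have d1 := @is_deriveX _ _ cos m.+1 x 1 _ (is_derive_cos x).
have d2 := @is_deriveX _ _ sin c.+1 x 1 _ (is_derive_sin x).
have -> : F = (cos ^+ m.+1 * sin ^+ c.+1)%R by apply/funext => y; rewrite /F /= !fctE.
have d := is_deriveM d1 d2.
apply: (is_derive_eq d).
have e (f : R -> R) i : (f ^+ i.+1) x = f x ^+ i.+1 by rewrite fctE.
rewrite !e /GRing.scale /=.
rewrite !(exprS (cos x)) !(exprS (sin x)).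
move: (cos x) (sin x) (m.+1%:R : R) (c.+1%:R : R) => C S p q.
ring.
Qed.

Lemma wallis00 : wallis 0 0 = pi.
Proof.
transitivity (pi / 2 - (- (pi / 2)) : R); last by lra.
apply: (@Rintegral_derive id) => //; first exact: continuous_cos_sin.
by move=> x; rewrite expr0 mul1r expr0; exact: is_derive_id.
Qed.

Lemma wallis10 : wallis 1 0 = 2.
Proof.
transitivity (sin (pi / 2) - sin (- (pi / 2)) : R); last by rewrite sinN sin_pihalf; lra.
apply: Rintegral_derive => //; first exact: continuous_cos_sin.
by move=> x; rewrite expr1 expr0 mulr1; exact: is_derive_sin.
Qed.

(** The Beta function B((m+1)/2, (c+1)/2). The recurrence in [c] is [wallis_parts] combined with
    cos^2 + sin^2 = 1; the case [c = 0] is an induction on [m] by steps of two. *)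
Lemma wallisE m c : ~~ odd c ->
  wallis m c = half_gamma m * half_gamma c / half_gamma (m + c).+1.
Proof.
have step m' c' : (m' + c' + 2)%:R * wallis m' c'.+2 = c'.+1%:R * wallis m' c'.
  by have := wallis_parts m' c'; rewrite -(wallisD m' c') mulrDr => ->; rewrite !natrD; ring.
have g0 i : half_gamma i != 0 by rewrite gt_eqF// half_gamma_gt0.
have base : wallis m 0 = half_gamma m * half_gamma 0 / half_gamma m.+1.
  suff [] : wallis m 0 = half_gamma m * half_gamma 0 / half_gamma m.+1 /\
     wallis m.+1 0 = half_gamma m.+1 * half_gamma 0 / half_gamma m.+2 by [].
  elim: m => [|m [IH1 IH2]].
    rewrite wallis00 wallis10 /= divr1 -expr2 sqr_sqrtr ?pi_ge0//; split=> //.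
    have : Num.sqrt pi != 0 :> R by have := g0 0%N.
    by move=> ?; field.
  split=> //; have := step m 0%N; have := wallisD m 0.
  rewrite IH1 half_gammaSS (half_gammaSS m.+1) addn0 mul1r.
  have Hm : m.+1%:R != 0 :> R by rewrite pnatr_eq0.
  have Hm2 : m.+2%:R != 0 :> R by rewrite pnatr_eq0.
  have := g0 m; have := g0 m.+1; have := g0 0%N; rewrite addn2.
  move: (half_gamma m) (half_gamma m.+1) (half_gamma 0%N) (wallis m.+2 0) (wallis m 2) => x y z w u z0 y0 x0 /(canRL (addrK _)) -> H.
  have -> : u = m.+2%:R^-1 * (x * z / y) by rewrite -H mulrA mulVf// mul1r.
  rewrite -(natr1 m.+1) in Hm2 *.
  move: (m.+1%:R : R) Hm Hm2 => t Ht Ht1; field.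
  by rewrite ?Ht ?Ht1 ?y0 ?x0.
elim/ltn_ind: c => -[|[|c]]// IH.
  by rewrite base addn0.
move=> oc2; have oc : ~~ odd c by move: oc2; rewrite /= negbK.
have := step m c; rewrite (IH c)// => H.
have H2 : (m + c + 2)%:R != 0 :> R by rewrite addn2 pnatr_eq0.
apply: (mulfI H2); rewrite H (addnS m c.+1) (addnS m c) (half_gammaSS c) (half_gammaSS (m + c).+1).
have H3 : (m + c).+2%:R != 0 :> R by rewrite pnatr_eq0.
rewrite addn2; have := g0 (m + c).+1; move: (half_gamma (m + c).+1) (half_gamma m) (half_gamma c) => x y z x0.
move: ((m + c).+2%:R : R) (c.+1%:R : R) H3 => t u t0.
by field; rewrite t0 x0.
Qed.

End wallis.

Section arcsine.
Context {R : realType}.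
Local Notation mu := (@lebesgue_measure R).

(** s^c (a^2 - s^2)^((m-1)/2). The exponent is split as a power and a quotient because it is
    negative for [m = 0], where the weight is singular at the ends. *)
Definition arcsine_weight (a : R) m c (s : R) : R :=
  s ^+ c * (Num.sqrt (a ^+ 2 - s ^+ 2) ^+ m / Num.sqrt (a ^+ 2 - s ^+ 2)).

Lemma arcsine_weight_ge0 a m c s : ~~ odd c -> 0 <= arcsine_weight a m c s.
Proof.
by move=> oc; rewrite mulr_ge0 ?real_exprn_even_ge0 ?num_real// divr_ge0// ?exprn_ge0// sqrtr_ge0.
Qed.

Lemma continuous_arcsine_weight a m c s : s ^+ 2 < a ^+ 2 ->
  {for s, continuous (arcsine_weight a m c)}.
Proof.
move=> sa.
have c1 : {for s, continuous (fun s : R => Num.sqrt (a ^+ 2 - s ^+ 2))}.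
  apply: (@continuous_comp _ _ _ (fun s : R => a ^+ 2 - s ^+ 2) Num.sqrt); last exact: sqrt_continuous.
  by apply: cvgB; [exact: cvg_cst | exact: exprn_continuous].
apply: cvgM; first exact: exprn_continuous.
apply: cvgM; last by apply: cvgV => //; rewrite sqrtr_eq0 -ltNge subr_gt0.
exact: (continuous_comp c1 (@exprn_continuous R m _)).
Qed.

Lemma measurable_arcsine_weight (a : R) m c : measurable_fun setT (arcsine_weight a m c).
Proof.
have mq : measurable_fun setT (fun s : R => Num.sqrt (a ^+ 2 - s ^+ 2)).
  by apply: (measurableT_comp measurable_sqrt); apply: measurable_funB => //; exact: measurable_funX.
apply: measurable_funM; first exact: measurable_funX.
apply: measurable_funM; first exact: measurable_funX.
rewrite [X in measurable_fun _ X](_ : _ = (fun s : R => (Num.sqrt (a ^+ 2 - s ^+ 2)) `^ (-1))).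
  by apply: (measurableT_comp (measurable_powR _)).
by apply/funext => s; rewrite powR_inv1// sqrtr_ge0.
Qed.

(** Angles increasing to pi/2. The substitution s = a sin x is made on compact intervals, where the
    weight is continuous, and monotone convergence passes to the open interval. *)
Let th (i : nat) : R := pi / 2 - (pi / 2) / i.+1%:R.

Let th_lt i : th i < pi / 2.
Proof. by rewrite /th gtrBl divr_gt0// divr_gt0// pi_gt0. Qed.

Let th_ge0 i : 0 <= th i.
Proof.
rewrite /th subr_ge0 ler_pdivrMr// ler_peMr ?divr_ge0 ?pi_ge0//.
by rewrite ler1n.
Qed.

Let th_nd i j : (i <= j)%N -> th i <= th j.
Proof.
move=> ij; rewrite /th lerD2l lerN2 ler_wpM2l ?divr_ge0 ?pi_ge0//.
by rewrite lef_pV2 ?posrE// ler_nat.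
Qed.

Let th_near (x : R) : `|x| < pi / 2 -> exists i, `|x| <= th i.
Proof.
move=> xp; exists (Num.truncn ((pi / 2) / (pi / 2 - `|x|))).
rewrite /th lerBrDr -lerBrDl ler_pdivrMr// -ler_pdivrMl ?subr_gt0// [leLHS]mulrC.
by rewrite ltW// truncnS_gt.
Qed.

Let sin_range (x : R) : `|x| < pi / 2 -> -1 < sin x < 1.
Proof.
move=> xp; have cx : 0 < cos x by apply: cos_gt0_pihalf; rewrite -ltr_norml.
rewrite -ltr_norml -(@ltr_pXn2r _ 2) ?nnegrE// real_normK ?num_real// expr1n sin2cos2.
by rewrite gtrBl exprn_gt0.
Qed.

Let arcsine_bigcup (a : R) : 0 < a ->
  \bigcup_i `[- (a * sin (th i)), a * sin (th i)]%classic = [set s : R | s ^+ 2 < a ^+ 2].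
Proof.
move=> a0; apply/seteqP; split=> s.
  move=> [i _] /=; rewrite in_itv/= -ler_norml => sa.
  rewrite -(real_normK (num_real s)) ltr_pXn2r// ?nnegrE// ?ltW//.
  apply: le_lt_trans sa _; rewrite gtr_pMr//.
  by have /andP[] : -1 < sin (th i) < 1 by apply: sin_range; rewrite ger0_norm.
move=> /=; rewrite -(real_normK (num_real s)) ltr_pXn2r// ?nnegrE// ?ltW// => sa.
have sa1 : -1 < s / a < 1.
  by rewrite -ltr_norml normrM normfV (gtr0_norm a0) ltr_pdivrMr// mul1r.
have sa2 : -1 <= s / a <= 1 by case/andP: sa1 => *; rewrite !ltW.
have [i xi] : exists i, `|asin (s / a)| <= th i.
  apply: th_near; rewrite ltr_norml asin_gtNpi2 ?asin_ltpi2//.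
    by case/andP: sa1 => [/ltW-> ->].
  by case/andP: sa1 => [-> /ltW->].
exists i => //=; rewrite in_itv/= -ler_norml.
have -> : s = a * sin (asin (s / a)).
  by rewrite asinK ?in_itv// mulrCA divff ?mulr1// gt_eqF.
rewrite normrM (gtr0_norm a0) ler_pM2l//.
have thI : th i \in `[- (pi / 2), pi / 2].
  rewrite in_itv/= (ltW (th_lt i)) andbT (le_trans _ (th_ge0 i))//.
  by rewrite oppr_le0 divr_ge0// pi_ge0.
have thN : - th i \in `[- (pi / 2), pi / 2].
  by move: thI; rewrite !in_itv/= lerN2 lerNl => /andP[-> ->].
have aI : asin (s / a) \in `[- (pi / 2), pi / 2].
  by rewrite in_itv/= asin_geNpi2 ?asin_lepi2.
move: xi; rewrite !ler_norml => /andP[l r]; apply/andP; split.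
  by rewrite -sinN leNgt ltr_sin// -leNgt.
by rewrite leNgt ltr_sin// -leNgt.
Qed.

(** Under s = a sin x the square root becomes a cos x and its inverse cancels the Jacobian. *)
Lemma integral_arcsine_weight (a : R) m c : 0 < a -> ~~ odd c ->
  (\int[mu]_(s in [set s | (s ^+ 2 < a ^+ 2)%R]) (arcsine_weight a m c s)%:E =
   (a ^+ (m + c) * wallis m c)%:E)%E.
Proof.
move=> a0 oc.
pose G := arcsine_weight a m c.
pose H x : R := a ^+ (m + c) * (cos x ^+ m * sin x ^+ c).
have cH : continuous H.
  by move=> x; apply: cvgM; [exact: cvg_cst|exact: continuous_cos_sin].
have subst i : (\int[mu]_(s in `[(- (a * sin (th i)))%R, (a * sin (th i))%R]) (G s)%:E =
    \int[mu]_(x in `[(- th i)%R, th i]) (H x)%:E)%E.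
  pose F x : R := a * sin x.
  have dF x : is_derive x (1:R) F (a * cos x).
    by rewrite /F; apply: is_deriveZ.
  have F' : (derive1 F) = (fun x => a * cos x).
    by apply/funext => x; rewrite derive1E; apply: derive_val.
  have cF' : continuous (derive1 F).
    by rewrite F' => x; apply: cvgM; [exact: cvg_cst|exact: continuous_cos].
  have cF : continuous F by move=> x; apply: cvgM; [exact: cvg_cst|exact: continuous_sin].
  have -> : - (a * sin (th i)) = F (- th i) by rewrite /F sinN mulrN.
  rewrite -[a * sin (th i)]/(F (th i)).
  rewrite integration_by_substitution_increasing//.
  - apply: eq_integral => x; rewrite inE/= in_itv/= => /andP[x1 x2]; congr EFin.
    have xp : `|x| < pi / 2 by rewrite (le_lt_trans _ (th_lt i))// ler_norml x1.
    have cx : 0 < cos x by apply: cos_gt0_pihalf; rewrite -ltr_norml.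
    transitivity (G (F x) * (a * cos x)); first by rewrite F'.
    rewrite /G /F /arcsine_weight [(a * sin x) ^+ 2]exprMn.
    have -> : a ^+ 2 - a ^+ 2 * sin x ^+ 2 = (a * cos x) ^+ 2.
      by rewrite exprMn sin2cos2 mulrBr mulr1 opprB addrC subrK.
    rewrite sqrtr_sqr gtr0_norm ?mulr_gt0//.
    rewrite /H exprD !exprMn -!mulrA mulVf ?gt_eqF ?mulr_gt0//.
    move: (cos x) (sin x) => u v; ring.
  - by rewrite (le_trans _ (th_ge0 i))// oppr_le0.
  - move=> x y xi yi xy; rewrite /F ltr_pM2l//.
    have sub z : z \in `[- th i, th i] -> z \in `[- (pi / 2), (pi / 2)].
      rewrite !in_itv/= => /andP[z1 z2]; apply/andP; split.
        by rewrite (le_trans _ z1)// lerN2 ltW.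
      by rewrite (le_trans z2)// ltW.
    by rewrite ltr_sin ?sub.
  - by apply/cvg_ex; exists ((derive1 F) (- th i)); apply: cvg_at_right_filter; exact: cF'.
  - by apply/cvg_ex; exists ((derive1 F) (th i)); apply: cvg_at_left_filter; exact: cF'.
  - split; first by move=> x _; case: (dF x).
      exact/cvg_at_right_filter/cF.
    exact/cvg_at_left_filter/cF.
  - apply: continuous_in_subspaceT => s; rewrite inE/= => sI.
    apply: continuous_arcsine_weight.
    have : (\bigcup_i `[- (a * sin (th i)), a * sin (th i)])%classic s.
      by exists i => //=; move: sI; rewrite /F sinN mulrN.
    by rewrite arcsine_bigcup.
have mG : measurable_fun setT G by exact: measurable_arcsine_weight.
have H0 x : `|x| < pi / 2 -> 0 <= H x.
  move=> xp; have cx : 0 < cos x by apply: cos_gt0_pihalf; rewrite -ltr_norml.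
  apply: mulr_ge0; first by rewrite exprn_ge0 ?ltW.
  apply: mulr_ge0; first by rewrite exprn_ge0 ?ltW.
  by rewrite real_exprn_even_ge0 ?num_real.
have thE i (x : R) : `|x| <= th i -> `|x| < pi / 2 by move/le_lt_trans; apply.
have limL : (\int[mu]_(s in `[(- (a * sin (th i)))%R, (a * sin (th i))%R]) (G s)%:E @[i --> \oo] -->
    \int[mu]_(s in [set s | (s ^+ 2 < a ^+ 2)%R]) (G s)%:E)%E.
  rewrite -arcsine_bigcup//; apply: ge0_nondecreasing_set_cvg_integral => //.
  - move=> i j ij; apply/subsetPset => s /=; rewrite !in_itv/= -!ler_norml => /le_trans; apply.
    rewrite ler_pM2l//.
    have thI k : th k \in `[- (pi / 2), pi / 2].
      rewrite in_itv/= (ltW (th_lt k)) andbT (le_trans _ (th_ge0 k))//.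
      by rewrite oppr_le0 divr_ge0// pi_ge0.
    by rewrite leNgt ltr_sin// -leNgt th_nd.
  - by move=> i; apply/measurable_EFinP; exact: measurable_funTS.
  - by move=> i s _; rewrite lee_fin arcsine_weight_ge0.
have limR : (\int[mu]_(x in `[(- th i)%R, th i]) (H x)%:E @[i --> \oo] -->
    (a ^+ (m + c) * wallis m c)%:E)%E.
  suff -> : (a ^+ (m + c) * wallis m c)%:E = (\int[mu]_(x in \bigcup_i `[(- th i)%R, th i]%classic) (H x)%:E)%E.
    apply: ge0_nondecreasing_set_cvg_integral => //.
    - move=> i j ij; apply/subsetPset => s /=; rewrite !in_itv/= -!ler_norml => /le_trans; apply.
      exact: th_nd.
    - by move=> i; apply/measurable_EFinP; apply: measurable_funTS; exact: continuous_measurable_fun.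
    - by move=> i x /=; rewrite in_itv/= -ler_norml => /thE xp; rewrite lee_fin H0.
  have -> : \bigcup_i `[(- th i)%R, th i]%classic = `](- (pi / 2))%R, (pi / 2)%R[%classic.
    apply/seteqP; split=> x /=.
      by move=> [i _] /=; rewrite !in_itv/= -ler_norml -ltr_norml; exact: thE.
    rewrite in_itv/= -ltr_norml => /th_near[i xi].
    by exists i => //=; rewrite in_itv/= -ler_norml.
  have iH := continuous_Rintegrable (- (pi / 2)) (pi / 2) cH.
  rewrite -RintegralZl//; last by apply: continuous_Rintegrable; exact: continuous_cos_sin.
  rewrite /Rintegral fineK; last exact: integrable_fin_num.
  rewrite integral_itv_bndoo//; apply/measurable_EFinP; apply: measurable_funTS; exact: continuous_measurable_fun.
by move: limR; rewrite -(funext subst) => /(cvg_unique _ limL); apply.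
Qed.
End arcsine.

Section tuple_integral.
Context {R : realType}.
Local Notation mu := (@lebesgue_measure R).

Lemma ge0_integral_lebesgue_tupleS n (f : n.+1.-tuple R -> \bar R) :
  measurable_fun setT f -> (forall t, 0 <= f t)%E ->
  (\int[lebesgue_tuple R n.+1]_t f t =
   \int[lebesgue_tuple R n]_t \int[mu]_s f (tcons (s, t)))%E.
Proof.
move=> mf f0.
have -> : (\int[lebesgue_tuple R n.+1]_t f t =
    \int[(mu \x lebesgue_tuple R n)%E]_x (f \o @tcons R n) x)%E.
  by rewrite -[in RHS](preimage_setT (@tcons R n)) -ge0_integral_pushforward//; exact: measurable_tcons.
rewrite fubini_tonelli2//.
  by apply: measurableT_comp => //; exact: measurable_tcons.
by move=> x; exact: f0.
Qed.

Lemma sqnorm_tcons n (s : R) (t : n.-tuple R) :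
  sqnorm (tcons (s, t)) = s ^+ 2 + sqnorm t.
Proof.
rewrite /sqnorm big_ord_recl; congr (_ + _); apply: eq_bigr => i _.
by rewrite tnthS.
Qed.

Definition height n (t : n.-tuple R) : R := Num.sqrt (1 - sqnorm t).

Lemma height_gt0 n (t : n.-tuple R) : sqnorm t < 1 -> 0 < height t.
Proof. by move=> t1; rewrite /height sqrtr_gt0 subr_gt0. Qed.

(** The monomial x_0^m t^al in the graph chart x_0 = [height t], times the volume density 1 /
    [height t], extended by zero outside of the ball. *)
Definition ball_monomial n m (al : 'I_n -> nat) (t : n.-tuple R) : R :=
  if sqnorm t < 1 then (\prod_(i < n) tnth t i ^+ al i) * (height t ^+ m / height t) else 0.

Lemma measurable_height n : measurable_fun setT (@height n).
Proof.
apply: (measurableT_comp measurable_sqrt); apply: measurable_funB => //.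
exact: measurable_sqnorm.
Qed.

Lemma measurable_height_pow n m :
  measurable_fun setT (fun t : n.-tuple R => height t ^+ m / height t).
Proof.
have mh := @measurable_height n.
apply: measurable_funM; first exact: measurable_funX.
rewrite [X in measurable_fun _ X](_ : _ = (fun t => height t `^ (-1))).
  by apply: (measurableT_comp (measurable_powR _)).
by apply/funext => t; rewrite powR_inv1// sqrtr_ge0.
Qed.

Lemma measurable_ball_monomial n m al : measurable_fun setT (@ball_monomial n m al).
Proof.
apply: measurable_fun_ifT => //.
  by apply: measurable_fun_ltr => //; exact: measurable_sqnorm.
apply: measurable_funM; last exact: measurable_height_pow.
apply: measurable_prod => i _; apply: measurable_funX; exact: measurable_tnth.
Qed.

Lemma ball_monomial_ge0 n m al t : (forall i, ~~ odd (al i)) -> 0 <= @ball_monomial n m al t.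
Proof.
move=> oal; rewrite /ball_monomial; case: ifP => // _.
apply: mulr_ge0; last by rewrite divr_ge0// ?exprn_ge0// sqrtr_ge0.
by apply: prodr_ge0 => i _; rewrite real_exprn_even_ge0 ?num_real.
Qed.

(** Integrating out the first coordinate s, with exponent c, over |s| < [height t] gives an arcsine
    integral: a Wallis factor times height^(m+c), which is again a ball monomial with m + c + 1 in
    place of m. The intermediate Gamma factors telescope. *)
Lemma integral_ball_monomial n m (al : 'I_n -> nat) : (forall i, ~~ odd (al i)) ->
  (\int[lebesgue_tuple R n]_t (ball_monomial m al t)%:E =
   (half_gamma m * (\prod_(i < n) half_gamma (al i)) /
     half_gamma (m + \sum_(i < n) al i + n))%:E)%E.
Proof.
elim: n m al => [|n IH] m al oal.
  rewrite /= integral_dirac//; last by apply/measurable_EFinP; exact: measurable_ball_monomial.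
  rewrite diracT mul1e /ball_monomial /height /sqnorm !big_ord0 ltr01 subr0 sqrtr1 expr1n.
  by rewrite addn0 addn0 mul1r mulr1 divr1 divff// gt_eqF// half_gamma_gt0.
rewrite ge0_integral_lebesgue_tupleS; last 2 first.
- by apply/measurable_EFinP; exact: measurable_ball_monomial.
- by move=> t; rewrite lee_fin ball_monomial_ge0.
pose al' i := al (lift ord0 i).
have inner t : (\int[mu]_s (ball_monomial m al (tcons (s, t)))%:E =
    (wallis m (al ord0))%:E * (ball_monomial (m + al ord0).+1 al' t)%:E)%E.
  rewrite /ball_monomial; case: ifPn => [t1|t1]; last first.
    rewrite mule0; under eq_integral => s _.
      rewrite ifF; last first.
        apply/negbTE; move: t1; rewrite -!leNgt sqnorm_tcons => /le_trans; apply.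
        by rewrite lerDr sqr_ge0.
      over.
    by rewrite integral0.
  pose P : R := \prod_(i < n) tnth t i ^+ al' i.
  have a2 : height t ^+ 2 = 1 - sqnorm t by rewrite sqr_sqrtr// subr_ge0 ltW.
  transitivity (\int[mu]_(s in [set s | (s ^+ 2 < height t ^+ 2)%R])
      (P%:E * (arcsine_weight (height t) m (al ord0) s)%:E))%E.
    rewrite [RHS]integral_mkcond; apply: eq_integral => s _; rewrite patchE sqnorm_tcons.
    have -> : (s \in [set s | s ^+ 2 < height t ^+ 2]) = (s ^+ 2 + sqnorm t < 1).
      by apply/idP/idP; rewrite inE/= a2 ltrBrDr.
    case: ifP => // _; rewrite -EFinM; congr EFin.
    have hE : height (tcons (s, t)) = Num.sqrt (height t ^+ 2 - s ^+ 2).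
      by rewrite [LHS]/height sqnorm_tcons a2; congr Num.sqrt; ring.
    rewrite big_ord_recl /arcsine_weight hE.
    rewrite (_ : tnth (tcons (s, t)) ord0 = s)//.
    rewrite (_ : \prod_(i < n) _ = P); last first.
      apply: eq_bigr => i _; congr (_ ^+ _).
      by rewrite tnthS.
    by move: (_ ^+ m / _) => w; ring.
  have mS : measurable [set s : R | s ^+ 2 < height t ^+ 2].
    have : measurable_fun setT (fun s : R => s ^+ 2 < height t ^+ 2).
      by apply: measurable_fun_ltr => //; exact: measurable_funX.
    by move=> /(_ measurableT [set true]); rewrite setTI; apply.
  rewrite ge0_integralZl//; last 3 first.
  - apply/measurable_EFinP; apply: measurable_funTS.
    exact: measurable_arcsine_weight.
  - by move=> s _; rewrite lee_fin arcsine_weight_ge0.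
  - rewrite lee_fin; apply: prodr_ge0 => i _.
    by rewrite real_exprn_even_ge0 ?num_real// /al'.
  rewrite integral_arcsine_weight ?height_gt0// -!EFinM; congr EFin.
  rewrite exprSr mulfK ?gt_eqF ?height_gt0// -/P; ring.
under eq_integral do rewrite inner.
rewrite ge0_integralZl//; last 3 first.
- by apply/measurable_EFinP; exact: measurable_ball_monomial.
- by move=> t _; rewrite lee_fin ball_monomial_ge0// => i; rewrite /al'.
- rewrite lee_fin wallisE// divr_ge0// ?mulr_ge0//; exact/ltW/half_gamma_gt0.
rewrite IH; last by move=> i; rewrite /al'.
rewrite -EFinM wallisE//; congr EFin.
rewrite !big_ord_recl.
rewrite (_ : ((m + al ord0).+1 + \sum_(i < n) al' i + n =
  m + (al ord0 + \sum_(i < n) al (lift ord0 i)) + n.+1)%N); last by rewrite /al'; lia.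
have := half_gamma_gt0 (R := R) (m + al ord0).+1 => /lt0r_neq0.
move: (half_gamma (m + al ord0).+1) => x x0.
rewrite !mulrA; congr (_ / _).
rewrite -!mulrA; congr (_ * _); congr (_ * _).
by rewrite mulrA mulVf// mul1r.
Qed.

End tuple_integral.

Section density.
Local Open Scope ereal_scope.
Context d d' (T : measurableType d) (T' : measurableType d') (R : realType).
Variables (mu : {measure set T -> \bar R}) (nu : {measure set T' -> \bar R}).
Variables (phi : T -> T') (w : T -> R).
Hypotheses (mphi : measurable_fun setT phi) (mw : measurable_fun setT w).
Let mwE : measurable_fun setT (EFin \o w).
Proof. exact/measurable_EFinP. Qed.
Hypothesis w0 : forall t, (0 <= w t)%R.
Hypothesis nuE : forall A, measurable A -> nu A = \int[mu]_(t in phi @^-1` A) (w t)%:E.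

Import HBNNSimple.

(** For indicators this is [nuE]; simple functions and monotone convergence do the rest. It serves
    with a chart as [phi] and the volume density as [w]. *)
Lemma ge0_integral_density (f : T' -> \bar R) :
  measurable_fun setT f -> (forall x, 0 <= f x) ->
  \int[nu]_x f x = \int[mu]_t (f (phi t) * (w t)%:E).
Proof.
move=> mf f0.
pose f_ := nnsfun_approx measurableT mf.
have cvgf x : (f_ n x)%:E @[n --> \oo] --> f x by exact: cvg_nnsfun_approx.
transitivity (limn (fun n => \int[nu]_x (f_ n x)%:E)).
  rewrite -monotone_convergence//.
  - by apply: eq_integral => y _; apply/esym/cvg_lim.
  - by move=> n; exact/measurable_EFinP/measurable_funP.
  - by move=> n y _; rewrite lee_fin.
  - by move=> y _ m n mn; rewrite lee_fin; exact/lefP/nd_nnsfun_approx.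
transitivity (limn (fun n => \int[mu]_t ((f_ n (phi t))%:E * (w t)%:E))); last first.
  rewrite -monotone_convergence//.
  - apply: eq_integral => t _; apply/cvg_lim => //.
    apply: cvgeZr => //; exact: cvgf.
  - move=> n; apply: emeasurable_funM => //; apply/measurable_EFinP.
    by apply: measurableT_comp => //; exact/measurable_funP.
  - by move=> n y _; rewrite mule_ge0// lee_fin.
  - move=> y _ m n mn; rewrite lee_wpmul2r ?lee_fin//; exact/lefP/nd_nnsfun_approx.
congr (limn _); apply/funext => n.
have mpre r : measurable (phi @^-1` (f_ n @^-1` [set r])).
  by rewrite -[X in measurable X]setTI; exact: mphi.
transitivity (\sum_(k \in range (f_ n))
    \int[mu]_t (k%:E * ((\1_(phi @^-1` (f_ n @^-1` [set k])) t)%:E * (w t)%:E))).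
  under eq_integral do rewrite fimfunE -fsumEFin//.
  rewrite ge0_integral_fsum//; last 2 first.
  - by move=> y; exact/measurable_EFinP/measurable_funM.
  - by move=> y x _; rewrite nnfun_muleindic_ge0.
  apply: eq_fsbigr => r /[!inE] -[x _ <-].
  rewrite integralZl_indic_nnsfun// integral_indic// setIT.
  rewrite ge0_integralZl//; last 3 first.
  - apply: emeasurable_funM => //; apply/measurable_EFinP.
    exact: measurable_indic.
  - by move=> t _; rewrite mule_ge0// lee_fin.
  - by rewrite lee_fin.
  congr (_ * _); rewrite nuE// integral_mkcond; apply: eq_integral => t _.
  rewrite patchE indicE; case: ifPn => _; by rewrite ?mul1e ?mul0e.
rewrite -ge0_integral_fsum//.
- apply: eq_integral => t _.
  rewrite [in RHS]fimfunE -fsumEFin// ge0_mule_fsuml//.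
    by apply: eq_fsbigr => r _; rewrite EFinM muleA.
  by move=> r; rewrite nnfun_muleindic_ge0.
- move=> r; apply: measurable_funeM; apply: emeasurable_funM => //.
  by apply/measurable_EFinP; exact: measurable_indic.
- move=> r t _.
  rewrite muleA; apply: mule_ge0; last by rewrite lee_fin.
  exact: (nnfun_muleindic_ge0 (f_ n) r (phi t)).
Qed.
End density.

Section round_metric.
Context {R : realType} {n : nat}.

(** Two block triangular factorizations of the matrix with blocks 1, -v, u, 1. *)
Lemma det_add_rank1 (K : comNzRingType) m (u : 'cV[K]_m) (v : 'rV[K]_m) :
  \det (1%:M + u *m v) = 1 + (v *m u) 0 0.
Proof.
have e1 : block_mx 1%:M 0 u 1%:M *m block_mx 1%:M (- v) 0 (1%:M + u *m v) =
    block_mx 1%:M (- v) u 1%:M :> 'M[K]_(1 + m).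
  rewrite mulmx_block !(mul0mx, mulmx0, mul1mx, mulmx1, addr0, add0r).
  by rewrite mulmxN addrCA addNr addr0.
have e2 : block_mx 1%:M (- v) 0 1%:M *m block_mx (1%:M + v *m u) 0 u 1%:M =
    block_mx 1%:M (- v) u 1%:M :> 'M[K]_(1 + m).
  by rewrite mulmx_block !(mul0mx, mulmx0, mul1mx, mulmx1, addr0, add0r) mulNmx addrK.
have := congr1 determinant (etrans e1 (esym e2)).
rewrite !det_mulmx !det_lblock !det_ublock !det1 !mul1r mulr1 => ->.
by rewrite [RHS](_ : _ = (1%:M + v *m u) 0 0) ?det_mx11// !mxE.
Qed.

Lemma det_round_metric (t : n.-tuple R) : sqnorm t < 1 ->
  \det (round_metric t) = (height t ^+ 2)^-1.
Proof.
move=> t1; rewrite sqr_sqrtr ?subr_ge0 ?ltW//.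
have h0 : 1 - sqnorm t != 0 by rewrite subr_eq0 eq_sym lt_eqF.
pose u : 'cV[R]_n := \col_i (tnth t i / (1 - sqnorm t)).
pose v : 'rV[R]_n := \row_i tnth t i.
rewrite (_ : round_metric t = 1%:M + u *m v).
  rewrite det_add_rank1 mxE (_ : \sum_j _ = sqnorm t / (1 - sqnorm t)).
    by field.
  by rewrite /sqnorm big_distrl; apply: eq_bigr => i _; rewrite !mxE expr2 mulrA.
by apply/matrixP => i j; rewrite !mxE big_ord1 !mxE mulrAC.
Qed.

Lemma ge0_integral_hemisphere b (f : sphere R n -> \bar R) :
  measurable_fun setT f -> (forall x, 0 <= f x)%E ->
  (\int[hemisphere_volume b]_x f x =
   \int[lebesgue_tuple R n]_t (f (chart b t) * (if sqnorm t < 1 then (height t)^-1 else 0)%:E))%E.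
Proof.
move=> mf f0.
have mb : measurable_fun setT (fun t : n.-tuple R => sqnorm t < 1).
  by apply: measurable_fun_ltr => //; exact: measurable_sqnorm.
apply: ge0_integral_density => //.
- exact: measurable_chart.
- apply: measurable_fun_ifT => //.
  by have := @measurable_height_pow R n 0; under eq_fun do rewrite expr0 div1r.
- by move=> t; case: ifP => // _; rewrite invr_ge0 sqrtr_ge0.
- move=> A mA; transitivity (\int[lebesgue_tuple R n]_(t in chart b @^-1` A `&` [set t | (sqnorm t < 1)%R])
    (Num.sqrt (\det (round_metric t)))%:E)%E; first by [].
  rewrite integral_mkcondr; apply: eq_integral => t _; rewrite patchE.
  have -> : (t \in [set t | sqnorm t < 1]) = (sqnorm t < 1) by apply/idP/idP; rewrite inE.
  case: ifP => // t1; rewrite det_round_metric// sqrtrV ?sqr_ge0//.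
  by rewrite sqrtr_sqr ger0_norm// sqrtr_ge0.
Qed.

End round_metric.

Section reflection.
Context {R : realType}.
Local Notation mu := (@lebesgue_measure R).

Definition reflect_tuple n (j : 'I_n) (t : n.-tuple R) : n.-tuple R :=
  [tuple (-1) ^+ (i == j) * tnth t i | i < n].

Lemma reflect_tcons0 n (s : R) (t : n.-tuple R) :
  reflect_tuple ord0 (tcons (s, t)) = tcons (- s, t).
Proof.
apply: eq_from_tnth => i; rewrite tnth_mktuple.
case: (unliftP ord0 i) => [k ->|->]; last by rewrite eqxx expr1 mulN1r.
by rewrite eq_sym (negbTE (neq_lift _ _)) expr0 mul1r !tnthS.
Qed.

Lemma reflect_tconsS n (j : 'I_n) (s : R) (t : n.-tuple R) :
  reflect_tuple (lift ord0 j) (tcons (s, t)) = tcons (s, reflect_tuple j t).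
Proof.
apply: eq_from_tnth => i; rewrite tnth_mktuple.
case: (unliftP ord0 i) => [k ->|->].
  by rewrite !tnthS tnth_mktuple (inj_eq lift_inj).
by rewrite (negbTE (neq_lift _ _)) expr0 mul1r.
Qed.

Lemma measurable_reflect n (j : 'I_n) : measurable_fun setT (reflect_tuple j).
Proof.
apply/measurable_fun_tnthP => i.
rewrite [X in measurable_fun _ X](_ : _ = (fun t => (-1) ^+ (i == j) * tnth t i)).
  by apply: measurable_funM => //; exact: measurable_tnth.
by apply/funext => t /=; rewrite tnth_mktuple.
Qed.

Lemma ge0_integral_lebesgueN (f : R -> \bar R) : measurable_fun setT f ->
  (forall s, 0 <= f s)%E -> (\int[mu]_s f (- s)%R = \int[mu]_s f s)%E.
Proof.
move=> mf f0.
have mN : measurable_fun setT (-%R : R -> measurableTypeR R) by exact: oppr_measurable.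
transitivity (\int[pushforward mu (-%R : R -> measurableTypeR R)]_s f s)%E; last first.
  by apply: eq_measure_integral => A mA _; exact: lebesgue_measureN.
by rewrite ge0_integral_pushforward.
Qed.

Lemma ge0_integral_reflect n (j : 'I_n) (f : n.-tuple R -> \bar R) :
  measurable_fun setT f -> (forall t, 0 <= f t)%E ->
  (\int[lebesgue_tuple R n]_t f (reflect_tuple j t) = \int[lebesgue_tuple R n]_t f t)%E.
Proof.
elim: n j f => [[]//|n IH] j f mf f0.
rewrite !ge0_integral_lebesgue_tupleS//; last first.
  by apply: measurableT_comp => //; exact: measurable_reflect.
have mc t : measurable_fun setT (fun s => f (tcons (s, t))).
  apply: measurableT_comp => //.
  exact: (measurableT_comp (@measurable_tcons R n) (measurable_pair2 t)).
case: (unliftP ord0 j) => [k ->|->].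
  pose g t := (\int[mu]_s f (tcons (s, t)))%E.
  transitivity (\int[lebesgue_tuple R n]_t g (reflect_tuple k t))%E.
    by apply: eq_integral => t _; apply: eq_integral => s _; rewrite reflect_tconsS.
  rewrite IH//; last by move=> t; exact: integral_ge0.
  have := @measurable_fun_fubini_tonelli_G _ _ _ _ R mu (f \o @tcons R n).
  apply=> //; first by apply: measurableT_comp => //; exact: measurable_tcons.
  by move=> x /=.
apply: eq_integral => t _.
under eq_integral do rewrite reflect_tcons0.
exact: (ge0_integral_lebesgueN (mc t) (fun s => f0 _)).
Qed.
End reflection.

(** * Monomial moments on the sphere *)

Section sphere_moments.
Context {R : realType} {n : nat}.
Implicit Types (al : 'I_n.+1 -> nat) (x : sphere R n).

Definition sphere_monomial al x : R := \prod_(i < n.+1) tnth x i ^+ al i.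

(** The integral of x^al over one hemisphere x_0 > 0 or x_0 < 0 when all exponents are even. *)
Definition sphere_mass al : R :=
  (\prod_(i < n.+1) half_gamma (al i)) / half_gamma (\sum_(i < n.+1) al i + n).

Lemma sphere_mass_gt0 al : 0 < sphere_mass al.
Proof.
rewrite divr_gt0 ?half_gamma_gt0//; apply: prodr_gt0 => i _; exact: half_gamma_gt0.
Qed.

Lemma measurable_sphere_coord i : measurable_fun setT (fun x => tnth x i).
Proof.
apply: (measurableT_comp (@measurable_tnth _ _ _ i)).
by move=> _ A mA; exists A => //; rewrite setTI.
Qed.

Lemma measurable_sphere_monomial al : measurable_fun setT (sphere_monomial al).
Proof.
apply: measurable_prod => i _; apply: measurable_funX; exact: measurable_sphere_coord.
Qed.

Lemma sqnorm_sphere x : sqnorm x = 1.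
Proof. by case: x => x /= /eqP. Qed.

Lemma sphere_coord_le1 x i : `|tnth x i| <= 1.
Proof.
rewrite -(@ler_pXn2r _ 2) ?nnegrE// expr1n real_normK ?num_real//.
rewrite -(sqnorm_sphere x) /sqnorm (bigD1 i)//= lerDl.
by apply: sumr_ge0 => j _; exact: sqr_ge0.
Qed.

Lemma chartE b (t : n.-tuple R) : sqnorm t < 1 ->
  chart b t = tcons ((-1) ^+ b * height t, t) :> n.+1.-tuple R.
Proof.
move=> t1; rewrite /chart val_insubd ifT//.
rewrite (sqnorm_tcons _ t) exprMn sqr_sqrtr; last by rewrite subr_ge0 ltW.
by rewrite sqrr_sign mul1r subrK.
Qed.

Lemma sphere_monomial_chart b al t : sqnorm t < 1 ->
  sphere_monomial al (chart b t) =
  (-1) ^+ (b && odd (al ord0)) * (height t ^+ al ord0 * \prod_(i < n) tnth t i ^+ al (lift ord0 i)).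
Proof.
move=> t1; rewrite /sphere_monomial chartE// big_ord_recl.
rewrite (_ : tnth (tcons ((-1) ^+ b * height t, t)) ord0 = (-1) ^+ b * height t)//.
rewrite exprMn -!mulrA; congr (_ * (_ * _)).
  by case: b; rewrite ?expr0 ?expr1n ?expr1//= signr_odd.
by apply: eq_bigr => i _; rewrite tnthS.
Qed.

Let hemisphere b (f : sphere R n -> \bar R) := (\int[hemisphere_volume b]_x f x)%E.

Lemma integral_hemisphere_even b al : (forall i, ~~ odd (al i)) ->
  hemisphere b (EFin \o sphere_monomial al) = (sphere_mass al)%:E.
Proof.
move=> oal; rewrite /hemisphere ge0_integral_hemisphere; last 2 first.
- by apply/measurable_EFinP; exact: measurable_sphere_monomial.
- move=> x; rewrite lee_fin; apply: prodr_ge0 => i _.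
  by rewrite real_exprn_even_ge0 ?num_real.
transitivity (\int[lebesgue_tuple R n]_t
    (ball_monomial (al ord0) (fun i => al (lift ord0 i)) t)%:E)%E.
  apply: eq_integral => t _; rewrite /ball_monomial; case: ifP => t1; last by rewrite mule0.
  rewrite -EFinM /= sphere_monomial_chart// (negbTE (oal _)) andbF expr0 mul1r.
  by congr EFin; rewrite mulrAC mulrC.
rewrite integral_ball_monomial => [|i //].
by rewrite /sphere_mass !big_ord_recl.
Qed.

Lemma integral_riemannian (f : sphere R n -> \bar R) :
  measurable_fun setT f -> (forall x, 0 <= f x)%E ->
  (\int[riemannian_volume]_x f x = hemisphere false f + hemisphere true f)%E.
Proof. by move=> mf f0; rewrite ge0_integral_measure_add. Qed.

Lemma riemannian_volumeT : riemannian_volume [set: sphere R n] = (2 * sphere_mass (fun=> 0%N))%:E.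
Proof.
rewrite -[LHS]mul1e -integral_cst// integral_riemannian//.
have e : cst 1%E = EFin \o sphere_monomial (fun=> 0%N).
  by apply/funext => x /=; rewrite /sphere_monomial big1.
by rewrite [X in hemisphere _ X]e [X in (_ + hemisphere _ X)%E]e !integral_hemisphere_even// -EFinD mulr_natl mulr2n.
Qed.

Lemma ge0_integral_sphere (f : sphere R n -> \bar R) :
  measurable_fun setT f -> (forall x, 0 <= f x)%E ->
  (\int[sphere_measure]_x f x =
   ((2 * sphere_mass (fun=> 0%N))^-1)%:E * (hemisphere false f + hemisphere true f))%E.
Proof.
move=> mf f0; rewrite -integral_riemannian//.
have m0 : 0 < 2 * sphere_mass (fun=> 0%N) by rewrite mulr_gt0 ?sphere_mass_gt0.
have k0 : 0 <= (2 * sphere_mass (fun=> 0%N))^-1 by rewrite invr_ge0 ltW.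
rewrite -(ge0_integral_mscale _ _ (NngNum k0))//.
apply: eq_measure_integral => A mA _.
rewrite /sphere_measure/= /mnormalize riemannian_volumeT /=.
rewrite ifF; first by rewrite /mscale/= muleC.
by rewrite !orbF eqe gt_eqF.
Qed.

(** [f 1] and [f (-1)] are the positive and negative parts of the monomial, so that only nonnegative
    functions are transformed. Changing the sign of a coordinate with odd exponent exchanges them:
    for x_0 this swaps the hemispheres, otherwise it is a reflection within each chart. *)
Lemma hemisphere_odd al : (exists i, odd (al i)) ->
  let f (s : R) x := (Num.max (s * sphere_monomial al x) 0)%:E in
  (hemisphere false (f 1%R) + hemisphere true (f 1%R) =
   hemisphere false (f (-1)%R) + hemisphere true (f (-1)%R))%E.
Proof.
move=> [j oj] f.
have mf s : measurable_fun setT (f s).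
  apply/measurable_EFinP; apply: measurable_maxr => //.
  by apply: measurable_funM => //; exact: measurable_sphere_monomial.
have f0 s x : (0 <= f s x)%E by rewrite lee_fin le_max lexx orbT.
rewrite /hemisphere !ge0_integral_hemisphere//.
pose w (t : n.-tuple R) : R := if sqnorm t < 1 then (height t)^-1 else 0.
move: oj; case: (unliftP ord0 j) => [k ->|->] oj; last first.
  rewrite addeC; congr (_ + _)%E; apply: eq_integral => t _;
    case: ifP => t1; rewrite ?mule0//; congr (_ * _)%E;
    by rewrite /f !sphere_monomial_chart// oj /= ?expr0 ?expr1 ?mulN1r ?mul1r ?opprK.
have mw : measurable_fun setT w.
  apply: measurable_fun_ifT => //.
    by apply: measurable_fun_ltr => //; exact: measurable_sqnorm.
  by have := @measurable_height_pow R n 0; under eq_fun do rewrite expr0 div1r.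
have sq t : sqnorm (reflect_tuple k t) = sqnorm t :> R.
  by rewrite /sqnorm; apply: eq_bigr => i _; rewrite tnth_mktuple exprMn sqrr_sign mul1r.
have wE t : w (reflect_tuple k t) = w t by rewrite /w /height sq.
have refl b t : sqnorm t < 1 ->
    sphere_monomial al (chart b (reflect_tuple k t)) = - sphere_monomial al (chart b t).
  move=> t1; rewrite !sphere_monomial_chart ?sq// /height sq -!mulrN; congr (_ * (_ * _)).
  rewrite (bigD1 k)// [in RHS](bigD1 k)//= -mulNr; congr (_ * _).
    by rewrite tnth_mktuple eqxx expr1 mulN1r exprNn -signr_odd oj expr1 mulN1r.
  by apply: eq_bigr => i ik; rewrite tnth_mktuple (negbTE ik) expr0 mul1r.
have key b : (\int[lebesgue_tuple R n]_t (f 1%R (chart b t) * (w t)%:E) =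
    \int[lebesgue_tuple R n]_t (f (-1)%R (chart b t) * (w t)%:E))%E.
  rewrite -(ge0_integral_reflect k (f := fun t => f (-1)%R (chart b t) * (w t)%:E)%E).
  - apply: eq_integral => t _; rewrite wE /w; case: ifP => t1; last by rewrite !mule0.
    by rewrite /f refl// mul1r mulN1r opprK.
  - apply: emeasurable_funM; last exact/measurable_EFinP.
    by apply: measurableT_comp => //; exact: measurable_chart.
  - move=> t; rewrite mule_ge0// lee_fin /w; case: ifP => // _.
    by rewrite invr_ge0 sqrtr_ge0.
by rewrite !key.
Qed.

Definition sphere_moment al : R :=
  if [forall i, ~~ odd (al i)] then sphere_mass al / sphere_mass (fun=> 0%N) else 0.

Lemma bounded_sphere_integrable (f : sphere R n -> R) (M : R) : measurable_fun setT f ->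
  (forall x, `|f x| <= M) -> sphere_measure.-integrable setT (EFin \o f).
Proof.
move=> mf fM; apply: (@le_integrable _ _ _ _ _ _ _ (cst M%:E)) => //.
- exact/measurable_EFinP.
- by move=> x _ /=; rewrite lee_fin (le_trans (fM x))// ler_norm.
- by apply: finite_measure_integrable_cst.
Qed.

Lemma sphere_monomial_le1 al x : `|sphere_monomial al x| <= 1.
Proof.
rewrite normr_prod; apply: (@le_trans _ _ (\prod_(i < n.+1) 1)); last by rewrite big1.
apply: ler_prod => i _.
by rewrite normr_ge0 normrX exprn_ile1// sphere_coord_le1.
Qed.

Lemma integral_sphere_monomial al :
  (\int[sphere_measure]_x sphere_monomial al x = sphere_moment al)%R.
Proof.
have m0 := sphere_mass_gt0 (fun=> 0%N).
rewrite /Rintegral /sphere_moment; case: ifPn => [/forallP oal|].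
  rewrite ge0_integral_sphere.
  - rewrite !(@integral_hemisphere_even _ al)// -EFinD -EFinM /=.
    by field; rewrite gt_eqF.
  - by apply/measurable_EFinP; exact: measurable_sphere_monomial.
  - move=> x; rewrite lee_fin; apply: prodr_ge0 => i _.
    by rewrite real_exprn_even_ge0 ?num_real.
rewrite negb_forall; case/existsP => i; rewrite negbK => oi.
pose f (s : R) x := (Num.max (s * sphere_monomial al x) 0)%:E.
have mf s : measurable_fun setT (f s).
  apply/measurable_EFinP; apply: measurable_maxr => //.
  by apply: measurable_funM => //; exact: measurable_sphere_monomial.
have f0 s x : (0 <= f s x)%E by rewrite lee_fin le_max lexx orbT.
have e : (\int[sphere_measure]_x f 1%R x = \int[sphere_measure]_x f (-1)%R x)%E.
  by rewrite !ge0_integral_sphere// hemisphere_odd//; exists i.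
have i1 s : `|s| = 1 -> sphere_measure.-integrable setT (f s).
  move=> s1; apply: (@bounded_sphere_integrable (fun x => Num.max (s * sphere_monomial al x) 0) 1).
    exact/measurable_EFinP/mf.
  move=> x; rewrite ger0_norm ?le_max ?lexx ?orbT// ge_max ler01 andbT.
  by rewrite (le_trans (ler_norm _))// normrM s1 mul1r sphere_monomial_le1.
transitivity (fine (\int[sphere_measure]_x (f 1%R x - f (-1)%R x)))%E.
  congr fine; apply: eq_integral => x _; rewrite /f mul1r mulN1r -EFinB; congr EFin.
  case: (leP 0 (sphere_monomial al x)) => h.
    by rewrite max_r ?subr0// oppr_le0.
  by rewrite max_l ?opprK ?add0r// oppr_ge0 ltW.
rewrite integralB//; [|by apply: i1; rewrite normr1|by apply: i1; rewrite normrN1].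
rewrite e subee//; apply: integrable_fin_num => //; apply: i1; by rewrite normrN1.
Qed.

(** The functional equation of Gamma, in numerator and denominator; this is integration by parts for
    monomials. *)
Lemma sphere_moment_step al j (be := fun i => (al i + (i == j).*2)%N) :
  (\sum_(i < n.+1) al i + n.+1)%:R * sphere_moment be = (al j).+1%:R * sphere_moment al.
Proof.
rewrite /sphere_moment.
have -> : [forall i, ~~ odd (be i)] = [forall i, ~~ odd (al i)].
  by apply: eq_forallb => i; rewrite /be oddD odd_double addbF.
case: ifP => _; last by rewrite !mulr0.
move: (sphere_mass (fun=> 0%N)) (lt0r_neq0 (sphere_mass_gt0 (fun=> 0%N))) => q q0.
rewrite /sphere_mass.
have -> : (\sum_(i < n.+1) be i + n = (\sum_(i < n.+1) al i + n).+2)%N.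
  have e : (\sum_(i < n.+1) (i == j).*2 = 2)%N.
    by rewrite (bigD1 j)//= eqxx big1 ?addn0// => i /negbTE->.
  by rewrite /be big_split /= e; lia.
have -> : \prod_(i < n.+1) half_gamma (be i) = (al j).+1%:R / 2 * \prod_(i < n.+1) half_gamma (al i) :> R.
  rewrite (bigD1 j)// [in RHS](bigD1 j)//= mulrA /be eqxx addn2 half_gammaSS; congr (_ * _).
  by apply: eq_bigr => i /negbTE ij; rewrite ij addn0.
rewrite half_gammaSS -addnS.
have := half_gamma_gt0 (R := R) (\sum_(i < n.+1) al i + n) => /lt0r_neq0.
have : (\sum_(i < n.+1) al i + n.+1)%:R != 0 :> R by rewrite addnS pnatr_eq0.
move: (half_gamma (\sum_(i < n.+1) al i + n)) (_%:R : R) => x y y0 x0.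
move: (\prod_(i < n.+1) _) (_.+1%:R : R) => p u.
by field; rewrite q0 x0 y0.
Qed.

End sphere_moments.

(** * Polynomial calculus *)

Import -(notations) mpoly.

Section poly_calculus.
Variables (K : comNzRingType) (n : nat).
Local Notation P := (mpoly n K).
Local Notation "\X i" := (@mpolyX n K (mnm1 i)) (at level 8, i at level 2, format "\X i").
Local Notation D := (@mderiv n K).
Local Notation homog d := (@ishomog1 n K d mdeg).
Implicit Types (p q : P) (i j : 'I_n).

Definition euler p : P := \sum_(i < n) \X i * D i p.
(** The infinitesimal rotation in the (i, j) plane. *)
Definition rot i j p : P := \X i * D j p - \X j * D i p.

Lemma mderivXU i j : D i (\X j) = (i == j)%:R.
Proof.
rewrite mderivX mnm1E eq_sym; case: eqVneq => [->|_]; last by rewrite scale0r.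
by rewrite (_ : mnm_sub _ _ = mnm0) ?scale1r ?mpolyX0//; apply/mnmP => k; rewrite mnmBE subnn mnm0E.
Qed.

Fact euler_is_linear : linear euler.
Proof.
move=> a p q; rewrite /euler scaler_sumr -big_split; apply: eq_bigr => i _.
by rewrite linearP mulrDr scalerAr.
Qed.
HB.instance Definition _ := GRing.isLinear.Build K P P _ euler euler_is_linear.

Fact rot_is_linear i j : linear (rot i j).
Proof.
move=> a p q; rewrite /rot !linearP !mulrDr -!scalerAr scalerBr; ring.
Qed.
HB.instance Definition _ i j := GRing.isLinear.Build K P P _ (rot i j) (rot_is_linear i j).

Fact laplacian_is_linear : linear (@laplacian K n).
Proof.
move=> a p q; rewrite /laplacian scaler_sumr -big_split; apply: eq_bigr => i _.
by rewrite !linearP.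
Qed.
HB.instance Definition _ := GRing.isLinear.Build K P P _ (@laplacian K n) laplacian_is_linear.

Lemma mpolyX_mderivX i (m : multinom n) :
  \X i * D i (mpolyX K m) = (m i)%:R *: mpolyX K m.
Proof.
rewrite mderivX -scalerAr; case: (posnP (m i)) => [->|mi]; first by rewrite !scale0r.
by rewrite -mpolyXD addmC submK// lep1mP -lt0n.
Qed.

Lemma eulerX (m : multinom n) : euler (mpolyX K m) = (mdeg m)%:R *: mpolyX K m.
Proof.
rewrite /euler; under eq_bigr do rewrite mpolyX_mderivX.
by rewrite -scaler_suml -natr_sum mdegE.
Qed.

Lemma euler_homog d p : p \is homog d -> euler p = d%:R *: p.
Proof.
move=> /dhomogP hp; rewrite [in LHS](mpolyE p) linear_sum [in RHS](mpolyE p) scaler_sumr.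
by apply: eq_big_seq => m /hp dm; rewrite linearZ /= eulerX dm !scalerA mulrC.
Qed.

Lemma mpoly_ring_ind (Q : P -> Prop) : (forall c, Q (mpolyC n c)) -> (forall i, Q (\X i)) ->
  (forall p q, Q p -> Q q -> Q (p + q)) -> (forall p q, Q p -> Q q -> Q (p * q)) ->
  forall p, Q p.
Proof.
move=> QC QX QD QM p; rewrite (mpolyE p).
apply: big_ind => [||m _]; [by rewrite -mpolyC0|exact: QD|].
rewrite -mul_mpolyC; apply: (QM) => //; rewrite mpolyXE_id.
apply: big_ind => [||i _]; [by rewrite -mpolyC1|exact: QM|].
by elim: (m i) => [|k IH]; rewrite ?expr0 -?mpolyC1// exprS; apply: QM.
Qed.

Lemma mpoly_linear_ext (F G : P -> K) :
  linear_for *%R F -> linear_for *%R G ->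
  (forall m, F (mpolyX K m) = G (mpolyX K m)) -> F =1 G.
Proof.
move=> lF lG FG p.
have z (H : P -> K) : linear_for *%R H -> H 0 = 0.
  by move=> lH; have := lH (-1) 0 0; rewrite scaler0 addr0 mulN1r addNr.
rewrite (mpolyE p); apply: (big_ind (fun q => F q = G q)) => [|q r hq hr|m _].
- by rewrite !z.
- by rewrite -[q]scale1r lF lG hq hr.
- by rewrite -[_ *: _]addr0 lF lG FG !z.
Qed.

Lemma mpolyX_homog (m : multinom n) d : mdeg m = d -> mpolyX K m \is homog d.
Proof. by move=> md; rewrite dhomogX /= md. Qed.

Lemma mderiv_homog d i p : p \is homog d -> D i p \is homog d.-1.
Proof.
move=> /dhomogP hp; rewrite (mpolyE p) linear_sum big_seq rpred_sum// => m /hp /= md.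
rewrite linearZ rpredZ//= mderivX; case: (posnP (m i)) => [->|mi].
  by rewrite scale0r rpred0.
rewrite rpredZ// mpolyX_homog// -md.
have := congr1 mdeg (@submK n (mnm1 i) m _); rewrite mdegD mdeg1 => <-; last by rewrite lep1mP -lt0n.
by rewrite addn1.
Qed.

Lemma mderiv_homog0 i p : p \is homog 0 -> D i p = 0.
Proof.
move=> /dhomogP hp; rewrite (mpolyE p) linear_sum big_seq big1// => m /hp /= md.
rewrite linearZ /= mderivX; move/eqP: md; rewrite mdeg_eq0 => /eqP->.
by rewrite mnm0E scale0r scaler0.
Qed.

Lemma XU_homog i : \X i \is homog 1.
Proof. by rewrite mpolyX_homog// mdeg1. Qed.

Lemma rot_homog d i j p : p \is homog d -> rot i j p \is homog d.
Proof.
case: d => [|d] hp; first by rewrite /rot !mderiv_homog0// !mulr0 subrr rpred0.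
by rewrite rpredB// -add1n; apply: dhomogM; rewrite ?XU_homog// ; apply: (@mderiv_homog d.+1).
Qed.

Lemma mderivXM i j p : D i (\X j * p) = (i == j)%:R * p + \X j * D i p.
Proof. by rewrite mderivM mderivXU. Qed.

Lemma laplacianXM j p : laplacian (\X j * p) = D j p *+ 2 + \X j * laplacian p.
Proof.
rewrite /laplacian mulr_sumr.
rewrite (eq_bigr (fun i => ((i == j)%:R * D i p) *+ 2 + \X j * D i (D i p))); last first.
  move=> i _; rewrite mderivXM mderivD mderivXM -mpolyC_nat mderiv_mulC mpolyC_nat.
  by ring.
rewrite big_split /=; congr (_ + _).
rewrite (bigD1 j)//= eqxx mul1r big1 ?addr0// => i /negbTE->.
by rewrite mul0r mul0rn.
Qed.

Lemma laplacian_mderiv i p : laplacian (D i p) = D i (laplacian p).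
Proof.
rewrite /laplacian linear_sum; apply: eq_bigr => j _.
by rewrite mderiv_comm (mderiv_comm i).
Qed.

Lemma laplacian_rot i j p : laplacian (rot i j p) = rot i j (laplacian p).
Proof.
rewrite /rot linearB /= !laplacianXM !laplacian_mderiv (mderiv_comm i j); ring.
Qed.

Definition msqnorm : P := \sum_(i < n) \X i ^+ 2.

(** If all rotations annihilate [p], the left side vanishes and the gradient of [p] is radial. *)
Lemma sumX_rot j p : \sum_(i < n) \X i * rot i j p = msqnorm * D j p - \X j * euler p.
Proof.
rewrite /msqnorm /euler mulr_suml mulr_sumr -sumrB; apply: eq_bigr => i _.
rewrite /rot; ring.
Qed.

Lemma rotM i j p q : rot i j (p * q) = rot i j p * q + p * rot i j q.
Proof. rewrite /rot !mderivM; ring. Qed.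

Definition linform (b : 'I_n -> K) : P := \sum_(i < n) b i *: \X i.

Lemma linform_homog b k : linform b ^+ k \is homog k.
Proof.
rewrite -[k in homog k]mul1n; apply: dhomogMn.
by rewrite rpred_sum// => i _; rewrite rpredZ// XU_homog.
Qed.

Lemma mderiv_linform i b : D i (linform b) = mpolyC n (b i).
Proof.
rewrite /linform linear_sum (bigD1 i)//= linearZ /= mderivXU eqxx big1 ?addr0.
  by rewrite -mul_mpolyC mulr1.
by move=> j; rewrite eq_sym => /negbTE ij; rewrite linearZ /= mderivXU ij scaler0.
Qed.

Lemma mderivXn i p k : D i (p ^+ k.+1) = k.+1%:R *: (p ^+ k * D i p).
Proof.
elim: k => [|k IH]; first by rewrite expr1 mul1r scale1r.
rewrite exprS mderivM IH -scalerAr !scaler_nat mulrA -exprS [RHS]mulrS; ring.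
Qed.

Lemma mderiv_linformX i b k :
  D i (linform b ^+ k.+1) = (k.+1%:R * b i) *: linform b ^+ k.
Proof. by rewrite mderivXn mderiv_linform mulrC mul_mpolyC scalerA. Qed.

Lemma laplacian_linform b k : \sum_(i < n) b i ^+ 2 = 0 -> laplacian (linform b ^+ k) = 0.
Proof.
move=> b0; rewrite /laplacian; case: k => [|[|k]].
- by rewrite big1// => i _; rewrite expr0 -mpolyC1 mderivC mderiv0.
- by rewrite big1// => i _; rewrite expr1 mderiv_linform mderivC.
under eq_bigr => i _ do rewrite mderiv_linformX linearZ /= mderiv_linformX scalerA.
rewrite -scaler_suml (_ : \sum_i _ = k.+2%:R * k.+1%:R * \sum_(i < n) b i ^+ 2).
  by rewrite b0 mulr0 scale0r.
by rewrite mulr_sumr; apply: eq_bigr => i _; ring.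
Qed.

(** The restriction to the line through [x] in direction [v], as a univariate polynomial to which a
    formal differential equation applies. *)
Definition along (x v : 'I_n -> K) p : {poly K} :=
  mmap (@polyC K) (fun i => (x i)%:P + v i *: 'X) p.

Lemma along_horner x v p t : (along x v p).[t] = meval (fun i => x i + t * v i) p.
Proof.
elim/mpoly_ring_ind: p => [c|i|p q|p q].
- by rewrite /along mmapC hornerC mevalC.
- by rewrite /along mmapX mmap1U mevalXU !hornerE mulrC.
- by rewrite /along mmapD hornerD mevalD => -> ->.
- by rewrite /along rmorphM hornerM mevalM => -> ->.
Qed.

Lemma deriv_along x v p : (along x v p)^`() = \sum_(j < n) v j *: along x v (D j p).
Proof.
elim/mpoly_ring_ind: p => [c|i|p q IHp IHq|p q IHp IHq].
- rewrite /along mmapC derivC big1// => j _.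
  by rewrite mderivC mmap0 scaler0.
- rewrite /along mmapX mmap1U derivD derivC add0r derivZ derivX.
  rewrite (bigD1 i)//= mderivXU eqxx rmorph1 big1 ?addr0// => j /negbTE ij.
  by rewrite mderivXU ij rmorph0 scaler0.
- rewrite {1}/along mmapD derivD -!/(along x v _) IHp IHq -big_split; apply: eq_bigr => j _.
  by rewrite mderivD /along mmapD scalerDr.
- rewrite {1}/along rmorphM derivM /= -!/(along x v _) IHp IHq mulr_suml mulr_sumr -big_split.
  apply: eq_bigr => j _.
  by rewrite mderivM /along mmapD !rmorphM /= scalerDr -scalerAl -scalerAr.
Qed.

End poly_calculus.

(** * Integrals of polynomials over the sphere *)

Local Open Scope complex_scope.
Section complex_sphere_integral.
Context {R : realType} {n : nat}.
Local Notation C := R[i].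
Local Notation S := (sphere R n).
Local Notation mu := (@sphere_measure R n).
Local Notation ReC := (@complex.Re R).
Local Notation ImC := (@complex.Im R).
Implicit Types (f g : S -> C).

(** Stable under ring operations and conjugation, true of polynomials, and sufficient for
    integrability over a probability measure. *)
Definition tame f :=
  [/\ measurable_fun setT (ReC \o f), measurable_fun setT (ImC \o f) &
      exists M, forall x, `|ReC (f x)| <= M /\ `|ImC (f x)| <= M].

Lemma tameD f g : tame f -> tame g -> tame (fun x => f x + g x).
Proof.
move=> [rf imf [M hM]] [rg img [N hN]]; split.
- by rewrite (_ : _ \o _ = (ReC \o f) \+ (ReC \o g))%R; [exact: measurable_funD|apply/funext=> x /=; rewrite raddfD].
- by rewrite (_ : _ \o _ = (ImC \o f) \+ (ImC \o g))%R; [exact: measurable_funD|apply/funext=> x /=; rewrite raddfD].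
- exists (M + N) => x; have [? ?] := hM x; have [? ?] := hN x.
  by rewrite !raddfD /=; split; rewrite (le_trans (ler_normD _ _))// lerD.
Qed.

Lemma ReM (a b : C) : ReC (a * b) = ReC a * ReC b - ImC a * ImC b.
Proof. by case: a => ? ?; case: b. Qed.

Lemma ImM (a b : C) : ImC (a * b) = ReC a * ImC b + ImC a * ReC b.
Proof. by case: a => ? ?; case: b. Qed.

Lemma tameM f g : tame f -> tame g -> tame (fun x => f x * g x).
Proof.
move=> [rf imf [M hM]] [rg img [N hN]]; split.
- rewrite (_ : _ \o _ = ((ReC \o f) \* (ReC \o g)) \- ((ImC \o f) \* (ImC \o g)))%R.
    by apply: measurable_funB; exact: measurable_funM.
  by apply/funext => x; rewrite /= ReM.
- rewrite (_ : _ \o _ = ((ReC \o f) \* (ImC \o g)) \+ ((ImC \o f) \* (ReC \o g)))%R.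
    by apply: measurable_funD; exact: measurable_funM.
  by apply/funext => x; rewrite /= ImM.
- exists (M * N + M * N) => x; have [? ?] := hM x; have [? ?] := hN x.
  by rewrite ReM ImM; split; rewrite ?(le_trans (ler_normB _ _)) ?(le_trans (ler_normD _ _))// !normrM lerD// ler_pM.
Qed.

Lemma tame_cst c : tame (fun=> c).
Proof.
split; [exact: measurable_cst|exact: measurable_cst|].
by exists (Num.max `|ReC c| `|ImC c|) => x; rewrite !le_max !lexx orbT.
Qed.

Lemma tame_real (h : S -> R) M : measurable_fun setT h -> (forall x, `|h x| <= M) -> tame (fun x => (h x)%:C).
Proof.
move=> mh hM; split; [exact: mh|exact: measurable_cst|]; exists M => x; split=> //=.
by rewrite normr0 (le_trans (normr_ge0 (h x))).
Qed.

Lemma tame_conj f : tame f -> tame (fun x => conjc (f x)).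
Proof.
move=> [rf imf [M hM]]; split.
- by rewrite (_ : _ \o _ = ReC \o f)//; apply/funext => x /=; case: (f x).
- rewrite (_ : _ \o _ = (fun x => - (ImC (f x)))); first exact: measurable_funN.
  by apply/funext => x /=; case: (f x).
- by exists M => x; have := hM x; case: (f x) => a b /=; rewrite normrN.
Qed.

Lemma tame_sum (I : Type) (r : seq I) (P : pred I) (F : I -> S -> C) :
  (forall i, tame (F i)) -> tame (fun x => \sum_(i <- r | P i) F i x).
Proof.
move=> tF; elim: r => [|i r IH].
  by rewrite (_ : (fun x => _) = fun=> 0); [exact: tame_cst|apply/funext => x; rewrite big_nil].
rewrite (_ : (fun x => _) = fun x => (if P i then F i x else 0) + \sum_(j <- r | P j) F j x).
  by apply: tameD => //; case: (P i) => //; exact: tame_cst.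
by apply/funext => x; rewrite big_cons; case: ifP; rewrite ?add0r.
Qed.

Lemma tame_integrable f : tame f ->
  mu.-integrable setT (EFin \o (ReC \o f)) /\ mu.-integrable setT (EFin \o (ImC \o f)).
Proof.
by move=> [rf imf [M hM]]; split; apply: (@bounded_sphere_integrable _ _ _ M) => // x; have [] := hM x.
Qed.

Lemma sphere_integralD f g : tame f -> tame g ->
  sphere_integral (fun x => f x + g x) = sphere_integral f + sphere_integral g.
Proof.
move=> /tame_integrable[rf imf] /tame_integrable[rg img].
apply/eqP; rewrite eq_complex /= -!RintegralD//; apply/andP; split; apply/eqP;
  by apply: eq_Rintegral => x _; rewrite raddfD.
Qed.

Lemma sphere_integralZ c f : tame f ->
  sphere_integral (fun x => c * f x) = c * sphere_integral f.
Proof.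
move=> /tame_integrable[rf imf]; case: c => a b; apply/eqP; rewrite eq_complex /=.
have iZ h k : mu.-integrable setT (EFin \o h) -> mu.-integrable setT (EFin \o (fun x => k * h x)).
  by move=> ih; exact: (@integrableZl _ _ _ mu setT measurableT k (EFin \o h) ih).
rewrite -!RintegralZl//; apply/andP; split; apply/eqP.
  rewrite -RintegralB//; [|exact: iZ|exact: iZ].
  by apply: eq_Rintegral => x _; rewrite ReM.
rewrite -RintegralD//; [|exact: iZ|exact: iZ].
by apply: eq_Rintegral => x _; rewrite ImM.
Qed.

Lemma sphere_integral_real (h : S -> R) :
  sphere_integral (fun x => (h x)%:C) = (\int[mu]_x h x)%R%:C.
Proof.
by apply/eqP; rewrite eq_complex /= eqxx /= Rintegral_cst// mul0r.
Qed.

Lemma sphere_integral_conj f : tame f -> sphere_integral (fun x => conjc (f x)) = conjc (sphere_integral f).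
Proof.
move=> tf; apply/eqP; rewrite eq_complex /=; apply/andP; split; apply/eqP.
  by apply: eq_Rintegral => x _; case: (f x).
rewrite (_ : (fun x => complex.Im (conjc (f x))) = (fun x => (-1) * ImC (f x))).
  by rewrite RintegralZl// ?mulN1r//; case/tame_integrable : tf.
by apply/funext => x; case: (f x) => a b; rewrite mulN1r.
Qed.

Definition spoly (p : mpoly n.+1 C) : S -> C :=
  fun x => meval (fun i => (tnth x i)%:C) p.

Lemma tame_spoly p : tame (spoly p).
Proof.
elim/mpoly_ring_ind: p => [c|i|p q|p q].
- by rewrite (_ : spoly _ = fun=> c); [exact: tame_cst|apply/funext => x; rewrite /spoly mevalC].
- rewrite (_ : spoly _ = fun x => (tnth x i)%:C).
    apply: (@tame_real _ 1); first exact: measurable_sphere_coord.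
    by move=> x; exact: sphere_coord_le1.
  by apply/funext => x; rewrite /spoly mevalXU.
- by move=> tp tq; have := tameD tp tq; congr tame; apply/funext => x; rewrite /spoly mevalD.
- by move=> tp tq; have := tameM tp tq; congr tame; apply/funext => x; rewrite /spoly mevalM.
Qed.

Definition sphere_mean (p : mpoly n.+1 C) : C := sphere_integral (spoly p).

Fact sphere_mean_is_linear : linear_for *%R sphere_mean.
Proof.
move=> a p q; rewrite /sphere_mean -sphere_integralZ; last exact: tame_spoly.
rewrite -sphere_integralD; last 2 first.
- by apply: tameM; [exact: tame_cst|exact: tame_spoly].
- exact: tame_spoly.
by congr sphere_integral; apply/funext => x; rewrite /spoly mevalD mevalZ.
Qed.
HB.instance Definition _ := GRing.isLinear.Build C (mpoly n.+1 C) C *%R sphere_mean sphere_mean_is_linear.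

Lemma sphere_meanX (m : multinom n.+1) :
  sphere_mean (mpolyX C m) = (@sphere_moment R n (fun i => m i))%:C.
Proof.
rewrite -integral_sphere_monomial -sphere_integral_real; congr sphere_integral; apply/funext => x.
by rewrite /spoly mevalX /sphere_monomial rmorph_prod; apply: eq_bigr => i _; rewrite rmorphXn.
Qed.

Lemma sphere_mean1 : sphere_mean 1 = 1.
Proof.
rewrite -mpolyX0 sphere_meanX /sphere_moment ifT; last by apply/forallP => i; rewrite mnm0E.
rewrite (_ : (fun i => _) = fun=> 0%N); last by apply/funext => i; rewrite mnm0E.
by rewrite divff// gt_eqF// sphere_mass_gt0.
Qed.

(** Integration by parts on the sphere. With the Euler operator in place of a degree both sides are
    linear in [p], so monomials suffice. *)
Lemma sphere_mean_XU j p :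
  sphere_mean (mpolyX C (mnm1 j) * (n%:R *: p + euler p)) = sphere_mean (mderiv j p).
Proof.
pose F p : C := sphere_mean (mpolyX C (mnm1 j) * (n%:R *: p + euler p)).
pose G p : C := sphere_mean (mderiv j p).
apply: (@mpoly_linear_ext C n.+1 F G).
- move=> a q r; rewrite /F -linearP; congr (sphere_mean _).
  rewrite [euler _]linearP /= -!mul_mpolyC; ring.
- by move=> a q r; rewrite /G !linearP.
move=> m; rewrite /F /G eulerX -scalerDl -natrD -scalerAr linearZ mderivX linearZ /=.
rewrite -mpolyXD !sphere_meanX.
(* For [m j = 0] the derivative vanishes, and so does the left side, where x_j occurs with exponent
   1. *)
case: (posnP (m j)) => mj.
  rewrite mj mul0r /sphere_moment ifF ?mulr0//.
  by apply/negbTE; rewrite negb_forall; apply/existsP; exists j; rewrite mnmDE mnm1E eqxx mj.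
pose m' := mnm_sub m (mnm1 j).
have := @sphere_moment_step R n (fun i => m' i) j.
rewrite /= (_ : (fun i => (m' i + (i == j).*2)%N) = fun i => mnm_add (mnm1 j) m i); last first.
  apply/funext => i; rewrite mnmDE mnmBE mnm1E [j == i]eq_sym.
  by case: (eqVneq i j) => [->|_] /=; lia.
have -> : (m' j).+1 = m j by rewrite mnmBE mnm1E eqxx subn1 prednK.
rewrite -mdegE (_ : (mdeg m' + n.+1 = n + mdeg m)%N).
  by move=> /(congr1 (real_complex R)); rewrite !rmorphM /= !rmorph_nat.
have := congr1 mdeg (@submK n.+1 (mnm1 j) m _); rewrite mdegD mdeg1 -/m'.
by move=> <-; [lia|rewrite lep1mP -lt0n].
Qed.
End complex_sphere_integral.
Local Close Scope complex_scope.

(** * Spherical harmonics in terms of an abstract mean value *)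

Section harmonic_polynomials.
Variables (C : numClosedFieldType) (n : nat).
Hypothesis n_gt0 : (0 < n)%N.
Local Notation P := (mpoly n.+1 C).
Local Notation "\X i" := (@mpolyX n.+1 C (mnm1 i)) (at level 8, i at level 2, format "\X i").
Local Notation D := (@mderiv n.+1 C).
Local Notation homog d := (@ishomog1 n.+1 C d mdeg).
Local Notation conj := (@Num.conj C).
Implicit Types (p q : P) (i j : 'I_n.+1).

Definition pbar p : P := map_mpoly conj p.
Definition harmonic k p := p \is homog k /\ laplacian p = 0.

Variable E : {scalar P}.
Hypothesis E_XU : forall j p, E (\X j * (n%:R *: p + euler p)) = E (D j p).
Hypothesis E1 : E 1 = 1.
Hypothesis E_pbar : forall p, E (pbar p) = conj (E p).
Hypothesis E_ge0 : forall p, 0 <= E (p * pbar p).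

Definition herm p q : C := E (p * pbar q).

Lemma pbarD p q : pbar (p + q) = pbar p + pbar q. Proof. exact: rmorphD. Qed.
Lemma pbarB p q : pbar (p - q) = pbar p - pbar q. Proof. exact: rmorphB. Qed.
Lemma pbarM p q : pbar (p * q) = pbar p * pbar q. Proof. exact: rmorphM. Qed.
Lemma pbarZ c p : pbar (c *: p) = conj c *: pbar p. Proof. exact: map_mpolyZ. Qed.
Lemma pbar_sum (I : Type) (r : seq I) (Q : pred I) (F : I -> P) :
  pbar (\sum_(i <- r | Q i) F i) = \sum_(i <- r | Q i) pbar (F i).
Proof. exact: rmorph_sum. Qed.

Lemma pbar0 : pbar 0 = 0. Proof. exact: rmorph0. Qed.

Lemma mderiv_pbar i p : D i (pbar p) = pbar (D i p).
Proof.
apply/mpolyP => m; rewrite mcoeff_deriv !mcoeff_map_mpoly mcoeff_deriv.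
by rewrite raddfMn.
Qed.

Lemma pbarX i : pbar (\X i) = \X i.
Proof. by rewrite /pbar map_mpolyX. Qed.

Lemma pbarC c : pbar (mpolyC _ c) = mpolyC _ (conj c).
Proof. exact: map_mpolyC. Qed.

Lemma mcoeff_pbar m p : mcoeff m (pbar p) = conj (mcoeff m p).
Proof. exact: mcoeff_map_mpoly. Qed.

Opaque pbar.

Lemma rot_pbar i j p : rot i j (pbar p) = pbar (rot i j p).
Proof.
by rewrite /rot !mderiv_pbar pbarB !pbarM !pbarX.
Qed.

Lemma laplacian_pbar p : laplacian (pbar p) = pbar (laplacian p).
Proof. by rewrite /laplacian pbar_sum; apply: eq_bigr => i _; rewrite !mderiv_pbar. Qed.

Lemma pbar_homog d p : p \is homog d -> pbar p \is homog d.
Proof.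
move=> hp; apply/dhomogP => m /=; rewrite mcoeff_msupp mcoeff_pbar => pm.
apply/eqP; apply: contraNT pm => dm; apply/eqP.
by rewrite (dhomog_nemf_coeff hp dm) rmorph0.
Qed.

Lemma meval_pbar (u : 'I_n.+1 -> C) p : (forall i, conj (u i) = u i) ->
  meval u (pbar p) = conj (meval u p).
Proof.
move=> ru; elim/mpoly_ring_ind: p => [c|i|p q hp hq|p q hp hq].
- by rewrite pbarC !mevalC.
- by rewrite pbarX mevalXU ru.
- by rewrite pbarD !mevalD hp hq rmorphD.
- by rewrite pbarM !mevalM hp hq rmorphM.
Qed.

Lemma pbarK p : pbar (pbar p) = p.
Proof. by apply/mpolyP => m; rewrite !mcoeff_pbar conjCK. Qed.

Lemma herm_conj p q : herm q p = conj (herm p q).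
Proof. by rewrite /herm -E_pbar pbarM pbarK mulrC. Qed.

Lemma hermDl p q r : herm (p + q) r = herm p r + herm q r.
Proof. by rewrite /herm mulrDl linearD. Qed.
Lemma hermZl a p r : herm (a *: p) r = a * herm p r.
Proof. by rewrite /herm -scalerAl linearZ. Qed.
Lemma herm_suml (I : Type) (s : seq I) (Q : pred I) (F : I -> P) r :
  herm (\sum_(i <- s | Q i) F i) r = \sum_(i <- s | Q i) herm (F i) r.
Proof. by rewrite /herm mulr_suml linear_sum. Qed.
Lemma hermZr a p r : herm p (a *: r) = conj a * herm p r.
Proof. by rewrite /herm pbarZ -scalerAr linearZ. Qed.
Lemma herm_sumr (I : Type) (s : seq I) (Q : pred I) (F : I -> P) r :
  herm r (\sum_(i <- s | Q i) F i) = \sum_(i <- s | Q i) herm r (F i).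
Proof. by rewrite /herm pbar_sum mulr_sumr linear_sum. Qed.

Lemma herm_ge0 p : 0 <= herm p p. Proof. exact: E_ge0. Qed.

Lemma mean_XU_homog d j q : q \is homog d -> (n + d)%:R * E (\X j * q) = E (D j q).
Proof.
move=> hq; rewrite -E_XU (euler_homog hq) -scalerDl -natrD.
by rewrite -scalerAr linearZ.
Qed.

(** Integration by parts turns both terms into the same multiple of E(D_i D_j q). *)
Lemma mean_rot d i j q : q \is homog d -> E (rot i j q) = 0.
Proof.
case: d => [|d] hq.
  by rewrite /rot !(mderiv_homog0 _ hq) !mulr0 subrr linear0.
have nd : (n + d)%:R != 0 :> C by rewrite pnatr_eq0; lia.
rewrite /rot linearB /=; apply: (mulfI nd); rewrite mulrBr mulr0.
rewrite !(@mean_XU_homog d) ?(@mderiv_homog _ _ d.+1)//.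
by rewrite mderiv_comm subrr.
Qed.

Lemma mean_laplacian d q : q \is homog d.+1 ->
  (d.+1 * (n + d))%:R * E q = E (laplacian q).
Proof.
move=> hq; rewrite natrM mulrAC mulrC.
have -> : d.+1%:R * E q = \sum_j E (\X j * D j q).
  by rewrite -linear_sum -[\sum_j _]/(euler q) (euler_homog hq) linearZ.
rewrite mulr_sumr /laplacian linear_sum; apply: eq_bigr => j _.
by rewrite mean_XU_homog// (@mderiv_homog _ _ d.+1).
Qed.

Lemma harmonic_mderiv k i p : harmonic k p -> harmonic k.-1 (D i p).
Proof. by move=> [hp lp]; split; [exact: mderiv_homog|rewrite laplacian_mderiv lp mderiv0]. Qed.

Lemma harmonic_rot k i j p : harmonic k p -> harmonic k (rot i j p).
Proof. by move=> [hp lp]; split; [exact: rot_homog|rewrite laplacian_rot lp linear0]. Qed.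

Lemma harmonicD k p q : harmonic k p -> harmonic k q -> harmonic k (p + q).
Proof. by move=> [hp lp] [hq lq]; split; [exact: rpredD|rewrite linearD /= lp lq addr0]. Qed.
Lemma harmonicZ k a p : harmonic k p -> harmonic k (a *: p).
Proof. by move=> [hp lp]; split; [exact: rpredZ|rewrite linearZ /= lp scaler0]. Qed.
Lemma harmonic_sum k (I : Type) (s : seq I) (Q : pred I) (F : I -> P) :
  (forall l, harmonic k (F l)) -> harmonic k (\sum_(l <- s | Q l) F l).
Proof.
move=> h; split; first by rewrite rpred_sum// => l _; have [] := h l.
by rewrite linear_sum big1// => l _; have [] := h l.
Qed.

Lemma laplacianM p q :
  laplacian (p * q) = laplacian p * q + (\sum_i D i p * D i q) *+ 2 + p * laplacian q.
Proof.
rewrite /laplacian mulr_suml mulr_sumr -sumrMnl -!big_split; apply: eq_bigr => i _ /=.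
rewrite !mderivM mderivD !mderivM; ring.
Qed.

(** The Laplacian of a product of two harmonic polynomials is twice the product of their gradients;
    [mean_laplacian] in degree 2k + 2 then applies, and the factors 2 cancel. *)
Lemma herm_harmonic k p q : harmonic k.+1 p -> harmonic k.+1 q ->
  (k.+1 * (n + k.*2.+1))%:R * herm p q = \sum_i herm (D i p) (D i q).
Proof.
move=> [hp lp] [hq lq].
have hpq : p * pbar q \is homog (k.*2.+1).+1.
  by rewrite (_ : _.+2 = k.+1 + k.+1)%N; [apply: dhomogM => //; exact: pbar_homog|lia].
have := mean_laplacian hpq.
rewrite laplacianM laplacian_pbar lp lq mul0r add0r pbar0 mulr0 addr0.
rewrite linearMn linear_sum -[RHS]mulr_natl.
rewrite (_ : (k.*2.+2 * (n + k.*2.+1) = 2 * (k.+1 * (n + k.*2.+1)))%N); last by lia.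
have two0 : 2%:R != 0 :> C by rewrite pnatr_eq0.
rewrite natrM -mulrA => /(mulfI two0)->.
by apply: eq_bigr => i _; rewrite /herm mderiv_pbar.
Qed.

(** Definiteness by induction on the degree: a harmonic polynomial of norm zero has partial
    derivatives of norm zero, by [herm_harmonic], and Euler's identity recovers it from these. *)
Lemma herm_eq0 k p : harmonic k p -> herm p p = 0 -> p = 0.
Proof.
elim: k p => [|k IH] p hp.
  have [h0 _] := hp; move: h0 => /dhomogP h0.
  have -> : p = mpolyC _ (mcoeff mnm0 p).
    apply/mpolyP => m; rewrite mcoeffC; case: eqVneq => [->|m0]; first by rewrite mulr1.
    rewrite mulr0; apply/eqP; apply: contraNT m0; rewrite -mcoeff_msupp => /h0 /eqP.
    by rewrite mdeg_eq0.
  move: (mcoeff mnm0 p) => c.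
  rewrite /herm pbarC -mpolyCM -[mpolyC _ _]mulr1 mul_mpolyC linearZ /= E1 mulr1.
  by rewrite -normCK => /eqP; rewrite sqrf_eq0 normr_eq0 => /eqP->; rewrite mpolyC0.
move=> h0; have := herm_harmonic hp hp; rewrite h0 mulr0 => /esym s0.
have D0 i : D i p = 0.
  apply: IH; first exact: (harmonic_mderiv i hp).
  move/eqP : s0; rewrite psumr_eq0 => [/allP/(_ i)|j _]; last exact: herm_ge0.
  by rewrite mem_index_enum => /(_ isT) /eqP.
have [hp' _] := hp; have := euler_homog hp'.
rewrite /euler big1 => [/esym/eqP|i _]; last by rewrite D0 mulr0.
by rewrite scaler_eq0 pnatr_eq0 => /eqP.
Qed.

Lemma herm_rot k i j p q : harmonic k p -> harmonic k q ->
  herm (rot i j p) q = - herm p (rot i j q).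
Proof.
move=> [hp _] [hq _]; apply/eqP; rewrite -addr_eq0 /herm -rot_pbar -linearD -rotM.
by rewrite (@mean_rot (k + k))//; apply: dhomogM => //; exact: pbar_homog.
Qed.

End harmonic_polynomials.

(** * The reproducing kernel is constant on the sphere *)

Section orthonormal_polynomials.
Variables (C : numClosedFieldType) (n : nat).
Hypothesis n_gt0 : (0 < n)%N.
Local Notation P := (mpoly n.+1 C).
Local Notation "\X i" := (@mpolyX n.+1 C (mnm1 i)) (at level 8, i at level 2, format "\X i").
Local Notation D := (@mderiv n.+1 C).
Local Notation homog d := (@ishomog1 n.+1 C d mdeg).
Local Notation conj := (@Num.conj C).
Local Notation harmonic := (@harmonic C n).
Implicit Types (p q : P) (i j : 'I_n.+1).

Variable E : {scalar P}.
Hypothesis E_XU : forall j p, E (\X j * (n%:R *: p + euler p)) = E (D j p).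
Hypothesis E1 : E 1 = 1.
Hypothesis E_pbar : forall p, E (pbar p) = conj (E p).
Hypothesis E_ge0 : forall p, 0 <= E (p * pbar p).
Local Notation herm := (herm E).

Definition onf k N (f : 'I_N -> P) :=
  (forall a, harmonic k (f a)) /\ (forall a b, herm (f a) (f b) = (a == b)%:R).

Definition onb k N (f : 'I_N -> P) :=
  onf k f /\ forall p, harmonic k p -> p = \sum_(a < N) herm p (f a) *: f a.

Lemma herm_onf k N (f : 'I_N -> P) (c : 'I_N -> C) b : onf k f ->
  herm (\sum_(a < N) c a *: f a) (f b) = c b.
Proof.
move=> [_ of_]; rewrite herm_suml (bigD1 b)//= hermZl of_ eqxx mulr1 big1 ?addr0// => a ab.
by rewrite hermZl of_ (negbTE ab) mulr0.
Qed.

(** Formally A / B^k has derivative zero. Uniqueness is read off the coefficients: [W] solves the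
    same linear equation with W(0) = 0, and B(0) = 1 determines each coefficient by the earlier
    ones. *)
Lemma polyODE (A B : {poly C}) k : B.[0] = 1 ->
  B * A^`() = k%:R *: (B^`() * A) -> A = A.[0] *: B ^+ k.
Proof.
move=> B0 AB; pose W := A - A.[0] *: B ^+ k.
have W0 : W`_0 = 0.
  by rewrite -horner_coef0 /W hornerD hornerN hornerZ horner_exp B0 expr1n mulr1 subrr.
have WB : B * W^`() = k%:R *: (B^`() * W).
  rewrite /W derivB derivZ mulrBr AB mulrBr scalerBr; congr (_ - _).
  rewrite -!scalerAr deriv_exp scalerA [k%:R * _]mulrC -scalerA; congr (_ *: _).
  case: k {AB W W0} => [|k]; first by rewrite mulr0n mulr0 scale0r.
  by rewrite scaler_nat mulrnAr exprS /=; congr (_ *+ _); ring.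
suff : W = 0 by move/eqP; rewrite subr_eq0 => /eqP.
apply/polyP => m; rewrite coef0; elim/ltn_ind: m => -[|m] IH //.
have := congr1 (fun p : {poly C} => p`_m) WB; rewrite coefZ !coefM.
rewrite big_ord_recl /= subn0 big1 ?addr0 => [|i _]; last first.
  rewrite coef_deriv /bump /= IH ?mul0rn ?mulr0//; have := ltn_ord i; lia.
rewrite [X in _ = _ * X]big1 => [|i _]; last by rewrite (IH (m - i)%N) ?mulr0//; lia.
rewrite mulr0 -horner_coef0 B0 mul1r coef_deriv => /eqP.
by rewrite mulrn_eq0 /= => /eqP.
Qed.

(** By [sumX_rot] and Euler, |x|^2 D_j q = 2 d x_j q. On the line through [x] and [y], which may
    leave the sphere, this is the equation of [polyODE] with [B] the restriction of |x|^2. So q is a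
    constant times B^d there, and B = 1 at both points. *)
Lemma rot_invariant_const d (q : P) : q \is homog d.*2 -> (forall i j, rot i j q = 0) ->
  forall x y : 'I_n.+1 -> C, \sum_i x i ^+ 2 = 1 -> \sum_i y i ^+ 2 = 1 -> meval x q = meval y q.
Proof.
move=> hq rq x y x1 y1.
pose v i : C := y i - x i.
have key j : @msqnorm C n.+1 * D j q = (d.*2)%:R *: (\X j * q).
  have := sumX_rot j q; rewrite big1 => [|i _]; last by rewrite rq mulr0.
  by move/esym/eqP; rewrite subr_eq0 => /eqP->; rewrite (euler_homog hq) scalerAr.
pose A := along x v q; pose B := along x v (@msqnorm C n.+1).
have AB : B * A^`() = d%:R *: (B^`() * A).
  rewrite /A /B !deriv_along mulr_sumr mulr_suml scaler_sumr; apply: eq_bigr => j _.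
  rewrite -scalerAr -scalerAl scalerA [d%:R * _]mulrC -scalerA; congr (_ *: _).
  rewrite /along -!rmorphM key.
  have -> : D j (@msqnorm C n.+1) = 2%:R *: \X j.
    rewrite /msqnorm linear_sum (bigD1 j)//= big1 ?addr0 => [|i ij].
      by rewrite mderivXn expr1 mderivXU eqxx mulr1.
    by rewrite mderivXn mderivXU eq_sym (negbTE ij) mulr0 scaler0.
  rewrite -scalerAl -!mul_mpolyC !rmorphM /= !mmapC -?mul_polyC. rewrite [RHS]mulrA; congr (_ * _).
  change ((d.*2%:R : C)%:P = (d%:R)%:P * (2%:R)%:P); by rewrite -polyCM -natrM muln2.
have sq (z : 'I_n.+1 -> C) : \sum_i z i ^+ 2 = 1 -> meval z (@msqnorm C n.+1) = 1.
  by move=> <-; rewrite /msqnorm rmorph_sum /=; apply: eq_bigr => i _; rewrite rmorphXn /= mevalXU.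
have e0 p : (along x v p).[0] = meval x p.
  by rewrite along_horner; apply: meval_eq => i; rewrite mul0r addr0.
have e1 p : (along x v p).[1] = meval y p.
  by rewrite along_horner; apply: meval_eq => i; rewrite mul1r addrC subrK.
have := polyODE _ AB; rewrite e0 sq// => /(_ erefl) /(congr1 (fun r : {poly C} => r.[1])).
by rewrite hornerZ horner_exp !e1 sq// expr1n mulr1 e0.
Qed.

Definition reproducing N (f : 'I_N -> P) : P := \sum_(a < N) f a * pbar (f a).

(** A rotation acts on the span of the basis by a skew-Hermitian matrix, so the contributions of
    [f a] and of its conjugate cancel. *)
Lemma rot_reproducing k N (f : 'I_N -> P) i j : onb k f -> rot i j (reproducing f) = 0.
Proof.
move=> [[hf of_] bf].
pose A a b := herm (rot i j (f a)) (f b).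
have Lf a : rot i j (f a) = \sum_b A a b *: f b by apply: bf; exact: harmonic_rot.
have skew a b : A a b = - conj (A b a).
  by rewrite /A (herm_rot n_gt0 E_XU i j (hf a) (hf b)) -(herm_conj E_pbar).
rewrite /reproducing linear_sum.
rewrite (eq_bigr (fun a => \sum_b A a b *: (f b * pbar (f a)) + \sum_b conj (A a b) *: (f a * pbar (f b)))); last first.
  move=> a _; rewrite [LHS]rotM rot_pbar Lf mulr_suml pbar_sum mulr_sumr.
  congr (_ + _); apply: eq_bigr => b _; first by rewrite scalerAl.
  by rewrite pbarZ scalerAr.
rewrite big_split /= exchange_big /= -big_split big1// => a _ /=.
rewrite -big_split big1// => b _ /=.
by rewrite -scalerDl skew addNr scale0r.
Qed.

(** The kernel is constant on the real sphere and has mean [N]; the hypothesis on [E] says that the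
    mean depends only on values there. *)
Lemma reproducing_sphere k N (f : 'I_N -> P) (x : 'I_n.+1 -> C) : onb k f ->
  (forall q, (forall y : 'I_n.+1 -> C, (forall i, conj (y i) = y i) -> \sum_i y i ^+ 2 = 1 -> meval y q = 0) ->
     E q = 0) ->
  (forall i, conj (x i) = x i) -> \sum_i x i ^+ 2 = 1 ->
  \sum_(a < N) `|meval x (f a)| ^+ 2 = N%:R.
Proof.
move=> bf E0 rx x1; have [[hf of_] _] := bf.
rewrite (eq_bigr (fun a => meval x (f a * pbar (f a)))); last first.
  by move=> a _; rewrite mevalM meval_pbar// normCK.
rewrite -rmorph_sum -/(reproducing f).
have hK : reproducing f \is homog k.*2.
  rewrite rpred_sum// => a _; rewrite -addnn; have [h _] := hf a.
  by apply: dhomogM => //; exact: pbar_homog.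
have cK := rot_invariant_const hK (fun i j => rot_reproducing i j bf).
have : E (reproducing f) = N%:R.
  rewrite /reproducing linear_sum (eq_bigr (fun=> 1)); first by rewrite sumr_const card_ord.
  by move=> a _; have := of_ a a; rewrite eqxx.
move=> <-; apply/eqP; rewrite eq_sym -subr_eq0.
have -> : E (reproducing f) - meval x (reproducing f) =
    E (reproducing f - meval x (reproducing f) *: 1).
  by rewrite linearB linearZ /= E1 mulr1.
apply/eqP/E0 => y ry y1.
by rewrite mevalB mevalZ meval1 mulr1 (cK y x)// subrr.
Qed.
End orthonormal_polynomials.

(** * An upper bound for the dimension *)

Section dimension_bound.
Variables (C : numClosedFieldType) (n : nat).
Local Notation P := (mpoly n.+2 C).
Local Notation D := (@mderiv n.+2 C).
Local Notation harmonic := (@harmonic C n.+1).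
Implicit Types (p q : P) (i j : 'I_n.+2).

(** The exponents of degree [k] in which x_0 occurs at most once: the boolean is the exponent of
    x_0, the function gives the middle ones, and the last one is determined. Truncated subtraction
    makes it total. *)
Definition low_multinom k (t : bool * {ffun 'I_n -> 'I_k.+1}) : multinom n.+2 :=
  Multinom [tuple
    match unlift ord0 i with
    | None => nat_of_bool t.1
    | Some j => match unlift ord_max j with
                | None => (k - (nat_of_bool t.1 + \sum_l nat_of_ord (t.2 l)))%N
                | Some l => nat_of_ord (t.2 l)
                end
    end | i < n.+2].

Lemma low_multinomP k (m : multinom n.+2) : mdeg m = k -> (m ord0 <= 1)%N ->
  exists t, low_multinom (k := k) t = m.
Proof.
move=> mk m0.
have mS : (m ord0 + (\sum_(l < n) m (lift ord0 (lift ord_max l)) + m (lift ord0 ord_max)) = k)%N.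
  rewrite -mk mdegE big_ord_recl; congr addn; rewrite big_ord_recr /=; congr addn.
  apply: eq_bigr => l _; congr (fun_of_multinom _ (lift _ _)); apply: val_inj.
  by rewrite /= /bump leqNgt ltn_ord.
have ml l : (m (lift ord0 (lift ord_max l)) < k.+1)%N.
  by move: mS; rewrite (bigD1 l)//=; lia.
exists (m ord0 == 1%N, [ffun l => Ordinal (ml l)]).
apply/mnmP => i; rewrite mnmE; case: unliftP => [j ->|->] /=; last by case: (m ord0) m0 => [|[]].
case: unliftP => [l ->|->]; first by rewrite ffunE.
rewrite (eq_bigr (fun l => m (lift ord0 (lift ord_max l)))); last by move=> l _; rewrite ffunE.
have -> : (m ord0 == 1%N) = m ord0 :> nat by case: (m ord0) m0 => [|[]].
by move: mS; set s := (\sum_(l < n) _)%N; lia.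
Qed.

(** The equation [laplacian p = 0] expresses the coefficients with x_0-exponent at least 2 by
    coefficients whose x_0-exponent is smaller by 2. *)
Lemma harmonic_low_eq0 k p : harmonic k p ->
  (forall t, mcoeff (low_multinom (k := k) t) p = 0) -> p = 0.
Proof.
move=> [hp lp] p0; apply/mpolyP => m; rewrite mcoeff0.
have [r] := ubnP (m ord0); elim: r m => // r IH m mr.
have [mk|mk] := eqVneq (mdeg m) k; last exact: (dhomog_nemf_coeff hp).
have [m0|m2] := leqP (m ord0) 1; first by have [t <-] := low_multinomP mk m0.
(* In the coefficient of the Laplacian at m - 2 e_0, the derivative in x_0 contributes the
   coefficient of [p] at [m], and all other terms vanish by induction. *)
pose m' := Multinom [tuple (m i - (i == ord0).*2)%N | i < n.+2].
have m'E i : m' i = (m i - (i == ord0).*2)%N by rewrite mnmE.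
have := congr1 (mcoeff m') lp; rewrite mcoeff0 /laplacian linear_sum /=.
under eq_bigr do rewrite mcoeff_deriv mcoeff_deriv.
rewrite big_ord_recl big1 ?addr0 => [|i _].
  rewrite (_ : mnm_add (mnm_add m' (mnm1 ord0)) (mnm1 ord0) = m); last first.
    apply/mnmP => i; rewrite !mnmDE m'E !mnm1E eq_sym.
    by case: (eqVneq i ord0) => [->|_] /=; lia.
  by move/eqP; rewrite !mulrn_eq0 /= => /eqP.
rewrite IH ?mul0rn// !mnmDE m'E !mnm1E /=; lia.
Qed.
End dimension_bound.

Section onb_exists.
Variables (C : numClosedFieldType) (n : nat).
Local Notation P := (mpoly n.+2 C).
Local Notation "\X i" := (@mpolyX n.+2 C (mnm1 i)) (at level 8, i at level 2, format "\X i").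
Local Notation D := (@mderiv n.+2 C).
Local Notation harmonic := (@harmonic C n.+1).
Implicit Types (p q : P) (i j : 'I_n.+2).
Variable E : {scalar P}.
Hypothesis E_XU : forall j p, E (\X j * (n.+1%:R *: p + euler p)) = E (D j p).
Hypothesis E1 : E 1 = 1.
Hypothesis E_pbar : forall p, E (pbar p) = Num.conj (E p).
Hypothesis E_ge0 : forall p, 0 <= E (p * pbar p).
Local Notation herm := (herm E).

Lemma onf_leq k N (f : 'I_N -> P) : onf E k f -> (N <= 2 * k.+1 ^ n)%N.
Proof.
move=> of_; have [hf _] := of_.
pose T : finType := (bool * {ffun 'I_n -> 'I_k.+1})%type.
pose A : 'M[C]_(N, #|T|) := \matrix_(a, t) mcoeff (low_multinom (enum_val t)) (f a).
have rA : row_free A.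
  apply: inj_row_free => v vA.
  pose p := \sum_(a < N) v 0 a *: f a.
  have p0 : p = 0.
    apply: (@harmonic_low_eq0 _ _ k); first by apply: harmonic_sum => a; exact: harmonicZ.
    move=> t; have := congr1 (fun B : 'rV_#|T| => B 0 (enum_rank t)) vA; rewrite !mxE => <-.
    by rewrite linear_sum; apply: eq_bigr => a _; rewrite !mxE enum_rankK linearZ.
  apply/rowP => a; rewrite mxE -(herm_onf (v 0) a of_) -/p p0.
  by rewrite /herm mul0r linear0.
have := rank_leq_col A; rewrite (eqP rA); congr (_ <= _)%N.
by rewrite card_prod card_bool card_ffun !card_ord.
Qed.

(** An orthonormal family of maximal size: a nonzero remainder [p - q] could be normalized and added
    to it. *)
Lemma onb_exists k : exists N, exists f : 'I_N -> P, onb E k f.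
Proof.
pose Q N := `[< exists f : 'I_N -> P, onf E k f >].
have Q0 : exists N, Q N.
  exists 0%N; apply/asboolP; exists (fun=> 0); split=> [[]|[]]//.
have Qb N : Q N -> (N <= 2 * k.+1 ^ n)%N by move=> /asboolP[f]; exact: onf_leq.
case: (ex_maxnP Q0 Qb) => N /asboolP[f of_] maxN; exists N, f; split=> // p hp.
have [hf ff] := of_.
pose q := \sum_(a < N) herm p (f a) *: f a.
have hr : harmonic k (p - q).
  rewrite -scaleN1r; apply: harmonicD => //; apply: harmonicZ; apply: harmonic_sum => a.
  exact: harmonicZ.
apply/eqP; rewrite -subr_eq0 -/q; apply: contraT => r0.
have orth b : herm (p - q) (f b) = 0.
  by rewrite -scaleN1r hermDl hermZl (herm_onf _ _ of_) mulN1r subrr.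
have s0 : 0 < herm (p - q) (p - q).
  rewrite lt_def herm_ge0// andbT; apply: contraNneq r0 => /(herm_eq0 (ltn0Sn n) E_XU E1 E_ge0 hr) ->.
  by rewrite eqxx.
pose c := (sqrtC (herm (p - q) (p - q)))^-1.
have c2 : c * Num.conj c * herm (p - q) (p - q) = 1.
  have c0 : 0 <= c by rewrite /c invr_ge0 sqrtC_ge0; exact: (ltW s0).
  rewrite -normCK (ger0_norm c0).
  by rewrite /c exprVn sqrtCK mulVf// lt0r_neq0.
pose g (a : 'I_N.+1) := match unlift ord_max a with None => c *: (p - q) | Some b => f b end.
have : Q N.+1.
  apply/asboolP; exists g; split.
    by move=> a; rewrite /g; case: unliftP => [b _|_] //; exact: harmonicZ.
  move=> a b; rewrite /g; case: unliftP => [a' ->|->]; case: unliftP => [b' ->|->].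
  - by rewrite ff (inj_eq lift_inj).
  - by rewrite hermZr (herm_conj E_pbar) orth rmorph0 mulr0 eq_sym (negbTE (neq_lift _ _)).
  - by rewrite hermZl orth mulr0 (negbTE (neq_lift _ _)).
  - by rewrite hermZl hermZr mulrA c2 eqxx.
by move/maxN; rewrite ltnn.
Qed.
End onb_exists.

(** * Randomized bases *)

Local Open Scope sesquilinear_scope.
Section power_mean.
Variable R : realFieldType.

Lemma tangent_pow6 (s t : R) : 0 <= s -> 0 <= t -> 6 * s ^+ 5 * t - 5 * s ^+ 6 <= t ^+ 6.
Proof.
move=> s0 t0; rewrite -subr_ge0 [leRHS](_ : _ = (t - s) ^+ 2 *
  (t ^+ 4 + 2 * (t ^+ 3 * s) + 3 * (t ^+ 2 * s ^+ 2) + 4 * (t * s ^+ 3) + 5 * s ^+ 4)); last by ring.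
by rewrite mulr_ge0 ?sqr_ge0// !addr_ge0// ?mulr_ge0 ?exprn_ge0// ?exprn_ge0.
Qed.

(** Jensen's inequality for t^6, from the tangent at the weighted mean. *)
Lemma power_mean6 (I : finType) (w t : I -> R) :
  (forall i, 0 <= w i) -> (forall i, 0 <= t i) ->
  (\sum_i w i * t i) ^+ 6 <= (\sum_i w i) ^+ 5 * \sum_i w i * t i ^+ 6.
Proof.
move=> w0 t0; have W0 : 0 <= \sum_i w i by exact: sumr_ge0.
have [W|W] := eqVneq (\sum_i w i) 0.
  have wi i : w i = 0.
    by apply/eqP; move/eqP : W; rewrite psumr_eq0// => /allP/(_ i); rewrite mem_index_enum => /(_ isT).
  by rewrite big1 => [|i _]; rewrite ?wi ?mul0r// W !expr0n /= mul0r.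
set A := \sum_i w i * t i; pose s := A / \sum_i w i.
have A0 : 0 <= A by apply: sumr_ge0 => i _; rewrite mulr_ge0.
have s0 : 0 <= s by rewrite divr_ge0.
have : \sum_i w i * (6 * s ^+ 5 * t i - 5 * s ^+ 6) <= \sum_i w i * t i ^+ 6.
  by apply: ler_sum => i _; rewrite ler_wpM2l// tangent_pow6.
move/(ler_wpM2l (exprn_ge0 5 W0)); apply: le_trans.
rewrite le_eqVlt; apply/orP; left; apply/eqP.
rewrite [X in _ * X](eq_bigr (fun i => 6 * s ^+ 5 * (w i * t i) - 5 * s ^+ 6 * w i)); last by move=> i _; ring.
rewrite sumrB -!mulr_sumr -/A /s; move: (\sum_i w i) W => x x0; field.
by [].
Qed.
End power_mean.

Section sixth_power.
Context {R : realType} {n N : nat}.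
Local Notation C := R[i].
Local Notation S := (sphere R n).
Local Notation mu := (@sphere_measure R n).
Local Notation nrm := (@Normc.normc R).
Variable u : 'I_N -> S -> C.
Hypothesis tu : forall j, tame (u j).

Definition comb (r : 'rV[C]_N) (x : S) : C := \sum_(j < N) r 0 j * u j x.
Definition int6 (r : 'rV[C]_N) : R := (\int[mu]_x (nrm (comb r x) ^+ 6))%R.

Lemma tame_comb r : tame (comb r).
Proof. by apply: tame_sum => j; apply: tameM => //; exact: tame_cst. Qed.

Lemma tame_normc2 (f : S -> C) : tame f ->
  measurable_fun setT (fun x => nrm (f x) ^+ 2) /\ exists M, forall x, nrm (f x) ^+ 2 <= M.
Proof.
move=> [rf imf [M hM]]; split.
  under eq_fun do rewrite normc_sqrE.
  by apply: measurable_funD; exact: measurable_funX.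
exists (M ^+ 2 + M ^+ 2) => x; have [h1 h2] := hM x.
rewrite normc_sqrE -[complex.Re _ ^+ 2]real_normK ?num_real// -[complex.Im _ ^+ 2]real_normK ?num_real//.
by rewrite lerD// lerXn2r// nnegrE (le_trans _ h1).
Qed.

Lemma integrable_normc_pow (f : S -> C) k : tame f ->
  mu.-integrable setT (EFin \o (fun x => nrm (f x) ^+ k.*2)).
Proof.
move=> /tame_normc2[mf [M hM]]; apply: (@bounded_sphere_integrable _ _ _ (M ^+ k)).
  by under eq_fun do rewrite -mul2n exprM; exact: measurable_funX.
move=> x; rewrite -mul2n exprM ger0_norm ?exprn_ge0 ?normc_ge0//.
by rewrite lerXn2r ?nnegrE ?sqr_ge0 ?(le_trans (sqr_ge0 _) (hM x)).
Qed.

Lemma Rintegral_sphere_cst (c : R) : (\int[mu]_x c = c)%R.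
Proof. by rewrite Rintegral_cst// [X in fine X](_ : _ = 1%E) ?mulr1//; exact: probability_setT. Qed.

Lemma Rintegral_sum (I : finType) (g : I -> S -> R) :
  (forall i, mu.-integrable setT (EFin \o g i)) ->
  (\int[mu]_x \sum_i g i x = \sum_i \int[mu]_x g i x)%R.
Proof.
move=> ig; elim: (index_enum I) => [|i s IH].
  under eq_Rintegral do rewrite big_nil; by rewrite Rintegral_cst// mul0r big_nil.
under eq_Rintegral do rewrite big_cons.
rewrite RintegralD// ?IH ?big_cons//.
rewrite (_ : _ \o _ = (fun x => \sum_(j <- s) (EFin \o g j) x)%E).
  by apply: integrable_sum.
by apply/funext => x /=; rewrite sumEFin.
Qed.

(** The triangle inequality in L^6, obtained pointwise from the power mean inequality with weights
    |c_i|. This is why l1 norms of coefficients are recorded throughout. *)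
Lemma int6_comb (I : finType) (c : I -> C) (r : I -> 'rV[C]_N) (A B : R) :
  \sum_i nrm (c i) <= A -> (forall i, int6 (r i) <= B) -> 0 <= B ->
  int6 (\sum_i c i *: r i) <= A ^+ 6 * B.
Proof.
move=> cA rB B0.
have A'0 : 0 <= \sum_i nrm (c i) by apply: sumr_ge0 => i _; exact: normc_ge0.
pose g i x := (\sum_j nrm (c j)) ^+ 5 * nrm (c i) * nrm (comb (r i) x) ^+ 6.
have ig i : mu.-integrable setT (EFin \o g i).
  exact: (@integrableZl _ _ _ mu setT measurableT _ _ (integrable_normc_pow 3 (tame_comb (r i)))).
have ge0_g i x : 0 <= g i x by rewrite /g !mulr_ge0 ?exprn_ge0 ?normc_ge0.
apply: (@le_trans _ _ (\int[mu]_x \sum_i g i x)%R).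
  apply: le_Rintegral => //.
  - exact: (integrable_normc_pow 3 (tame_comb _)).
  - rewrite (_ : _ \o _ = (fun x => \sum_i (EFin \o g i) x)%E); first exact: integrable_sum.
    by apply/funext => x /=; rewrite sumEFin.
  - move=> x _; have -> : comb (\sum_i c i *: r i) x = \sum_i c i * comb (r i) x.
      rewrite /comb; under [RHS]eq_bigr do rewrite mulr_sumr.
      rewrite exchange_big /=; apply: eq_bigr => j _; rewrite summxE mulr_suml.
      by apply: eq_bigr => i _; rewrite mxE mulrA.
    apply: (@le_trans _ _ ((\sum_i nrm (c i) * nrm (comb (r i) x)) ^+ 6)).
      rewrite lerXn2r ?nnegrE ?normc_ge0//.
        by apply: sumr_ge0 => i _; rewrite mulr_ge0 ?normc_ge0.
      rewrite (le_trans (normc_sum _ _ _))//.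
      by apply: ler_sum => i _; rewrite Normc.normcM.
    apply: le_trans (power_mean6 _ _) _ => [i|i|]; try exact: normc_ge0.
    by rewrite mulr_sumr; apply: ler_sum => i _; rewrite /g mulrA.
rewrite Rintegral_sum//; apply: (@le_trans _ _ (\sum_i (\sum_j nrm (c j)) ^+ 5 * nrm (c i) * B)).
  apply: ler_sum => i _; rewrite RintegralZl//; last exact: (integrable_normc_pow 3 (tame_comb (r i))).
  by rewrite ler_wpM2l ?mulr_ge0 ?exprn_ge0 ?normc_ge0//; exact: rB.
rewrite -mulr_suml -mulr_sumr -exprSr ler_wpM2r// lerXn2r// nnegrE//.
exact: le_trans cA.
Qed.

Lemma sign_sum_Rintegral (I : eqType) (V : zmodType) (r : seq I) (a : I -> V) (g : V -> S -> R) v :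
  (forall v, mu.-integrable setT (EFin \o g v)) ->
  sign_sum r a (fun v => \int[mu]_x g v x)%R v = (\int[mu]_x sign_sum r a (g^~ x) v)%R /\
  mu.-integrable setT (EFin \o (fun x => sign_sum r a (g^~ x) v)).
Proof.
move=> ig; elim: r v => [|i r IH] v //=.
have [e1 i1] := IH (v + a i); have [e2 i2] := IH (v - a i).
rewrite e1 e2 RintegralD//; split => //.
rewrite (_ : _ \o _ = ((EFin \o (fun x => sign_sum r a (g^~ x) (v + a i)%R)) \+ (EFin \o (fun x => sign_sum r a (g^~ x) (v - a i)%R)))%E).
  exact: integrableD.
by apply/funext.
Qed.

(** At each point x the average over the signs of the sixth power of one row is at most 60 (K/D)^3.
    Some choice of signs does no worse than the average for the sum over all [D] rows, and a single
    row is bounded by that sum. When [K] and [D] are comparable the result is O(K). *)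
Lemma random_signs D (U : 'M[C]_D) (e : 'M[C]_(D, N)) (K : R) :
  (forall i j, nrm (U i j) ^+ 2 = D%:R^-1) ->
  (forall x, \sum_j nrm (comb (row j e) x) ^+ 2 <= K) ->
  exists eps : 'I_D -> bool, forall i,
    int6 (row i (U *m diag_mx (\row_j (-1) ^+ eps j) *m e)) <= D%:R * (60 * (K / D%:R) ^+ 3).
Proof.
move=> Uflat eK.
pose a j : 'M[C]_(D, N) := col j U *m row j e.
pose G (v : 'M[C]_(D, N)) : R := \sum_i int6 (row i v).
pose B : R := 60 * (K / D%:R) ^+ 3.
have bound i : sign_sum (enum 'I_D) a (fun v => int6 (row i v)) 0 <= 2 ^+ D * B.
  have [-> _] := @sign_sum_Rintegral _ _ (enum 'I_D) a (fun v x => nrm (comb (row i v) x) ^+ 6) 0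
    (fun v => integrable_normc_pow 3 (tame_comb (row i v))).
  have [_ ii] := @sign_sum_Rintegral _ _ (enum 'I_D) a (fun v x => nrm (comb (row i v) x) ^+ 6) 0
    (fun v => integrable_normc_pow 3 (tame_comb (row i v))).
  apply: (@le_trans _ _ (\int[mu]_x (2 ^+ D * B))%R); last first.
    by rewrite Rintegral_sphere_cst.
  apply: le_Rintegral => //; first exact: finite_measure_integrable_cst.
  move=> x _.
  pose l (v : 'M[C]_(D, N)) : C := comb (row i v) x.
  have ladd : nmod_morphism l.
    split=> [|v w]; rewrite /l /comb.
      by rewrite big1// => j _; rewrite !mxE mul0r.
    by rewrite -big_split; apply: eq_bigr => j _; rewrite !mxE mulrDl.
  pose la : {additive 'M[C]_(D, N) -> C} := HB.pack l (GRing.isNmodMorphism.Build _ _ l ladd).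
  have -> : sign_sum (enum 'I_D) a (fun v => nrm (comb (row i v) x) ^+ 6) 0 =
      sign_sum (enum 'I_D) a ((fun z => nrm z ^+ 6) \o la) 0 by [].
  rewrite sign_sum_comp raddf0; apply: le_trans (sign_sum_normc6 _ _) _.
  rewrite size_enum_ord ler_wpM2l ?exprn_ge0// /B ler_wpM2l// lerXn2r ?nnegrE//.
  - by apply: sumr_ge0 => j _; exact: sqr_ge0.
  - rewrite divr_ge0//; apply: le_trans (eK x); apply: sumr_ge0 => j _; exact: sqr_ge0.
  rewrite big_enum /=.
  rewrite (eq_bigr (fun j => D%:R^-1 * nrm (comb (row j e) x) ^+ 2)); last first.
    move=> j _; rewrite -(Uflat i j) -exprMn -Normc.normcM; congr (nrm _ ^+ 2).
    rewrite /= /l /comb mulr_sumr; apply: eq_bigr => m _.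
    by rewrite !mxE big_ord1 !mxE mulrA.
  by rewrite -mulr_sumr mulrC ler_wpM2r ?invr_ge0.
have Gb : sign_sum (enum 'I_D) a G 0 <= 2 ^+ size (enum 'I_D) * (D%:R * B).
  rewrite /G sign_sum_sum size_enum_ord; apply: le_trans (ler_sum _ (fun i _ => bound i)) _.
  by rewrite sumr_const card_ord -[_ *+ D]mulr_natl mulrCA.
have [eps Heps] := sign_sum_exists (enum_uniq _) Gb; exists eps => i.
apply: le_trans Heps; rewrite /G (bigD1 i)//=.
set v := 0 + _; have -> : v = U *m diag_mx (\row_j (-1) ^+ eps j) *m e.
  rewrite /v add0r big_enum /=; apply/matrixP => k l; rewrite !mxE summxE.
  apply: eq_bigr => j _; rewrite mul_mx_diag !mxE.
  by case: (eps j); rewrite !mxE big_ord1 !mxE ?expr1 ?mulrN1 ?mulNr// expr0 mulr1.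
rewrite lerDl; apply: sumr_ge0 => j _; apply: Rintegral_ge0 => x _.
by rewrite exprn_ge0 ?normc_ge0.
Qed.
End sixth_power.
Local Close Scope sesquilinear_scope.

Local Open Scope sesquilinear_scope.

(** * Orthonormal bases that mix beams and flat vectors *)

Section mixed_basis.
Context {R : realType} {n : nat}.
Local Notation C := R[i].
Local Notation S := (sphere R n).
Local Notation nrm := (@Normc.normc R).

Lemma orthonormal_completion M N (W : 'M[C]_(M, N)) : W \is unitarymx ->
  exists D (e : 'M[C]_(D, N)), [/\ (M + D = N)%N, e \is unitarymx & e *m W ^t* = 0].
Proof.
move=> uW.
pose P := orthomx (@Num.conj C) (mx_of_hermitian (hermitian1mx _)) W.
exists (\rank P), (schmidt (row_base P)); split.
- by rewrite rank_ortho mxrank_unitary// subnKC// -(mxrank_unitary uW) rank_leq_col.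
- by apply: schmidt_unitarymx; exact: rank_leq_col.
- apply/orthomx1P; rewrite eqmx_schmidt_free ?row_base_free//.
  by rewrite eq_row_base.
Qed.

(** Applied at each point of the sphere, it gives the flat part of the space the pointwise bound
    sum_j |e_j(x)|^2 <= N that [random_signs] asks for. *)
Lemma bessel k N (X : 'M[C]_(k, N)) (v : 'cV[C]_N) : X \is unitarymx ->
  \sum_i nrm ((X *m v) i 0) ^+ 2 <= \sum_i nrm (v i 0) ^+ 2.
Proof.
move=> uX.
have e m (w : 'cV[C]_m) : ((\sum_i nrm (w i 0) ^+ 2)%:C)%C = (w ^t* *m w) 0 0.
  by rewrite rmorph_sum mxE; apply: eq_bigr => i _; rewrite !mxE mulrC -normc_sqr.
rewrite -lecR !e -subr_ge0.
pose p := X ^t* *m (X *m v).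
have pv : p ^t* *m v = (X *m v) ^t* *m (X *m v) by rewrite /p trmx_mul map_mxM trmxCK -mulmxA.
have vp : v ^t* *m p = (X *m v) ^t* *m (X *m v) by rewrite /p mulmxA -[in X in X *m _](trmxCK X) -map_mxM -trmx_mul trmxCK.
have pp : p ^t* *m p = (X *m v) ^t* *m (X *m v).
  by rewrite {2}/p mulmxA /p trmx_mul map_mxM trmxCK -(mulmxA _ X) (unitarymxP uX) mulmx1.
have vpB : (v - p) ^t* = v ^t* - p ^t* by apply/matrixP => i j; rewrite !mxE rmorphB.
have := e _ (v - p); rewrite vpB mulmxBl !mulmxBr pv vp pp subrr subr0.
have mB (A1 A2 : 'M[C]_1) : (A1 - A2) 0 0 = A1 0 0 - A2 0 0 by rewrite !mxE.
rewrite mB => <-; rewrite ler0c.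
by apply: sumr_ge0 => i _; exact: sqr_ge0.
Qed.

Variables (N : nat) (u : 'I_N -> S -> C).
Hypothesis tu : forall j, tame (u j).
Hypothesis sum_u : forall x, \sum_j nrm (u j x) ^+ 2 = N%:R.

Lemma comb_mul x k (A : 'M[C]_(k, N)) i : comb u (row i A) x = (A *m \col_j u j x) i 0.
Proof. by rewrite mxE; apply: eq_bigr => j _; rewrite !mxE. Qed.

Lemma int6_mul k m (A : 'M[C]_(k, m)) (V : 'M[C]_(m, N)) i (c B : R) :
  \sum_j nrm (A i j) <= c -> (forall j, int6 u (row j V) <= B) -> 0 <= B ->
  int6 u (row i (A *m V)) <= c ^+ 6 * B.
Proof.
move=> Ac VB B0; rewrite row_mul mulmx_sum_row.
apply: int6_comb => //; apply: le_trans Ac; apply: ler_sum => j _.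
by rewrite mxE.
Qed.

(** The rows of [V] are the orthonormalized beams [W], then the flat vectors [E], and [H] reflects
    within fibers that contain exactly one row of [W]. As [E] is orthogonal to all of [Q], the inner
    product with the beam of the fiber is the product of an entry of [H], at least 1/L, and a
    diagonal overlap, at least 1/2. *)
Lemma mixed_basis M (Q : 'M[C]_(M, N)) (L : nat) (B : R) :
  (0 < M)%N -> (2 * M <= N.+1)%N -> (N <= L * M)%N -> N%:R <= B ->
  (forall i, (Q *m Q ^t*) i i = 1) ->
  (forall i, \sum_(j | j != i) nrm ((Q *m Q ^t*) i j) <= 1 / 4) ->
  (forall i, int6 u (row i Q) <= B) ->
  exists2 U : 'M[C]_N, U \is unitarymx & forall i,
    int6 u (row i U) <= 5 ^+ 6 * (60 * 27 * B) /\
    exists c, (2 * L%:R)^-1 <= nrm ((U *m Q ^t*) i c).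
Proof.
move=> M0 M2 NLM NB Q1 Qd QB.
have B0 : 0 <= B by apply: le_trans NB.
have [T [Tu Wu T2 TW]] := gram_schmidt_dominant Q1 Qd.
pose W := T *m Q.
have [D [e [MD eu eW]]] := orthonormal_completion Wu.
have [E [Eu EW EB]] : exists E : 'M[C]_(D, N), [/\ E \is unitarymx, E *m W ^t* = 0 &
    forall i, int6 u (row i E) <= 60 * 27 * B].
  have [D0|D0] := posnP D.
    by exists e; split=> // i; have := ltn_ord i; rewrite [X in (_ < X)%N]D0.
  have [U0 U0u U0f] := @flat_unitary R D D0.
  have eK x : \sum_j nrm (comb u (row j e) x) ^+ 2 <= N%:R.
    under eq_bigr do rewrite comb_mul.
    rewrite (le_trans (bessel _ eu))//.
    by under eq_bigr do rewrite mxE; rewrite sum_u.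
  have [eps Heps] := random_signs tu U0f eK.
  exists (U0 *m diag_mx (\row_j (-1) ^+ eps j) *m e); split.
  - apply: (mul_unitarymx _ eu); apply: (mul_unitarymx U0u).
    apply/unitarymxP/matrixP => i j; rewrite mul_diag_mx !mxE.
    have [<-|ij] := eqVneq i j; last by rewrite mulr0n conjC0 mulr0.
    by rewrite mulr1n; case: (eps i); rewrite ?expr0 ?expr1 ?conjC1 ?mulr1// rmorphN1 mulrNN mulr1.
  - by move: (U0 *m _) => X; rewrite -(mulmxA X) [X in _ *m X](eW : e *m W ^t* = 0) mulmx0.
  - move=> i; apply: le_trans (Heps i) _.
    apply: (@le_trans _ _ (60 * 27 * N%:R)); last by rewrite ler_wpM2l// mulr_ge0.
    (* From 2 M <= N + 1 and M + D = N follows N <= 2 D + 1; this is where the cap on the number of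
       beams enters. *)
    have N3 : N%:R <= 3 * D%:R :> R by rewrite -natrM ler_nat; lia.
    have D0' : 0 < D%:R :> R by rewrite ltr0n.
    have h : N%:R / D%:R <= 3 :> R by rewrite ler_pdivrMr.
    have h0 : 0 <= N%:R / D%:R :> R by rewrite divr_ge0.
    rewrite (_ : _ * _ = 60 * (N%:R / D%:R) ^+ 2 * N%:R :> R); last first.
      by rewrite !exprS expr0; field; rewrite gt_eqF.
    rewrite ler_wpM2r//.
    have : (N%:R / D%:R) ^+ 2 <= 3 ^+ 2 :> R by rewrite lerXn2r ?nnegrE.
    lra.
pose V : 'M[C]_(M + D, N) := col_mx W E.
have Vu : V \is unitarymx.
  apply/unitarymxP; rewrite /V tr_col_mx map_row_mx mul_col_row EW !(unitarymxP _)//.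
  by rewrite -[W]trmxCK -map_mxM -trmx_mul EW trmx0 map_mx0 -scalar_mx_block.
have VB i : int6 u (row i V) <= 60 * 27 * B.
  case: (split_ordP i) => j ->; rewrite /V ?rowKu ?rowKd//.
  apply: (@le_trans _ _ (2 ^+ 6 * B)); last first.
    by rewrite ler_wpM2r// !exprS expr0; lra.
  exact: int6_mul.
(* Fibers are the residue classes modulo [M]: each has one index below [M], its beam, and at most
   [L] indices in all, because N <= L M. *)
have kapP (i : 'I_(M + D)) : (i %% M < M)%N by rewrite ltn_pmod.
pose kap (i : 'I_(M + D)) : 'I_M := Ordinal (kapP i).
have sigK : cancel (lshift D) kap by move=> c; apply/val_inj; rewrite /= modn_small.
have fib c : #|[set i | kap i == c]%SET|%:R <= L%:R :> R.
  rewrite ler_nat.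
  have divL (i : 'I_(M + D)) : (i %/ M < L)%N by rewrite ltn_divLR// (leq_trans (ltn_ord i))// MD.
  rewrite -[X in (_ <= X)%N](card_ord L).
  apply: (leq_card_in (fun i => Ordinal (divL i))) => i j; rewrite !inE => /eqP ic /eqP jc /(congr1 val)/= ij.
  apply/val_inj => /=; rewrite (divn_eq i M) (divn_eq j M) ij; congr addn.
  by have := congr1 val ic; have := congr1 val jc; rewrite /= => -> ->.
have [H Hu [H0 H5 HL]] := mixing_unitary sigK fib.
have L0 : 0 < L%:R :> R.
  by rewrite ltr0n; case: (L) NLM => //; rewrite mul0n leqn0 -MD addn_eq0 => /andP[/eqP M00]; rewrite M00 in M0.
pose U := H *m V.
have Uu : U \is unitarymx by apply: mul_unitarymx.
exists (\matrix_(i, j) U (cast_ord (esym MD) i) j).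
  apply/unitarymxP/matrixP => i j; have := unitarymxP Uu => /matrixP/(_ (cast_ord (esym MD) i) (cast_ord (esym MD) j)).
  rewrite !mxE (inj_eq (@cast_ord_inj _ _ _)) => <-.
  by apply: eq_bigr => l _; rewrite !mxE.
move=> i; set i' := cast_ord (esym MD) i; split.
  rewrite (_ : row i _ = row i' U); last by apply/rowP => j; rewrite !mxE.
  by apply: int6_mul => //; rewrite mulr_ge0.
exists (kap i').
have -> : (\matrix_(i, j) U (cast_ord (esym MD) i) j *m Q ^t*) i (kap i') =
    H i' (lshift D (kap i')) * (W *m Q ^t*) (kap i') (kap i').
  transitivity ((H *m (V *m Q ^t*)) i' (kap i')).
    by rewrite mulmxA -/U !mxE; apply: eq_bigr => l _; rewrite !mxE.
  rewrite mxE (bigD1 (lshift D (kap i')))//= big1 ?addr0 => [|j jc].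
    by rewrite /V mul_col_mx col_mxEu.
  have [kj|kj] := eqVneq (kap i') (kap j); last by rewrite H0 ?mul0r.
  case: (split_ordP j) kj jc => l ->; first by rewrite sigK => ->; rewrite eqxx.
  move=> _ _; rewrite /V mul_col_mx col_mxEd.
  have -> : E *m Q ^t* = 0.
    have -> : Q = invmx T *m W by rewrite /W mulKmx.
    by rewrite trmx_mul map_mxM mulmxA EW mul0mx.
  by rewrite mxE mulr0.
rewrite Normc.normcM invfM mulrC ler_pM ?invr_ge0 ?(ltW L0)//.
by have := TW (kap i'); rewrite mul1r.
Qed.
End mixed_basis.
Local Close Scope sesquilinear_scope.

(** * Gaussian beams *)

Section beam_moments.
Variables (C : numClosedFieldType) (n : nat).
Hypothesis n_gt0 : (0 < n)%N.
Local Notation P := (mpoly n.+1 C).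
Local Notation "\X i" := (@mpolyX n.+1 C (mnm1 i)) (at level 8, i at level 2, format "\X i").
Local Notation D := (@mderiv n.+1 C).
Local Notation homog d := (@ishomog1 n.+1 C d mdeg).
Implicit Types (p q : P) (i j : 'I_n.+1).
Variable E : {scalar P}.
Hypothesis E_XU : forall j p, E (\X j * (n%:R *: p + euler p)) = E (D j p).
Hypothesis E1 : E 1 = 1.

Lemma pbar_linform (b : 'I_n.+1 -> C) k :
  pbar (linform b ^+ k) = linform (fun i => Num.conj (b i)) ^+ k.
Proof.
elim: k => [|k IH]; first by rewrite !expr0 -mpolyC1 pbarC rmorph1.
rewrite !exprS pbarM IH; congr (_ * _).
by rewrite /linform pbar_sum; apply: eq_bigr => i _; rewrite pbarZ pbarX.
Qed.

Lemma meval_linform (b : 'I_n.+1 -> C) k x :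
  meval x (linform b ^+ k) = (\sum_i b i * x i) ^+ k.
Proof.
rewrite rmorphXn /=; congr (_ ^+ _); rewrite /linform rmorph_sum /=; apply: eq_bigr => i _.
by rewrite mevalZ mevalXU.
Qed.

(** Integrate by parts one factor a.x. The derivative of (a.x)^k in direction a vanishes because a.a
    = 0, and that of (c.x)^(k+1) gives the factor (k+1) a.c. *)
Lemma mean_linform (a c : 'I_n.+1 -> C) k : \sum_i a i ^+ 2 = 0 ->
  E (linform a ^+ k * linform c ^+ k) = beam_const C n k * ((\sum_i a i * c i) / 2) ^+ k.
Proof.
move=> a0; elim: k => [|k IH].
  by rewrite !expr0 mulr1 E1 /beam_const big_ord0 mulr1.
pose q := linform a ^+ k * linform c ^+ k.+1.
have hq : q \is homog (k.*2.+1).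
  by rewrite (_ : k.*2.+1 = (k + k.+1)%N); [apply: dhomogM; exact: linform_homog|lia].
have nz : (n + k.*2.+1)%:R != 0 :> C by rewrite pnatr_eq0; lia.
have -> : linform a ^+ k.+1 * linform c ^+ k.+1 = \sum_i a i *: (\X i * q).
  rewrite exprS -mulrA -/q [X in X * q]/linform mulr_suml; apply: eq_bigr => i _.
  by rewrite scalerAl.
rewrite linear_sum; apply: (mulfI nz); rewrite mulr_sumr.
rewrite (eq_bigr (fun i => E (a i *: D i q))); last first.
  by move=> i _; rewrite !linearZ /= mulrCA (mean_XU_homog E_XU _ hq).
rewrite -linear_sum.
have -> : \sum_i a i *: D i q = (k.+1%:R * \sum_i a i * c i) *: (linform a ^+ k * linform c ^+ k).
  rewrite (eq_bigr (fun i => (a i ^+ 2) *: (k%:R *: (linform a ^+ k.-1 * linform c ^+ k.+1)) +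
     (a i * c i) *: (k.+1%:R *: (linform a ^+ k * linform c ^+ k)))).
    by rewrite big_split /= -!scaler_suml a0 scale0r add0r scalerA mulrC.
  move=> i _; rewrite /q mderivM mderiv_linformX.
  case: k {IH q hq nz} => [|k]; first by rewrite expr0 -mpolyC1 mderivC mul0r add0r mulr0n
    scale0r scaler0 add0r mpolyC1 !mul1r scale1r !scalerA.
  by rewrite mderiv_linformX -!mul_mpolyC !mpolyCM; ring.
rewrite linearZ /= IH [beam_const C n k.+1]big_ord_recr /= -/(beam_const C n k) [in RHS]exprS.
rewrite -[k.+1.*2]muln2 natrM.
move: (\sum_i a i * c i) => z.
set y := (z / 2) ^+ k; move: (y) (beam_const C n k) => {}y x.
by move: nz; move: ((n + k.*2.+1)%:R : C) => N nz; field.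
Qed.
End beam_moments.

Section beams.
Variables (C : numClosedFieldType) (n : nat).
Hypothesis n_gt0 : (0 < n)%N.
Local Notation P := (mpoly n.+1 C).
Local Notation "\X i" := (@mpolyX n.+1 C (mnm1 i)) (at level 8, i at level 2, format "\X i").
Local Notation D := (@mderiv n.+1 C).
Local Notation conj := (@Num.conj C).
Variable E : {scalar P}.
Hypothesis E_XU : forall j p, E (\X j * (n%:R *: p + euler p)) = E (D j p).
Hypothesis E1 : E 1 = 1.
Hypothesis E_pbar : forall p, E (pbar p) = conj (E p).
Local Notation herm := (herm E).
Implicit Types (p q : P) (b c x : 'I_n.+1 -> C).

Lemma harmonic_beam s b k : \sum_i b i ^+ 2 = 0 -> harmonic k (s *: linform b ^+ k).
Proof. by move=> b0; apply: harmonicZ; split; [exact: linform_homog|exact: laplacian_linform]. Qed.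

Lemma herm_beam s b c k : \sum_i b i ^+ 2 = 0 ->
  herm (s *: linform b ^+ k) (s *: linform c ^+ k) =
  s * conj s * beam_const C n k * ((\sum_i b i * conj (c i)) / 2) ^+ k.
Proof.
move=> b0; rewrite hermZl hermZr /herm pbar_linform (mean_linform n_gt0 E_XU E1 _ _ b0).
by rewrite !mulrA.
Qed.

Lemma mean_beam_norm b m : \sum_i b i ^+ 2 = 0 -> \sum_i `|b i| ^+ 2 = 2 ->
  E (linform b ^+ m * pbar (linform b ^+ m)) = beam_const C n m.
Proof.
move=> b0 b2; rewrite pbar_linform (mean_linform n_gt0 E_XU E1 _ _ b0).
rewrite (eq_bigr (fun i => `|b i| ^+ 2)) => [|i _]; last by rewrite normCK.
by rewrite b2 divff// expr1n mulr1.
Qed.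

(* The real vector x - (conj beta * b + beta * conj b) / 2, where beta = b.x,
   has squared length 1 - |beta|^2. *)
Lemma null_linform_le1 b x : \sum_i b i ^+ 2 = 0 -> \sum_i `|b i| ^+ 2 = 2 ->
  (forall i, conj (x i) = x i) -> \sum_i x i ^+ 2 = 1 -> `|\sum_i b i * x i| ^+ 2 <= 1.
Proof.
move=> b0 b2 rx x1; set beta := \sum_i _.
have betaC : conj beta = \sum_i conj (b i) * x i.
  by rewrite rmorph_sum; apply: eq_bigr => i _; rewrite rmorphM /= rx.
pose y i := x i - (conj beta * b i + beta * conj (b i)) / 2.
have yr i : conj (y i) = y i.
  rewrite /y rmorphB rmorphM rmorphD !rmorphM /= !conjCK rx fmorphV rmorph_nat.
  by rewrite [beta * _ + _]addrC.
have b0C : \sum_i conj (b i) ^+ 2 = 0.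
  rewrite (eq_bigr (fun i => conj (b i ^+ 2))) => [|i _]; last by rewrite rmorphXn.
  by rewrite -rmorph_sum b0 rmorph0.
have : 0 <= \sum_i y i ^+ 2.
  by apply: sumr_ge0 => i _; rewrite expr2 -{2}yr mul_conjC_ge0.
suff -> : \sum_i y i ^+ 2 = 1 - `|beta| ^+ 2 by rewrite subr_ge0.
rewrite (eq_bigr (fun i => x i ^+ 2 - conj beta * (b i * x i) - beta * (conj (b i) * x i) +
  conj beta ^+ 2 / 4 * b i ^+ 2 + beta ^+ 2 / 4 * conj (b i) ^+ 2 +
  beta * conj beta / 2 * `|b i| ^+ 2)); last first.
  by move=> i _; rewrite /y normCK; move: (conj (b i)) (conj beta) => b' beta'; field.
rewrite !big_split /= !sumrN -!mulr_sumr b0 b0C b2 x1 -/beta -betaC normCK !mulr0 !addr0.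
by move: (conj beta) => beta'; field.
Qed.

Lemma parseval k N (f : 'I_N -> P) p q : onb E k f -> harmonic k p -> harmonic k q ->
  herm p q = \sum_j herm p (f j) * conj (herm q (f j)).
Proof.
move=> [_ bf] hp hq; rewrite [in LHS](bf q hq) herm_sumr; apply: eq_bigr => j _.
by rewrite hermZr mulrC.
Qed.

Lemma meval_onb k N (f : 'I_N -> P) p x : onb E k f -> harmonic k p ->
  meval x p = \sum_j herm p (f j) * meval x (f j).
Proof.
move=> [_ bf] hp; rewrite [in LHS](bf p hp) raddf_sum; apply: eq_bigr => j _.
by rewrite /= mevalZ.
Qed.

Local Open Scope sesquilinear_scope.
Lemma onb_unitary k N (f : 'I_N -> P) (U : 'M[C]_N) : U \is unitarymx -> onb E k f ->
  onb E k (fun i => \sum_j U i j *: f j).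
Proof.
move=> Uu bf; have [of_ fE] := bf; have [hf _] := of_.
have gE p i : herm p (\sum_j U i j *: f j) = ((\row_j herm p (f j)) *m U ^t*) 0 i.
  by rewrite herm_sumr mxE; apply: eq_bigr => j _; rewrite hermZr !mxE mulrC.
split; first split=> [i|i j].
- by apply: harmonic_sum => j; exact/harmonicZ/hf.
- rewrite gE (_ : \row_l _ = row i U); first by rewrite -row_mul (unitarymxP Uu) !mxE.
  by apply/rowP => l; rewrite !mxE (herm_onf _ _ of_).
move=> p hp; rewrite [LHS](fE p hp).
under [RHS]eq_bigr => i _ do rewrite gE scaler_sumr.
rewrite exchange_big; apply: eq_bigr => j _ /=.
under eq_bigr => i _ do rewrite scalerA.
rewrite -scaler_suml; congr (_ *: _).
transitivity (((\row_j herm p (f j)) *m U ^t* *m U) 0 j); last by rewrite mxE.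
by rewrite -mulmxA (mulmx1C (unitarymxP Uu)) mulmx1 mxE.
Qed.
End beams.

Local Open Scope complex_scope.
Section sphere_mean_properties.
Context {R : realType} {nu : nat}.
Local Notation C := R[i].
Local Notation S := (sphere R nu.+1).
Local Notation P := (mpoly nu.+2 C).
Local Notation mu := (@sphere_measure R nu.+1).
Local Notation nrm := (@Normc.normc R).
Local Notation E := (@sphere_mean R nu.+1).
Implicit Types (p q : P) (x : S) (b : 'I_nu.+2 -> C).

Lemma conj_sphere_coord x i : Num.conj (tnth x i)%:C = (tnth x i)%:C.
Proof. exact: conjc_real. Qed.

Lemma sqr_sphere_coord x : \sum_i (tnth x i)%:C ^+ 2 = 1 :> C.
Proof.
rewrite -[RHS](rmorph1 (real_complex R)) -(sqnorm_sphere x) rmorph_sum.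
by apply: eq_bigr => i _; rewrite rmorphXn.
Qed.

Lemma spoly_pbar p x : spoly (pbar p) x = conjc (spoly p x).
Proof. exact: (@meval_pbar C nu.+1 _ p (conj_sphere_coord x)). Qed.

Lemma sphere_mean_pbar p : E (pbar p) = Num.conj (E p).
Proof.
rewrite /sphere_mean -[RHS](sphere_integral_conj (tame_spoly p)).
by congr sphere_integral; apply/funext => x; exact: spoly_pbar.
Qed.

Lemma sphere_mean_normc p : E (p * pbar p) = (\int[mu]_x (nrm (spoly p x) ^+ 2))%R%:C.
Proof.
rewrite /sphere_mean -sphere_integral_real; congr sphere_integral; apply/funext => x.
by rewrite normc_sqr {1}/spoly mevalM; congr (_ * _); exact: spoly_pbar.
Qed.

Lemma sphere_mean_ge0 p : 0 <= E (p * pbar p).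
Proof. by rewrite sphere_mean_normc ler0c Rintegral_ge0// => x _; exact: sqr_ge0. Qed.

Lemma sphere_mean_vanish q :
  (forall y : 'I_nu.+2 -> C, (forall i, Num.conj (y i) = y i) -> \sum_i y i ^+ 2 = 1 -> meval y q = 0) ->
  E q = 0.
Proof.
move=> q0; rewrite /sphere_mean (_ : spoly q = fun=> 0).
  by rewrite (sphere_integral_real (fun=> 0)) Rintegral_sphere_cst.
by apply/funext => x; apply: q0; [exact: conj_sphere_coord|exact: sqr_sphere_coord].
Qed.

Definition sphere_linform b x : C := \sum_i b i * (tnth x i)%:C.

Lemma spoly_beam s b k x : spoly (s *: linform b ^+ k) x = s * sphere_linform b x ^+ k.
Proof. by rewrite /spoly mevalZ meval_linform. Qed.

Lemma beam_constC k : beam_const C nu.+1 k = (beam_const R nu.+1 k)%:C.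
Proof.
rewrite /beam_const rmorph_prod; apply: eq_bigr => j _.
by rewrite rmorphM fmorphV !rmorph_nat.
Qed.

Section null.
Variable b : 'I_nu.+2 -> C.
Hypotheses (b0 : \sum_i b i ^+ 2 = 0) (b2 : \sum_i nrm (b i) ^+ 2 = 2).

Let b2C : \sum_i `|b i| ^+ 2 = 2.
Proof. by rewrite sum_normc2C b2 rmorph_nat. Qed.

Lemma sphere_linform_le1 x : nrm (sphere_linform b x) <= 1.
Proof.
have := null_linform_le1 b0 b2C (conj_sphere_coord x) (sqr_sphere_coord x).
rewrite normc2C -(rmorph1 (real_complex R)) lecR.
by move=> h; rewrite -(ler_pXn2r (n := 2))// ?expr1n ?nnegrE ?ler01 ?normc_ge0.
Qed.

Lemma integral_sphere_linform m :
  (\int[mu]_x (nrm (sphere_linform b x) ^+ m.*2))%R = beam_const R nu.+1 m.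
Proof.
apply: (@complexI R); rewrite -beam_constC.
have <- : E (linform b ^+ m * pbar (linform b ^+ m)) = beam_const C nu.+1 m.
  exact: (mean_beam_norm (ltn0Sn nu) (@sphere_mean_XU R nu.+1) (@sphere_mean1 R nu.+1) m b0 b2C).
rewrite sphere_mean_normc; congr _%:C; apply: eq_Rintegral => x _.
by rewrite /spoly meval_linform normcX -exprM muln2.
Qed.
End null.
End sphere_mean_properties.
Local Close Scope complex_scope.

Local Open Scope complex_scope.
Local Open Scope sesquilinear_scope.
Section beam_estimates.
Variables (R : rcfType) (nu k : nat).
Hypothesis k_gt0 : (0 < k)%N.
Local Notation gam := (beam_const R nu.+1).
Let W : R := (3 * nu.+1)%:R ^+ nu.

(** The factor that normalizes (b.x)^k in L^2. *)
Definition beam_scale : R := Num.sqrt (gam k)^-1.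
Local Notation s := beam_scale.

Lemma beam_scale_ge0 : 0 <= s. Proof. exact: sqrtr_ge0. Qed.

Lemma beam_scale2 : s ^+ 2 * gam k = 1.
Proof.
have g0 := beam_const_gt0 R nu k.
by rewrite sqr_sqrtr ?mulVf ?gt_eqF// invr_ge0 ltW.
Qed.

Let W1 : 1 <= (nu.+1)%:R ^+ nu :> R.
Proof. by rewrite exprn_ege1// ler1n. Qed.

Let T1 : 1 <= (3 : R) ^+ nu.
Proof. by rewrite exprn_ege1// ler1n. Qed.

Let WE : W = 3 ^+ nu * (nu.+1)%:R ^+ nu.
Proof. by rewrite /W natrM exprMn. Qed.

Lemma beam_scale4 : s ^+ 4 <= 3 ^+ nu * k%:R ^+ nu.
Proof.
have e4 : s ^+ 4 * gam k ^+ 2 = 1.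
  by rewrite (_ : s ^+ 4 = (s ^+ 2) ^+ 2) -?exprMn ?beam_scale2 ?expr1n// -exprM.
have s4 : 0 <= s ^+ 4 by rewrite exprn_ge0// sqrtr_ge0.
have := ler_wpM2l s4 (beam_const_ge R nu k_gt0).
by rewrite mulr1 mulrA e4 mul1r natrM exprMn.
Qed.

Lemma beam_scale6 : s ^+ 6 * gam (3 * k) <= W * k%:R ^+ nu.
Proof.
have g0 := beam_const_gt0 R nu (3 * k).
rewrite -(ler_pXn2r (n := 2))// ?nnegrE; last 2 first.
- by rewrite mulr_ge0 ?exprn_ge0 ?sqrtr_ge0// ltW.
- by rewrite mulr_ge0// exprn_ge0.
have := beam_const_le R nu (3 * k); rewrite natrM exprMn WE.
have := beam_scale4; have := beam_scale_ge0.
have -> : (s ^+ 6 * gam (3 * k)) ^+ 2 = (s ^+ 4) ^+ 3 * gam (3 * k) ^+ 2 by ring.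
have K1 : 1 <= k%:R ^+ nu :> R by rewrite exprn_ege1// ler1n.
have := sqr_ge0 (gam (3 * k)); have : 0 <= s ^+ 4 by rewrite exprn_ge0// sqrtr_ge0.
move: T1 W1 K1; move: (s ^+ 4) (gam _ ^+ 2) (3 ^+ nu) (nu.+1%:R ^+ nu) (k%:R ^+ nu) => s4 g2 T V K T0 V0 K0.
move=> s40 g20 _ s4T gT.
apply: (@le_trans _ _ ((T * K) ^+ 3 * g2)).
  by rewrite ler_wpM2r// lerXn2r// ?nnegrE ?mulr_ge0//; lra.
have TK : 0 <= T * K by rewrite mulr_ge0//; lra.
rewrite exprSr -mulrA [T * K * g2]mulrC.
apply: (@le_trans _ _ ((T * K) ^+ 2 * V)); first by rewrite ler_wpM2l ?sqr_ge0.
rewrite [T * V * K]mulrAC [leRHS]exprMn ler_wpM2l ?sqr_ge0// expr2 ler_peMr//; lra.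
Qed.

(** Bounds the L^1 norm of a beam by a multiple of k^(-nu/4). Fourth powers avoid roots, as the
    bounds on [beam_const] concern its square. *)
Lemma beam_scale_l1 : (s * gam k./2) ^+ 4 * k%:R ^+ nu <= 3 ^+ nu * W ^+ 2.
Proof.
have H : gam k./2 ^+ 2 * k%:R ^+ nu <= W.
  (* [k./2] vanishes only for [k = 1]; otherwise k <= 3 * [k./2]. *)
  have [h0|h0] := posnP k./2.
    rewrite h0 /beam_const big_ord0 expr1n mul1r WE (_ : k = 1%N); last by lia.
    by rewrite expr1n; exact: mulr_ege1.
  rewrite WE; have := beam_const_le R nu k./2; rewrite -(ler_pM2l (_ : 0 < 3 ^+ nu)); last by rewrite exprn_gt0.
  apply: le_trans; rewrite mulrCA ler_wpM2l ?sqr_ge0// -exprMn lerXn2r ?nnegrE//.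
  by rewrite -natrM ler_nat; lia.
have -> : (s * gam k./2) ^+ 4 * k%:R ^+ nu = (s ^+ 4) * (gam k./2 ^+ 2) ^+ 2 * k%:R ^+ nu by ring.
have := beam_scale4; have K0 : 0 <= k%:R ^+ nu :> R by rewrite exprn_ge0.
move: H; have := sqr_ge0 (gam k./2).
move: T1 K0; move: (s ^+ 4) (gam _ ^+ 2) (3 ^+ nu) (k%:R ^+ nu) W => s4 g2 T K W' T0 K0 g0 gW sT.
apply: (@le_trans _ _ (T * K * g2 ^+ 2 * K)).
  by rewrite ler_wpM2r// ler_wpM2r// sqr_ge0.
rewrite (_ : T * K * _ * _ = T * (g2 * K) ^+ 2); last by ring.
by rewrite ler_wpM2l//; [lra|rewrite lerXn2r// nnegrE ?mulr_ge0// (le_trans _ gW)// mulr_ge0].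
Qed.
End beam_estimates.
Local Close Scope sesquilinear_scope.
Local Close Scope complex_scope.

Local Open Scope complex_scope.
Local Open Scope sesquilinear_scope.
Section modulus.
Context {R : realType} {n : nat}.
Local Notation nrm := (@Normc.normc R).
Implicit Types f : sphere R n -> R[i].

Lemma measurable_normc f : tame f -> measurable_fun setT (fun x => nrm (f x)).
Proof.
move=> /tame_normc2[mf _]; under eq_fun do rewrite -[nrm _]ger0_norm ?normc_ge0// -sqrtr_sqr.
exact: (measurableT_comp (@measurable_sqrt R)).
Qed.

Lemma integrable_normc f k : tame f ->
  (@sphere_measure R n).-integrable setT (EFin \o (fun x => nrm (f x) ^+ k)).
Proof.
move=> tf; have [_ [M hM]] := tame_normc2 tf.
apply: (@bounded_sphere_integrable _ _ _ ((1 + M) ^+ k)).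
  by apply: measurable_funX; exact: measurable_normc.
move=> x; rewrite ger0_norm ?exprn_ge0 ?normc_ge0//.
have := hM x; have := normc_ge0 (f x); move: (nrm _) => r r0 rM.
by rewrite lerXn2r// ?nnegrE; nra.
Qed.
End modulus.

(** Rounding the halves up keeps at least one beam and costs only the +1 in 2 M' <= N + 1. *)
Lemma selection_size M N T X K : (0 < M)%N -> (0 < N)%N -> (0 < T * K)%N ->
  (X <= K * M)%N -> (N <= 2 * (T * X))%N ->
  exists M', [/\ (0 < M')%N, (M' <= M)%N, (2 * M' <= N.+1)%N & (N <= 4 * (T * K) * M')%N].
Proof.
move=> M0 N0 TK XM NX; exists (minn (uphalf M) (uphalf N)); split; try lia.
have [MN|NM] := leqP (uphalf M) (uphalf N).
  apply: leq_trans NX _; apply: (@leq_trans (2 * (T * (K * (2 * uphalf M))))%N); last by lia.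
  rewrite !leq_mul2l (leq_trans XM) ?orbT// leq_mul2l; apply/orP; right; lia.
apply: (@leq_trans (4 * uphalf N)%N); first by lia.
by rewrite leq_mul2r leq_pmulr ?orbT.
Qed.

Section flat_onb.
Context {R : realType} {nu : nat}.
Hypothesis nu_gt0 : (0 < nu)%N.
Local Notation C := R[i].
Local Notation S := (sphere R nu.+1).
Local Notation P := (mpoly nu.+2 C).
Local Notation mu := (@sphere_measure R nu.+1).
Local Notation nrm := (@Normc.normc R).
Local Notation E := (@sphere_mean R nu.+1 : {scalar P}).
Let EXU := @sphere_mean_XU R nu.+1.
Let E1 := @sphere_mean1 R nu.+1.

Let K := ((64 * nu ^ 2) ^ (nu * 2))%N.
Let L := (4 * (2 ^ nu * K))%N.
Let W : R := (3 * nu.+1)%:R ^+ nu.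

Section beams.
Variables (k : nat) (b : 'I_nu.+2 -> C).
Hypotheses (k_gt0 : (0 < k)%N) (b0 : \sum_i b i ^+ 2 = 0) (b2 : \sum_i nrm (b i) ^+ 2 = 2).
Local Notation s := (beam_scale R nu k).
Let q : P := s%:C *: linform b ^+ k.

Lemma normc_beam x : nrm (spoly q x) = s * nrm (sphere_linform b x) ^+ k.
Proof. by rewrite spoly_beam Normc.normcM normc_real ?beam_scale_ge0// normcX. Qed.

Lemma normc_beam_le x : nrm (spoly q x) <= s.
Proof.
rewrite normc_beam ler_piMr ?beam_scale_ge0// exprn_ile1 ?normc_ge0//.
exact: sphere_linform_le1.
Qed.

Lemma integral_beam6 : (\int[mu]_x (nrm (spoly q x) ^+ 6))%R = s ^+ 6 * beam_const R nu.+1 (3 * k).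
Proof.
rewrite -(integral_sphere_linform b0 b2) -RintegralZl//.
  apply: eq_Rintegral => x _; rewrite normc_beam exprMn -exprM.
  by rewrite (_ : (k * 6)%N = (3 * k).*2); last lia.
apply: integrable_normc_pow; have := tame_spoly (linform b); congr tame; apply/funext => x.
by have := spoly_beam 1 b 1 x; rewrite scale1r !expr1 mul1r.
Qed.

(** The exact formula is for even exponents; since |b.x| <= 1, the exponent k may be rounded down to
    [k./2.*2]. *)
Lemma integral_beam1 : (\int[mu]_x (nrm (spoly q x)))%R <= s * beam_const R nu.+1 k./2.
Proof.
have tb : tame (sphere_linform b).
  have := tame_spoly (linform b); congr tame; apply/funext => x.
  by have := spoly_beam 1 b 1 x; rewrite scale1r !expr1 mul1r.
have ti m := integrable_normc m tb.
rewrite -(integral_sphere_linform b0 b2) -RintegralZl//.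
apply: le_Rintegral => //.
- by have := integrable_normc 1 (tame_spoly q); under eq_fun do rewrite expr1.
- have := integrableZl measurableT s (ti k./2.*2).
  by under eq_fun do rewrite /= -EFinM.
move=> x _; rewrite normc_beam ler_wpM2l ?beam_scale_ge0//.
by rewrite ler_wiXn2l ?normc_ge0 ?sphere_linform_le1//; lia.
Qed.

Lemma herm_beam_scale c : herm E q (s%:C *: linform c ^+ k) = ((\sum_i b i * Num.conj (c i)) / 2) ^+ k.
Proof.
rewrite (herm_beam (ltn0Sn nu) EXU E1 _ _ _ b0).
rewrite [Num.conj _]conjc_real beam_constC -!rmorphM -expr2 beam_scale2.
by rewrite rmorph1 mul1r.
Qed.
End beams.

(** With X = k^(nu/4), the conditions on [a] and [b] say that the test function [q] has L^1 norm
    O(1/X) and supremum O(X), in fourth powers so that only integral powers of k occur. *)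
Lemma flat_onb : exists2 A : R, 1 <= A & forall k, (0 < k)%N ->
  exists N, exists2 g : 'I_N -> P, onb E k g & forall i,
    (\int[mu]_x (nrm (spoly (g i) x) ^+ 6))%R <= A * k%:R ^+ nu /\
    exists (q : P) (a b : R), [/\ forall x, nrm (spoly q x) <= b,
      (\int[mu]_x (nrm (spoly q x)))%R <= a, 0 <= a /\ a ^+ 4 * k%:R ^+ nu <= A,
      0 <= b /\ b ^+ 4 <= A * k%:R ^+ nu & A^-1 <= nrm (herm E (g i) q)].
Proof.
have W1 : 1 <= W by rewrite exprn_ege1// ler1n.
pose A1 : R := 5 ^+ 6 * (60 * 27 * (2 * W)).
pose A2 : R := 2 * L%:R.
pose A3 : R := 3 ^+ nu * W ^+ 2.
have A10 : 0 <= A1 by rewrite /A1 !mulr_ge0//; lra.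
have L1 : (0 < L)%N by rewrite !(muln_gt0, expn_gt0) nu_gt0.
have A21 : 1 <= A2.
  have : (1 : R) <= L%:R by rewrite ler1n.
  by rewrite /A2; lra.
have T1 : 1 <= (3 : R) ^+ nu by rewrite exprn_ege1// ler1n.
have W2 : 1 <= W ^+ 2 by exact: exprn_ege1.
have T0 : 0 <= (3 : R) ^+ nu by rewrite exprn_ge0.
have T3 : 3 ^+ nu <= A3 by rewrite /A3 ler_peMr.
have A31 := le_trans T1 T3.
exists (A1 + A2 + A3); first lra.
move=> k k0.
have k1 : 1 <= k%:R ^+ nu :> R by rewrite exprn_ege1// ler1n.
have [N [f bf]] := onb_exists EXU E1 (@sphere_mean_pbar R nu) (@sphere_mean_ge0 R nu) k.
(* For [N = 0] the claims on the elements of the basis are vacuous. *)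
have [N0|N0] := posnP N; first by exists N, f => // i; have := ltn_ord i; rewrite {2}N0.
have NK : (N <= 2 * (2 * k) ^ nu)%N.
  have := onf_leq bf.1.
  by move=> /leq_trans; apply; rewrite leq_mul2l leq_exp2r//= mul2n -addnn -addn1 leq_add2l.
pose u j := spoly (f j).
have tu j : tame (u j) by exact: tame_spoly.
have sum_u x : \sum_j nrm (u j x) ^+ 2 = N%:R.
  apply: (@complexI R); rewrite -sum_normc2C rmorph_nat.
  apply: (reproducing_sphere (ltn0Sn nu) EXU E1 (@sphere_mean_pbar R nu) (x := fun i => (tnth x i)%:C) bf).
  - exact: sphere_mean_vanish.
  - exact: conj_sphere_coord.
  - exact: sqr_sphere_coord.
have [M kM hM] := beam_family R nu_gt0 k0.
have M0 : (0 < M)%N.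
  by rewrite lt0n; apply: contraTneq kM => ->; rewrite muln0 leqn0 expn_eq0 gtn_eqF.
have [M' [M'0 M'M M'N NM']] : exists M', [/\ (0 < M')%N, (M' <= M)%N, (2 * M' <= N.+1)%N & (N <= L * M')%N].
  apply: selection_size kM _ => //; last by rewrite -expnMn.
  by rewrite !(muln_gt0, expn_gt0) nu_gt0.
have [b [b0 b2 bb]] := hM M' M'M.
pose s := beam_scale R nu k.
pose q i : P := s%:C *: linform (b i) ^+ k.
have hq i : harmonic k (q i) by exact: harmonic_beam.
pose Q : 'M[C]_(M', N) := \matrix_(i, j) herm E (q i) (f j).
have QQ i j : (Q *m Q ^t*) i j = ((\sum_l b i l * Num.conj (b j l)) / 2) ^+ k.
  rewrite -herm_beam_scale// (parseval bf (hq i) (hq j)) mxE.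
  by apply: eq_bigr => l _; rewrite !mxE.
have combq i x : comb u (row i Q) x = spoly (q i) x.
  rewrite /comb /spoly (meval_onb _ bf (hq i)).
  by apply: eq_bigr => j _; rewrite !mxE.
(* [2 * W * k%:R ^+ nu] bounds both the dimension, by [NK] and 2 <= 3 (nu + 1), and the sixth
   moments of the beams. *)
have [|i|i|i|U Uu UQ] := @mixed_basis R nu.+1 N u tu sum_u M' Q L (2 * W * k%:R ^+ nu) M'0 M'N NM'.
- apply: (@le_trans _ _ (2 * (2 * k) ^ nu)%:R); first by rewrite ler_nat.
  rewrite natrM natrX natrM exprMn -mulrA ler_wpM2l// ler_wpM2r ?exprn_ge0//.
  by rewrite lerXn2r ?nnegrE// ler_nat mulnS.
- by rewrite QQ (eq_bigr (fun l => `|b i l| ^+ 2)) ?sum_normc2C ?b2 ?rmorph_nat ?divff ?expr1n// => l _; rewrite normCK.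
- by apply: le_trans (bb i); apply: ler_sum => j _; rewrite QQ normcX.
- rewrite /int6; under eq_Rintegral do rewrite combq.
  rewrite integral_beam6//; apply: le_trans (beam_scale6 R nu k0) _.
  by rewrite -mulrA ler_peMl ?mulr_ge0 ?exprn_ge0//; lra.
pose g i : P := \sum_j U i j *: f j.
have spg i x : spoly (g i) x = comb u (row i U) x.
  rewrite /spoly /g raddf_sum; apply: eq_bigr => j _ /=.
  by rewrite mevalZ !mxE.
exists N, g; first exact: onb_unitary.
move=> i; have [Ui [c Uc]] := UQ i; split.
  under eq_Rintegral do rewrite spg.
  apply: le_trans Ui _; rewrite !mulrA ler_wpM2r ?exprn_ge0//.
  by move: A21 A31; rewrite /A1 !mulrA; lra.
have s0 := beam_scale_ge0 R nu k.
exists (q c), (s * beam_const R nu.+1 k./2), s; split.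
- by move=> x; exact: normc_beam_le.
- exact: integral_beam1.
- split; first by rewrite mulr_ge0// ltW// beam_const_gt0.
  by apply: le_trans (beam_scale_l1 R nu k0) _; rewrite -/W -/A3; lra.
- split=> //; apply: le_trans (beam_scale4 R nu k0) _.
  by rewrite ler_wpM2r ?exprn_ge0//; lra.
apply: le_trans (_ : _ <= A2^-1) _; first by rewrite lef_pV2 ?posrE; lra.
apply: le_trans Uc _; rewrite le_eqVlt; apply/orP; left; apply/eqP; congr (nrm _).
rewrite mxE /g herm_suml; apply: eq_bigr => j _.
by rewrite hermZl !mxE -(herm_conj (@sphere_mean_pbar R nu)).
Qed.
End flat_onb.
Local Close Scope sesquilinear_scope.
Local Close Scope complex_scope.

(** * From sixth moments to Lp norms *)

Local Open Scope complex_scope.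
Section power_interpolation.
Variable R : realType.
Implicit Types t l p : R.

(** The first term dominates for t <= l, the second for t >= l since p <= 6. Used in place of
    Hoelder's inequality. *)
Lemma powR_interpolation t l p : 0 <= t -> 0 < l -> 2 < p <= 6 ->
  t `^ p <= l `^ (p - 2) * t ^+ 2 + l `^ (p - 6) * t ^+ 6.
Proof.
move=> t0 l0 /andP[p2 p6].
have [->|tn0] := eqVneq t 0.
  by rewrite powR0 ?addr_ge0 ?mulr_ge0 ?powR_ge0 ?exprn_ge0//; lra.
have tp : 0 < t by rewrite lt0r tn0.
have tE n : t `^ p = t `^ (p - n%:R) * t ^+ n.
  by rewrite -powR_mulrn// -powRD ?subrK// tn0 implybT.
have [tl|/ltW lt] := leP t l.
  apply: (@le_trans _ _ (l `^ (p - 2) * t ^+ 2)); last by rewrite lerDl mulr_ge0 ?powR_ge0 ?exprn_ge0.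
  rewrite (tE 2) ler_wpM2r ?exprn_ge0//.
  by rewrite ge0_ler_powR// ?nnegrE; lra.
apply: (@le_trans _ _ (l `^ (p - 6) * t ^+ 6)); last by rewrite lerDr mulr_ge0 ?powR_ge0 ?exprn_ge0.
rewrite (tE 6) ler_wpM2r ?exprn_ge0//.
rewrite -[p - 6]opprB !powRN lef_pV2 ?posrE ?powR_gt0//.
by rewrite ge0_ler_powR// ?nnegrE; lra.
Qed.

Lemma le_powR_threshold t l p : 0 <= t -> 0 < l -> 1 < p ->
  t <= l + l `^ (1 - p) * t `^ p.
Proof.
move=> t0 l0 p1; have [tl|/ltW lt] := leP t l.
  by rewrite (le_trans tl)// lerDl mulr_ge0 ?powR_ge0.
have tp : 0 < t by exact: lt_le_trans lt.
apply: (@le_trans _ _ (l `^ (1 - p) * t `^ p)); last by rewrite lerDr ltW.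
rewrite [leLHS](_ : t = t `^ (1 - p) * t `^ p); last by rewrite -powRD ?subrK ?powRr1// gt_eqF ?implybT.
rewrite ler_wpM2r ?powR_ge0// -[1 - p]opprB !powRN lef_pV2 ?posrE ?powR_gt0//.
by rewrite ge0_ler_powR// ?nnegrE; lra.
Qed.
End power_interpolation.

Section Lp_norms.
Context {R : realType} {n : nat}.
Local Notation C := R[i].
Local Notation mu := (@sphere_measure R n).
Local Notation nrm := (@Normc.normc R).
Implicit Types (f q : sphere R n -> C) (p : R).

Lemma normc_sphere_integral f : tame f ->
  nrm (sphere_integral f) <= (\int[mu]_x (nrm (f x)))%R.
Proof.
move=> tf; set z := sphere_integral f.
have ReE (w : C) : complex.Re w <= nrm w.
  case: w => a b /=; apply: le_trans (ler_norm _) _.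
  by rewrite -sqrtr_sqr ler_wsqrtr// lerDl sqr_ge0.
have zz : nrm z ^+ 2 = (\int[mu]_x (complex.Re (conjc z * f x)))%R.
  have /(congr1 (@complex.Re R)) := sphere_integralZ (conjc z) tf.
  rewrite /= => ->; rewrite -/z; case: z => a b /=.
  by rewrite sqr_sqrtr ?addr_ge0 ?sqr_ge0//; ring.
have i1 : mu.-integrable setT (EFin \o (fun x => nrm (f x))).
  by have := integrable_normc 1 tf; under eq_fun do rewrite expr1.
have nc : nrm (conjc z) = nrm z := normc_conj z.
have : nrm z ^+ 2 <= nrm z * (\int[mu]_x (nrm (f x)))%R.
  rewrite zz -RintegralZl//; apply: le_Rintegral => //.
  - by have [] := tame_integrable (tameM (tame_cst (conjc z)) tf).
  - by have := integrableZl measurableT (nrm z) i1; under eq_fun do rewrite /= -EFinM.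
  by move=> x _; rewrite (le_trans (ReE _))// Normc.normcM nc.
have [->|z0] := eqVneq (nrm z) 0; first by move=> _; apply: Rintegral_ge0 => x _; exact: normc_ge0.
by rewrite expr2 ler_pM2l// lt0r z0 normc_ge0.
Qed.

Lemma integrable_normc_powR f p : 0 < p -> tame f ->
  mu.-integrable setT (EFin \o (fun x => nrm (f x) `^ p)).
Proof.
move=> p0 tf; have [_ [M hM]] := tame_normc2 tf.
apply: (@bounded_sphere_integrable _ _ _ ((1 + M) `^ p)).
  by apply: (measurableT_comp (measurable_powR _)); exact: measurable_normc.
move=> x; rewrite ger0_norm ?powR_ge0//.
have := hM x; have := normc_ge0 (f x); move: (nrm _) => r r0 rM.
by rewrite ge0_ler_powR ?nnegrE ?(ltW p0)//; nra.
Qed.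

Lemma Lp_normE f p : 0 < p -> tame f ->
  Lp_norm p f = ((\int[mu]_x (nrm (f x) `^ p))%R `^ p^-1)%:E.
Proof.
move=> p0 tf; rewrite /Lp_norm unlock -poweR_EFin; congr (_ `^ _)%E.
rewrite fineK; last first.
  by apply: integrable_fin_num => //; exact: integrable_normc_powR.
apply: eq_integral => x _.
by rewrite abse_EFin ger0_norm ?normc_ge0// poweR_EFin.
Qed.

Section bounds.
Variables (f q : sphere R n -> C) (A X a b p : R).
Hypotheses (tf : tame f) (tq : tame q) (A1 : 1 <= A) (X0 : 0 < X) (p2 : 2 < p <= 6).
Hypothesis f2 : (\int[mu]_x (nrm (f x) ^+ 2))%R = 1.
Hypothesis f6 : (\int[mu]_x (nrm (f x) ^+ 6))%R <= A * X ^+ 4.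
Let I := (\int[mu]_x (nrm (f x) `^ p))%R.

Let p0 : 0 < p. Proof. by case/andP: p2; lra. Qed.
Let I0 : 0 <= I. Proof. by apply: Rintegral_ge0 => x _; exact: powR_ge0. Qed.

(** The threshold l = X balances the two terms: X^(p-2) from the second moment and A X^(p-6) X^4
    from the sixth. *)
Lemma Lp_norm_le : (Lp_norm p f <= ((2 * A ^+ 2) * X `^ (1 - 2 / p))%:E)%E.
Proof.
have A1' := A1.
have IA : I <= (1 + A) * X `^ (p - 2).
  apply: (@le_trans _ _ (\int[mu]_x (X `^ (p - 2) * nrm (f x) ^+ 2 + X `^ (p - 6) * nrm (f x) ^+ 6))%R).
    apply: le_Rintegral => //; first exact: integrable_normc_powR.
      have := integrableD measurableT (integrableZl measurableT (X `^ (p - 2)) (integrable_normc 2 tf))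
        (integrableZl measurableT (X `^ (p - 6)) (integrable_normc 6 tf)).
      by under eq_fun do rewrite /= -!EFinM -EFinD.
    by move=> x _; exact: powR_interpolation (normc_ge0 _) X0 p2.
  have iZ c k : mu.-integrable setT (EFin \o (fun x => c * nrm (f x) ^+ k)).
    by have := integrableZl measurableT c (integrable_normc k tf); under eq_fun do rewrite /= -EFinM.
  rewrite RintegralD ?RintegralZl//; try (exact: integrable_normc || exact: iZ).
  rewrite f2 mulr1 mulrDl mul1r lerD2l.
  apply: (@le_trans _ _ (X `^ (p - 6) * (A * X ^+ 4))); first by rewrite ler_wpM2l ?powR_ge0.
  rewrite mulrCA -(powR_mulrn 4 (ltW X0)) -powRD ?(gt_eqF X0) ?implybT//.
  by rewrite (_ : p - 6 + 4%:R = p - 2)//; ring.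
rewrite (Lp_normE p0 tf) lee_fin.
apply: (@le_trans _ _ (((1 + A) * X `^ (p - 2)) `^ p^-1)).
  apply: ge0_ler_powR; rewrite ?nnegrE ?invr_ge0 ?(ltW p0)//.
  by rewrite mulr_ge0 ?powR_ge0//; move: A1; lra.
have A0 : 0 <= 1 + A by rewrite addr_ge0// (le_trans _ A1).
rewrite (powRM _ A0 (powR_ge0 _ _)).
rewrite -powRrM mulrBl divff ?gt_eqF// ler_wpM2r ?powR_ge0//.
apply: (@le_trans _ _ (1 + A)); last by nra.
rewrite ler1_powR//; first lra.
by rewrite invf_le1//; case/andP: p2; lra.
Qed.

Hypothesis qb : forall x, nrm (q x) <= b.
Hypothesis qa : (\int[mu]_x (nrm (q x)))%R <= a.
Hypotheses (a0 : 0 <= a) (aX : a ^+ 4 * X ^+ 4 <= A) (b0 : 0 <= b) (bX : b ^+ 4 <= A * X ^+ 4).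
Hypothesis fq : A^-1 <= nrm (inner_product f q).

(** Where |f| is at most a threshold l, its pairing with q is at most l times the L^1 norm of q; the
    rest is bounded by the p-th moment of f and the supremum of q. As the pairing is at least 1/A,
    the p-th moment cannot be small. *)
Lemma Lp_norm_ge : (((2 * A ^+ 2)^-1 * X `^ (1 - 2 / p))%:E <= Lp_norm p f)%E.
Proof.
have A1' := A1.
have A4 : A <= A ^+ 4 by rewrite ler_eXnr.
have aXA : a * X <= A.
  rewrite -(ler_pXn2r (n := 4))// ?nnegrE ?mulr_ge0 ?(ltW X0)//; last lra.
  by rewrite exprMn (le_trans aX).
have bXA : b <= A * X.
  rewrite -(ler_pXn2r (n := 4))// ?nnegrE ?mulr_ge0 ?(ltW X0)//; last lra.
  by rewrite (le_trans bX)// exprMn ler_wpM2r// exprn_ge0// ltW.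
have A20 : 0 < 2 * A ^+ 2 by rewrite mulr_gt0// exprn_gt0//; lra.
(* Chosen so that l a <= 1 / (2 A), because a X <= A: half of the lower bound 1/A is left for the
   p-th moment. *)
pose l := X / (2 * A ^+ 2).
have l0 : 0 < l by rewrite divr_gt0.
have ip := integrable_normc_powR p0 tf.
have iq : mu.-integrable setT (EFin \o (fun x => nrm (q x))).
  by have := integrable_normc 1 tq; under eq_fun do rewrite expr1.
have tfq : tame (fun x => f x * conjc (q x)) by apply: tameM => //; exact: tame_conj.
have H : A^-1 <= l * a + l `^ (1 - p) * (A * X) * I.
  apply: le_trans fq _; apply: le_trans (normc_sphere_integral tfq) _.
  have i1 : mu.-integrable setT (EFin \o (fun x => l * nrm (q x))).
    by have := integrableZl measurableT l iq; under eq_fun do rewrite /= -EFinM.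
  have i2 : mu.-integrable setT (EFin \o (fun x => l `^ (1 - p) * (A * X) * nrm (f x) `^ p)).
    by have := integrableZl measurableT (l `^ (1 - p) * (A * X)) ip; under eq_fun do rewrite /= -EFinM.
  apply: (@le_trans _ _ (\int[mu]_x (l * nrm (q x) + l `^ (1 - p) * (A * X) * nrm (f x) `^ p))%R).
    apply: le_Rintegral => //.
    - by have := integrable_normc 1 tfq; under eq_fun do rewrite expr1.
    - by have := integrableD measurableT i1 i2; under eq_fun do rewrite /= -EFinD.
    move=> x _; rewrite Normc.normcM (_ : nrm (conjc (q x)) = nrm (q x)); last exact: normc_conj.
    have p1 : 1 < p by case/andP: p2; lra.
    have := le_powR_threshold (normc_ge0 (f x)) l0 p1.
    move: (powR_ge0 (nrm (f x)) p) (powR_ge0 l (1 - p)) (normc_ge0 (q x)) (le_trans (qb x) bXA).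
    move: (l `^ (1 - p)) (nrm (f x)) (nrm (q x)) (A * X) => v w z c u0 v0 z0 zc wuv.
    move: (w `^ p) u0 wuv => u u0 wuv.
    apply: (@le_trans _ _ ((l + v * u) * z)); first by rewrite ler_wpM2r.
    by rewrite mulrDl lerD2l [leLHS]mulrAC ler_wpM2r// ler_wpM2l.
  rewrite RintegralD// !RintegralZl// lerD2r ler_wpM2l// ltW//.
have lI : l `^ p <= X ^+ 2 * I.
  have la : l * a <= A^-1 / 2.
    rewrite /l mulrAC [X * a]mulrC ler_pdivrMr// (_ : A^-1 / 2 * _ = A)//; field; lra.
  have : A^-1 / 2 <= l `^ (1 - p) * (A * X) * I by lra.
  rewrite -(ler_pM2l (powR_gt0 p l0)) !mulrA -powRD ?(gt_eqF l0) ?implybT//.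
  rewrite [p + _]addrC subrK powRr1 ?(ltW l0)//.
  have -> : l * A * X * I = (X ^+ 2 * I) * (A^-1 / 2) by rewrite /l; field; lra.
  by rewrite -mulrA ler_pM2r// divr_gt0// invr_gt0; lra.
rewrite (Lp_normE p0 tf) lee_fin -/I.
have lX : l <= X `^ (2 / p) * I `^ p^-1.
  have -> : X `^ (2 / p) * I `^ p^-1 = (X ^+ 2 * I) `^ p^-1.
    by rewrite powRM ?sqr_ge0// powRrM (powR_mulrn 2 (ltW X0)).
  have {1}-> : l = (l `^ p) `^ p^-1 by rewrite -powRrM divff ?gt_eqF// powRr1// ltW.
  have XI : 0 <= X ^+ 2 * I by exact: mulr_ge0 (sqr_ge0 _) I0.
  have pV : 0 <= p^-1 by rewrite invr_ge0 ltW.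
  exact: (ge0_ler_powR pV (powR_ge0 _ _) XI lI).
rewrite powRB ?(gt_eqF X0) ?implybT// powRr1 ?(ltW X0)// mulrA [_^-1 * X]mulrC.
by rewrite ler_pdivrMr ?powR_gt0// [leRHS]mulrC.
Qed.
End bounds.
End Lp_norms.
Local Close Scope complex_scope.

(** * Bases and dimension *)

Section bases.
Context {T : Type} {K : fieldType}.
Implicit Types (V : set (T -> K)).

(** Uniqueness of coordinates with respect to [b'] makes the product of the two transition matrices
    the identity, which forces the inequality of sizes. *)
Lemma basis_size_le V N N' (b : 'I_N -> T -> K) (b' : 'I_N' -> T -> K) :
  is_basis V b -> is_basis V b' -> (N' <= N)%N.
Proof.
move=> [Vb Eb] [Vb' Eb'].
have /choice[A HA] : forall i, exists c : {ffun 'I_N -> K}, b' i = fun x => \sum_j c j * b j x.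
  by move=> i; have [c [Hc _]] := Eb _ (Vb' i); exists c.
have /choice[B HB] : forall j, exists c : {ffun 'I_N' -> K}, b j = fun x => \sum_i c i * b' i x.
  by move=> j; have [c [Hc _]] := Eb' _ (Vb j); exists c.
pose A' : 'M[K]_(N', N) := \matrix_(i, j) A i j.
pose B' : 'M[K]_(N, N') := \matrix_(j, i) B j i.
apply: (@mulmx1_min _ _ _ A' B'); apply/matrixP => i l.
have [c [_ Uc]] := Eb' _ (Vb' i).
have c1 : c = [ffun l => (A' *m B') i l].
  apply: Uc; rewrite HA; apply/funext => x.
  under eq_bigr => j _ do rewrite HB mulr_sumr.
  rewrite exchange_big; apply: eq_bigr => m _ /=.
  by rewrite ffunE mxE mulr_suml; apply: eq_bigr => j _; rewrite !mxE mulrA.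
have c2 : c = [ffun l => (i == l)%:R].
  apply: Uc; apply/funext => x; rewrite (bigD1 i)//= ffunE eqxx mul1r big1 ?addr0// => m mi.
  by rewrite ffunE eq_sym (negbTE mi) mul0r.
by have := c1; rewrite c2 => /ffunP/(_ l); rewrite !ffunE => <-; rewrite mxE.
Qed.

Lemma dimension_basis V N (b : 'I_N -> T -> K) : is_basis V b -> dimension V = N.
Proof.
move=> bV; rewrite /dimension.
have [|b' bV'] := @xgetPex _ 0%N [set N | exists b : 'I_N -> T -> K, is_basis V b].
  by exists N; exists b.
by apply/eqP; rewrite eqn_leq (basis_size_le bV bV') (basis_size_le bV' bV).
Qed.
End bases.

Local Open Scope complex_scope.
Section onb_basis.
Context {R : realType} {nu : nat}.
Local Notation C := R[i].
Local Notation S := (sphere R nu.+1).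
Local Notation P := (mpoly nu.+2 C).
Local Notation mu := (@sphere_measure R nu.+1).
Local Notation nrm := (@Normc.normc R).
Local Notation E := (@sphere_mean R nu.+1 : {scalar P}).
Implicit Types (p q : P).

Lemma inner_product_spoly p q : inner_product (spoly p) (spoly q) = herm E p q.
Proof.
rewrite /inner_product /herm /= /sphere_mean; congr sphere_integral; apply/funext => x.
by rewrite -spoly_pbar /spoly mevalM.
Qed.

Lemma spherical_harmonic_spoly k p : harmonic k p -> spherical_harmonic R nu.+1 k (spoly p).
Proof. by move=> [hp lp]; exists (DHomog hp). Qed.

Lemma spoly_lincomb N (c : 'I_N -> C) (g : 'I_N -> P) :
  spoly (\sum_j c j *: g j) = fun x => \sum_j c j * spoly (g j) x.
Proof.
apply/funext => x; rewrite /spoly raddf_sum; apply: eq_bigr => j _ /=.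
by rewrite mevalZ.
Qed.

Lemma onb_is_basis k N (g : 'I_N -> P) : onb E k g ->
  is_basis (spherical_harmonic R nu.+1 k) (fun j => spoly (g j)).
Proof.
move=> [og gE]; split; first by move=> j; apply: spherical_harmonic_spoly; have [] := og.
move=> v [[p hp] /= lp vE]; have vp : v = spoly p by [].
exists [ffun j => herm E p (g j)]; split.
  rewrite vp {1}(gE p (conj hp lp)) spoly_lincomb; apply/funext => x.
  by apply: eq_bigr => j _; rewrite ffunE.
move=> c cE; apply/ffunP => j; rewrite ffunE -inner_product_spoly -vp cE.
rewrite -(spoly_lincomb c g) inner_product_spoly.
exact: herm_onf og.
Qed.

Lemma onb_orthonormal k N (g : 'I_N -> P) : onb E k g ->
  orthonormal_family (fun j => spoly (g j)).
Proof. by move=> [[_ og] _] i j; rewrite inner_product_spoly. Qed.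

Lemma onb_integral2 k N (g : 'I_N -> P) i : onb E k g ->
  (\int[mu]_x (nrm (spoly (g i) x) ^+ 2))%R = 1.
Proof.
move=> [[_ og] _]; apply: (@complexI R); rewrite -sphere_mean_normc.
by have := og i i; rewrite eqxx.
Qed.
End onb_basis.
Local Close Scope complex_scope.

Theorem theorem3 (R : realType) (n : nat) (hn : (2 <= n)%N) :
  let pn : R := 2 * (n%:R + 1) / (n%:R - 1) in
  exists Cnp : R -> R,
    (forall p : R, 2 < p <= pn -> 1 <= Cnp p) /\
    forall k : nat, (1 <= k)%N ->
      exists u : 'I_(dimension (spherical_harmonic R n k)) ->
          sphere R n -> R[i],
        [/\ is_basis (spherical_harmonic R n k) u,
            orthonormal_family u &
            forall j (p : R), 2 < p <= pn ->
              let e := (n%:R - 1) / 4 - (n%:R - 1) / (2 * p) in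
              (((Cnp p)^-1 * k%:R `^ e)%:E <= Lp_norm p (u j))%E /\
              (Lp_norm p (u j) <= (Cnp p * k%:R `^ e)%:E)%E].
Proof.
case: n hn => [//|nu]; rewrite ltnS => nu0 pn.
have n1 : nu.+1%:R - 1 = nu%:R :> R by rewrite -natr1 addrK.
have [A A1 HA] := @flat_onb R nu nu0.
have pn6 : pn <= 6.
  rewrite /pn n1 ler_pdivrMr ?ltr0n//.
  have : 1 <= nu%:R :> R by rewrite ler1n.
  by rewrite -natr1; lra.
(* The constant does not depend on p, since only the second and sixth moments and the pairing with a
   beam enter. *)
exists (fun=> 2 * A ^+ 2); split; first by move=> _ _; nra.
move=> k k0; have [N [g bg Hg]] := HA k k0.
have bV := onb_is_basis bg; have dN := dimension_basis bV.
subst N; exists (fun j => spoly (g j)); split => //; first exact: onb_orthonormal bg.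
move=> j p /andP[p2 pp] e.
pose X : R := k%:R `^ (nu%:R / 4).
have X0 : 0 < X by rewrite powR_gt0// ltr0n.
have X4 : X ^+ 4 = k%:R ^+ nu.
  by rewrite -powR_mulrn ?ltW// -powRrM divfK// powR_mulrn.
(* The exponent is (nu/4) (1 - 2/p), so the claim is a power of X. *)
have eE : k%:R `^ e = X `^ (1 - 2 / p).
  by rewrite -powRrM /e n1; congr (_ `^ _); field; lra.
have p6 : 2 < p <= 6 by rewrite p2 (le_trans pp).
have [g6 [q [a [b [qb qa [a0 aX] [b0 bX] gq]]]]] := Hg j.
rewrite -X4 in g6 aX bX; rewrite -inner_product_spoly in gq.
have g2 := onb_integral2 j bg.
rewrite eE; split.
  exact: (Lp_norm_ge (tame_spoly (g j)) (tame_spoly q) A1 X0 p6 qb qa a0 aX b0 bX gq).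
exact: (Lp_norm_le (tame_spoly (g j)) A1 X0 p6 g2 g6).
Qed.
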